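(* Let $p\in(3,\infty)$ and let $\alpha=\alpha(p/(p-1))$, where $\alpha(\cdot)$ is the function on $(1,3/2)$ defined in the context. Then there exist a function $a\in\mathfrak{A}(1,\alpha)$ and a function $f\in L_p(Q)$ such that the equation $$u_t=a\,u_{xx}+f\quad\text{in } Q$$ does not have solutions in the class $\overset{0}{W}{}^{1,2}_p(Q)$.
   Context: $Q=(0,1)\times\mathbb{R}$, with points written $(t,x)$. For $0<\beta\le\alpha<\infty$, $\mathfrak{A}(\beta,\alpha)$ is the set of Borel functions $a(t,x)$ on $Q$ with $\beta\le a(t,x)\le\alpha$ for all $(t,x)\in Q$. For $p\in(1,\infty)$, $W^{1,2}_p$ is the Sobolev space of functions $u(t,x)$ on $\mathbb{R}^2$ such that $u,u_x,u_{xx},u_t\in L_p(\mathbb{R}^2)$, and $\overset{0}{W}{}^{1,2}_p(Q)$ is the set of restrictions to $Q$ of functions in $W^{1,2}_p$ that are identically zero for $t\le0$. Equations are understood almost everywhere in $Q$. Definition of $\alpha(\cdot)$. For $\gamma\in(0,1)$ put $\lambda=\gamma-1\in(-1,0)$, $\phi_\lambda(x)=\int_0^\infty e^{-2xr-r^2}r^{-1-\lambda}\,dr$, $u_\lambda(x)=\phi_\lambda(x)+\phi_\lambda(-x)$. There is a unique $c_{0\lambda}>0$ such that $(u_\lambda(x)e^{-x^2})''=0$ at $x=c_{0\lambda}$, and a unique $c_{1\lambda}>0$ such that $(\phi_\lambda(x)e^{-x^2})''=0$ at $x=c_{1\lambda}$. Set $a_{1\gamma}=c_{0\lambda}/c_{1\lambda}$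 (one has $a_{1\gamma}>1$) and $\beta(\gamma)=a_{1\gamma}^2$. Fix any function $\gamma:(1,3/2)\to(0,1)$ with $\gamma(q)<\frac3q-2$ for all $q\in(1,3/2)$ and $\lim_{q\downarrow1}\gamma(q)=1$, and set $\alpha(q)=\beta(\gamma(q))$ for $q\in(1,3/2)$. *)

(* Defs.v *)
From HB Require Import structures.
From mathcomp Require Import all_boot all_order all_algebra.
From mathcomp Require Import all_classical all_reals all_analysis.
Import Order.TTheory GRing.Theory Num.Theory.
Import numFieldNormedType.Exports.

Set Implicit Arguments.
Unset Strict Implicit.
Unset Printing Implicit Defensive.

Local Open Scope classical_set_scope.
Local Open Scope ring_scope.

(* Points of the plane are pairs z = (t, x), so z.1 is time and z.2 is space. *)

(* measurableTypeR R is R with its Borel sigma-algebra. *)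
Definition leb2 (R : realType) :
    {measure set (measurableTypeR R * measurableTypeR R) -> \bar R} :=
  (@lebesgue_measure R \x @lebesgue_measure R)%E.

Definition Qdom (R : realType) : set (R * R) :=
  [set z | 0 < z.1 /\ z.1 < 1].

Definition dir_t (R : realType) : R * R := (1, 0).
Definition dir_x (R : realType) : R * R := (0, 1).

Definition iter_derive (R : realType) (vs : seq (R * R)) (phi : R * R -> R) :
    R * R -> R :=
  foldr (fun v (g : R * R -> R) => (fun z => 'D_v g z)) phi vs.

(* Equivalent to C^oo: differentiability of every iterated directional
   derivative implies its continuity. *)
Definition smooth (R : realType) (phi : R * R -> R) : Prop :=
  forall (vs : seq (R * R)) (z : R * R), differentiable (iter_derive vs phi) z.

Definition test_function (R : realType) (U : set (R * R)) (phi : R * R -> R) :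
    Prop :=
  [/\ smooth phi,
      compact (closure [set z | phi z != 0]) &
      closure [set z | phi z != 0] `<=` U].

Definition locally_integrable2 (R : realType) (U : set (R * R))
    (f : R * R -> R) : Prop :=
  forall K : set (R * R), compact K -> K `<=` U ->
    (@leb2 R).-integrable K (EFin \o f).

(* g is the generalized derivative of f along the directions vs on the open
   set U. *)
Definition weak_derivative (R : realType) (U : set (R * R))
    (vs : seq (R * R)) (f g : R * R -> R) : Prop :=
  [/\ locally_integrable2 U f, locally_integrable2 U g &
      forall phi : R * R -> R, test_function U phi ->
        \int[@leb2 R]_(z in U) (f z * iter_derive vs phi z) =
        (-1) ^+ size vs * \int[@leb2 R]_(z in U) (g z * phi z)].

(* L_p(U), for measurable U, through extension by zero. *)
Definition Lp (R : realType) (p : R) (U : set (R * R)) (f : R * R -> R) : Prop :=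
  f \_ U \in Lfun (@leb2 R) p%:E.

Definition W12 (R : realType) (p : R) (u : R * R -> R) : Prop :=
  Lp p setT u /\
  exists ux uxx ut : R * R -> R,
    [/\ Lp p setT ux, Lp p setT uxx & Lp p setT ut] /\
    [/\ weak_derivative setT [:: dir_x R] u ux,
        weak_derivative setT [:: dir_x R; dir_x R] u uxx &
        weak_derivative setT [:: dir_t R] u ut].

(* Only the values of v on Q matter. *)
Definition W12_0 (R : realType) (p : R) (v : R * R -> R) : Prop :=
  exists u : R * R -> R,
    [/\ W12 p u,
        forall z : R * R, z.1 <= 0 -> u z = 0 &
        forall z : R * R, Qdom z -> v z = u z].

Definition coeff_class (R : realType) (beta alpha : R) (a : R * R -> R) :
    Prop :=
  @measurable_fun _ _ (measurableTypeR R * measurableTypeR R)%type R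
    (@Qdom R) a /\
  forall z : R * R, Qdom z -> beta <= a z <= alpha.

(* v_t = a v_xx + f almost everywhere in Q *)
Definition solves (R : realType) (a f v : R * R -> R) : Prop :=
  exists vt vxx : R * R -> R,
    [/\ weak_derivative (@Qdom R) [:: dir_t R] v vt,
        weak_derivative (@Qdom R) [:: dir_x R; dir_x R] v vxx &
        {ae @leb2 R, forall z, Qdom z -> vt z = a z * vxx z + f z}].

Definition phi_ (R : realType) (lambda x : R) : R :=
  \int[@lebesgue_measure R]_(r in `]0, +oo[)
    (expR (- (2 * x * r) - r ^+ 2) * r `^ (- 1 - lambda)).

Definition u_ (R : realType) (lambda x : R) : R :=
  phi_ lambda x + phi_ lambda (- x).

Definition inflection_set (R : realType) (g : R -> R) : set R :=
  [set c | 0 < c /\ ((fun x => g x * expR (- x ^+ 2))^`(2))%classic c = 0].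

(* For -1 < lambda < 0 both inflection sets are singletons, so xget selects
   their unique element. *)
Definition c0 (R : realType) (lambda : R) : R :=
  xget 0 (inflection_set (u_ lambda)).

Definition c1 (R : realType) (lambda : R) : R :=
  xget 0 (inflection_set (phi_ lambda)).

Definition a1 (R : realType) (gamma : R) : R :=
  c0 (gamma - 1) / c1 (gamma - 1).

Definition beta_ (R : realType) (gamma : R) : R := a1 gamma ^+ 2.

Definition admissible_gamma (R : realType) (gamma : R -> R) : Prop :=
  (forall q : R, 1 < q < 3 / 2 ->
     0 < gamma q < 1 /\ gamma q < 3 / q - 2) /\
  gamma q @[q --> 1^'+] --> (1 : R).

Definition alpha_ (R : realType) (gamma : R -> R) (q : R) : R :=
  beta_ (gamma q).

(* Main.v *)
Require Import Defs.
From HB Require Import structures.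
From mathcomp Require Import all_boot all_order all_algebra.
From mathcomp Require Import all_classical all_reals all_analysis.
From mathcomp Require Import measurable_realfun ring lra.
Import Order.TTheory GRing.Theory Num.Theory.
Import numFieldNormedType.Exports.
Local Open Scope classical_set_scope.
Local Open Scope ring_scope.

Set Implicit Arguments.
Unset Strict Implicit.
Unset Printing Implicit Defensive.

(** Write s = 1 - t, q = p / (p - 1) and g = gamma q, so that 0 < g < 1 and
    g < 3 / q - 2.

    Suppose that V solves the backward equation V_t = - a V_xx in Q, singular
    only at the point (1, 0), and that V_t and V_xx belong to L_q(Q). For u in
    the solution class,

      int_Q (u_t V_xx + u_xx V_t) = 0,

    because moving two space derivatives and one time derivative across turns the
    first term into the opposite of the second. The boundary t = 0 contributes nothing since u vanishes there, and the boundary t = 1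
    contributes nothing provided V / s also belongs to L_q(Q). If moreover
    u_t = a u_xx + f, the integrand is f V_xx. Hence every right-hand side f for
    which the equation is solvable is orthogonal to V_xx, and the indicator f of
    a small box on which V_xx is negative is not.

    It remains to find a and V. Take both self-similar, with y = x / (2 sqrt s):
    V = s^(-g/2) Psi(y) and a = A(y). The backward equation becomes

      A Psi'' + 2 y Psi' + 2 g Psi = 0.

    For A = 1 it is solved by psi(y) = phi_lambda(y) e^(-y^2) with lambda = g - 1,
    which decays as y -> +oo, and by the even function psi(y) + psi(-y), whose second
    derivatives vanish at c1 and c0. Use the even solution for |y| <= c0, where
    A = 1, and a multiple of psi(r |y|) with r = c1 / c0 for |y| >= c0, where
    A = r^-2. At an inflection point the equation reads y Psi' = - g Psi, so the
    two pieces that agree in value at c0 also agree in the first derivative, and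
    both second derivatives are 0 there: Psi is of class C^2. A Wronskian argument
    gives c1 < c0, so A takes values in [1, (c0 / c1)^2]. This is
    profile_exists.

    All of V / s, V_t, V_x and V_xx are bounded by a multiple of
    s^(-g/2 - 1) / (1 + y^2), whose q-th power is integrable over Q because
    g < 3 / q - 2 (integrable_dominator_powR).

    The integral identity is first read off the definition of weak derivatives
    for products xi(t) eta(x) (tensor_cancellation), then extended by
    mollification to compactly supported functions of class C^{1,2}
    (tensor_identity_extends), and finally to V by cutting off near t = 1 and
    near infinity and passing to the limit by dominated convergence
    (dual_identity). *)

(** * Derivatives of real functions *)

Section RealDerivatives.
Variable R : realType.
Implicit Types (f g : R -> R) (x a b c : R).

Lemma scaleRE a b : a *: b = a * b. Proof. by []. Qed.

Lemma is_derive1_eq f x a b : is_derive x 1 f a -> a = b -> is_derive x 1 f b.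
Proof. by move=> + <-. Qed.

Lemma is_derive1_cst c x : is_derive x 1 (fun _ : R => c) 0.
Proof. exact: is_derive_cst. Qed.

Lemma is_derive1_id x : is_derive x 1 (fun y : R => y) 1.
Proof. exact: is_derive_id. Qed.

Lemma is_derive1_D f g x a b : is_derive x 1 f a -> is_derive x 1 g b ->
  is_derive x 1 (fun y => f y + g y) (a + b).
Proof. by move=> *; apply: is_deriveD. Qed.

Lemma is_derive1_N f x a : is_derive x 1 f a -> is_derive x 1 (fun y => - f y) (- a).
Proof. by move=> *; apply: is_deriveN. Qed.

Lemma is_derive1_M f g x a b : is_derive x 1 f a -> is_derive x 1 g b ->
  is_derive x 1 (fun y => f y * g y) (a * g x + f x * b).
Proof.
move=> df dg; apply: (is_derive1_eq (is_deriveM df dg)).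
by rewrite !scaleRE addrC mulrC.
Qed.

Lemma is_derive1_chain f g x a b : is_derive (g x) 1 f a -> is_derive x 1 g b ->
  is_derive x 1 (fun y => f (g y)) (a * b).
Proof.
move=> df dg; apply: (is_derive1_eq (is_derive1_comp df dg)).
by rewrite mulrC.
Qed.

Lemma is_derive1_V f x a : f x != 0 -> is_derive x 1 f a ->
  is_derive x 1 (fun y => (f y)^-1) (- a / f x ^+ 2).
Proof.
move=> fx df; apply: (is_derive1_eq (is_deriveV fx df)).
by rewrite scaleRE mulNr mulNr mulrC.
Qed.

Lemma is_derive1_X f n x a : is_derive x 1 f a ->
  is_derive x 1 (fun y => f y ^+ n) (n%:R * f x ^+ n.-1 * a).
Proof.
by move=> df; have := is_deriveX n df; rewrite exprfctE.
Qed.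

Lemma is_derive1_expR f x a : is_derive x 1 f a ->
  is_derive x 1 (fun y => expR (f y)) (expR (f x) * a).
Proof. by move=> df; apply: is_derive1_chain. Qed.

Lemma is_derive1_continuous f x a : is_derive x 1 f a -> {for x, continuous f}.
Proof. by case=> d _; apply/differentiable_continuous/derivable1_diffP. Qed.

Lemma is_derive1_derive1 f f' : (forall x, is_derive x 1 f (f' x)) -> f^`()%classic = f'.
Proof. by move=> df; apply/funext => x; rewrite derive1E; apply: derive_val. Qed.

End RealDerivatives.

(** Reads the derivative off the expression, taking derivatives of unknown
    functions from the context. *)
Ltac derive_step :=
  lazymatch goal with
  | |- is_derive _ _ (fun _ => ?c) _ => eapply is_derive1_cst
  | |- is_derive _ _ (fun y => y) _ => eapply is_derive1_id
  | |- is_derive _ _ (fun y => @?f y + @?g y) _ => eapply (@is_derive1_D _ f g)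
  | |- is_derive _ _ (fun y => - @?f y) _ => eapply (@is_derive1_N _ f)
  | |- is_derive _ _ (fun y => @?f y * @?g y) _ => eapply (@is_derive1_M _ f g)
  | |- is_derive _ _ (fun y => @?f y ^+ ?n) _ => eapply (@is_derive1_X _ f n)
  | |- is_derive _ _ (fun y => (@?f y)^-1) _ => eapply (@is_derive1_V _ f)
  | |- is_derive _ _ (fun y => expR (@?f y)) _ => eapply (@is_derive1_expR _ f)
  end.
Ltac derive_auto := repeat first [eassumption | derive_step].
Ltac derive_eq := eapply is_derive1_eq; [solve [derive_auto] | ].

(** * Flat functions at the origin *)

Lemma exprn_expRN_le (R : realType) n (y : R) : 0 <= y -> y ^+ n * expR (- y) <= n`!%:R.
Proof.
move=> y0; rewrite expRN ler_pdivrMr ?expR_gt0// mulrC.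
case: n => [|n]; first by rewrite expr0 fact0 mulr1 -expR0 ler_expR.
have := expR_ge1Dxn n y0; rewrite -ler_pdivrMr ?ltr0n ?fact_gt0//.
by move=> ?; lra.
Qed.

Lemma poly_expN_bounded (R : realType) (P : {poly R}) :
  exists2 C : R, 0 <= C & forall y, 0 <= y -> `|P.[y] * expR (- y)| <= C.
Proof.
exists (\sum_(i < size P) `|P`_i| * i`!%:R) => [|y y0].
  by apply: sumr_ge0 => i _; rewrite mulr_ge0.
rewrite horner_coef mulr_suml (le_trans (ler_norm_sum _ _ _))//.
apply: ler_sum => i _; rewrite -mulrA normrM ler_wpM2l// ger0_norm ?exprn_expRN_le//.
by rewrite mulr_ge0 ?exprn_ge0 ?expR_ge0.
Qed.

(** P(1/x) e^(-1/x) for x > 0. Keeping the polynomial factor makes this family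
    closed under differentiation, so that smoothness is a syntactic fact. *)
Definition flat (R : realType) (P : {poly R}) (x : R) : R :=
  if 0 < x then P.[x^-1] * expR (- x^-1) else 0.

Definition dflat (R : realType) (P : {poly R}) : {poly R} := 'X^2 * (P - P^`()).

(** Away from 0 this is the chain rule; at 0 the bound |flat P h| <= C h^2,
    obtained by boundedness of z^2 P(z) e^(-z), gives the derivative 0. *)
Lemma is_derive_flat (R : realType) (P : {poly R}) (x : R) :
  is_derive x 1 (flat P) (flat (dflat P) x).
Proof.
rewrite /dflat.
have [x0|x0|->] := ltrgtP x 0; last first.
- have [C C0 HC] := poly_expN_bounded ('X^2 * P).
  have bnd h : `|flat P h| <= C * h ^+ 2.
    rewrite /flat; case: ifPn => [h0|_]; last by rewrite normr0 mulr_ge0 ?sqr_ge0.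
    have : `|h ^- 2 * (P.[h^-1] * expR (- h^-1))| <= C.
      by have := HC h^-1; rewrite !hornerE exprVn ?mulrA; apply; rewrite invr_ge0 ltW.
    by rewrite normrM ger0_norm ?invr_ge0 ?sqr_ge0// ler_pdivrMl ?exprn_gt0// [leRHS]mulrC.
  have f0 Q : flat Q 0 = 0 :> R by rewrite /flat ltxx.
  have cv : h^-1 *: (flat P (h *: 1 + 0) - flat P 0) @[h --> 0^'] --> (0 : R).
    apply/cvgrPdist_le => e e0; near=> h.
    rewrite addr0 f0 subr0 sub0r normrN !scaleRE mulr1 normrM normfV.
    have h0 : h != 0 by near: h; exact: nbhs_dnbhs_neq.
    rewrite ler_pdivrMl ?normr_gt0// (le_trans (bnd h))//.
    rewrite -(real_normK (num_real h)) expr2 mulrA mulrC ler_wpM2l//.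
    have : `|h| < e / (C + 1) by near: h; apply: dnbhs0_lt; rewrite divr_gt0 ?ltr_wpDl.
    rewrite ltr_pdivlMr ?ltr_wpDl// => hh; apply: le_trans (ltW hh).
    by rewrite mulrC ler_wpM2l ?lerDl.
  by rewrite f0; split; [apply/cvg_ex; exists 0|exact: cvg_lim cv].
- apply: (@near_eq_is_derive R R R (fun y => P.[y^-1] * expR (- y^-1)) (flat P) x 1).
    by near=> y; rewrite /flat ifT//; near: y; exact: lt_nbhsr.
  have xn0 : x != 0 by rewrite gt_eqF.
  have d1 : is_derive x 1 (fun y : R => P.[y^-1]) (P^`().[x^-1] * (- 1 / x ^+ 2)).
    have d0 : is_derive x 1 (fun y : R => y^-1) (- 1 / x ^+ 2).
      derive_auto.
    exact: (is_derive1_chain (is_derive_poly P x^-1) d0).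
  derive_eq.
  by rewrite /flat x0 hornerM hornerXn hornerD hornerN; field.
- have f0 Q y : y < 0 -> flat Q y = 0 :> R by move=> y0; rewrite /flat ltNge (ltW y0).
  rewrite f0//; apply: (@near_eq_is_derive R R R (cst 0) (flat P) x 1).
  by near=> y; rewrite f0//; near: y; exact: lt_nbhsl.
Unshelve. all: by end_near. Qed.

Section FlatLimits.
Variable R : realType.
Implicit Types (P Q : {poly R}) (x y : R).

Lemma flat_le0 P y : y <= 0 -> flat P y = 0.
Proof. by rewrite /flat ltNge => ->. Qed.

Lemma flat_bounded P : exists2 C, 0 <= C & forall y, `|flat P y| <= C.
Proof.
have [C C0 HC] := poly_expN_bounded P; exists C => // y.
rewrite /flat; case: ifPn => [y0|_]; last by rewrite normr0.
by apply: HC; rewrite invr_ge0 ltW.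
Qed.

Lemma flat_cvg P (u : nat -> R) : u n @[n --> \oo] --> +oo ->
  flat P (u n) @[n --> \oo] --> P.[0].
Proof.
move=> uoo; have u0 : \forall n \near \oo, 0 < u n by have := (cvgryPgt _).1 uoo; apply.
have cV : (u n)^-1 @[n --> \oo] --> (0 : R) by exact/(gtr0_cvgV0 u0).
have : P.[(u n)^-1] * expR (- (u n)^-1) @[n --> \oo] --> P.[0] * expR (- 0 : R).
  apply: cvgM.
    by apply: (cvg_comp _ (fun y : R => P.[y]) cV); exact: continuous_horner.
  by apply: continuous_cvg; [exact: continuous_expR|exact: cvgN].
rewrite oppr0 expR0 mulr1; apply: cvg_trans; apply: near_eq_cvg.
by near=> n; rewrite /flat ifT//; near: n.
Unshelve. all: by end_near. Qed.

(** Multiplying by the argument lowers the order of vanishing at infinity by one;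
    this trades the factor n produced by differentiating x -> flat P (n x)
    against 1/x. *)
Lemma flat_mulX P y : y * flat ('X * P) y = flat P y.
Proof.
rewrite /flat; case: ifPn => [y0|_]; last by rewrite mulr0.
by rewrite hornerM hornerX !mulrA divff ?mul1r// gt_eqF.
Qed.

Lemma dflat0 P : (dflat P).[0] = 0.
Proof. by rewrite hornerM hornerXn expr0n mul0r. Qed.

End FlatLimits.

(** * Smooth functions of product type *)

(** A class of smooth functions rich enough for cutoffs and mollifiers, on which
    derivatives of every order are obtained by induction on the syntax. *)
Inductive smooth1 (R : realType) : (R -> R) -> Prop :=
| smooth1_flat P a b : smooth1 (fun x => flat P (a * x + b))
| smooth1_cst c : smooth1 (fun=> c)
| smooth1_add f g : smooth1 f -> smooth1 g -> smooth1 (fun x => f x + g x)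
| smooth1_mul f g : smooth1 f -> smooth1 g -> smooth1 (fun x => f x * g x).

Lemma smooth1_is_derive (R : realType) (f : R -> R) : smooth1 f ->
  smooth1 f^`()%classic /\ forall x : R, is_derive x 1 f (f^`()%classic x).
Proof.
suff: smooth1 f -> exists2 f', smooth1 f' & forall x : R, is_derive x 1 f (f' x).
  by move=> H /H[f' sf' df]; rewrite (is_derive1_derive1 df).
elim=> [P a b|c|{}f g _ [f' sf df] _ [g' sg dg]|{}f g s1 [f' sf df] s2 [g' sg dg]].
- exists (fun x => flat (dflat P) (a * x + b) * a).
    exact: smooth1_mul (smooth1_flat _ _ _) (smooth1_cst _).
  move=> x; apply: (is_derive1_chain (is_derive_flat P _)).
  by derive_eq; ring.
- by exists (fun=> 0); [exact: smooth1_cst|move=> x; derive_auto].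
- by exists (fun x => f' x + g' x); [exact: smooth1_add|move=> x; exact: is_derive1_D].
- exists (fun x => f' x * g x + f x * g' x).
    by apply: smooth1_add; exact: smooth1_mul.
  by move=> x; exact: is_derive1_M.
Qed.

Lemma smooth1_continuous (R : realType) (f : R -> R) : smooth1 f -> continuous f.
Proof. by move=> /smooth1_is_derive[_ df] x; exact: is_derive1_continuous (df x). Qed.

Definition tensor (R : realType) (f g : R -> R) (z : R * R) : R := f z.1 * g z.2.

(** Directional derivatives of such functions are again of this form, which is all
    that smoothness in the plane asks for. *)
Inductive smooth2 (R : realType) : (R * R -> R) -> Prop :=
| smooth2_fst f : smooth1 f -> smooth2 (fun z => f z.1)
| smooth2_snd f : smooth1 f -> smooth2 (fun z => f z.2)
| smooth2_add F G : smooth2 F -> smooth2 G -> smooth2 (fun z => F z + G z)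
| smooth2_mul F G : smooth2 F -> smooth2 G -> smooth2 (fun z => F z * G z).

Section PlaneDerivatives.
Variable R : realType.
Implicit Types (f g : R -> R) (F G : R * R -> R) (z v : R * R).

Lemma differentiable_fst_comp f z v : derivable f z.1 1 ->
  differentiable (fun w : R * R => f w.1) z /\
  'D_v (fun w : R * R => f w.1) z = v.1 * f^`()%classic z.1.
Proof.
move=> df; have c1 : continuous (fst : R * R -> R) by move=> w; exact: cvg_fst.
have d1 : differentiable (fst : R * R -> R) z by exact: linear_differentiable.
have d2 : differentiable f z.1 by apply/derivable1_diffP.
have d : differentiable (f \o fst) z by exact: differentiable_comp.
split=> //; rewrite -[LHS]/('D_v (f \o fst) z) deriveE// diff_comp// /= (@diff_lin _ _ _ fst)//.
by rewrite diff1E// derive1E.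
Qed.

Lemma differentiable_snd_comp f z v : derivable f z.2 1 ->
  differentiable (fun w : R * R => f w.2) z /\
  'D_v (fun w : R * R => f w.2) z = v.2 * f^`()%classic z.2.
Proof.
move=> df; have c1 : continuous (snd : R * R -> R) by move=> w; exact: cvg_snd.
have d1 : differentiable (snd : R * R -> R) z by exact: linear_differentiable.
have d2 : differentiable f z.2 by apply/derivable1_diffP.
have d : differentiable (f \o snd) z by exact: differentiable_comp.
split=> //; rewrite -[LHS]/('D_v (f \o snd) z) deriveE// diff_comp// /= (@diff_lin _ _ _ snd)//.
by rewrite diff1E// derive1E.
Qed.

Lemma smooth2_derive F : smooth2 F -> (forall z, differentiable F z) /\
  forall v, smooth2 (fun z => 'D_v F z).
Proof.
elim=> [f /smooth1_is_derive[sf df]|f /smooth1_is_derive[sf df]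
  |{}F G sF [dF hF] sG [dG hG]|{}F G sF [dF hF] sG [dG hG]].
- have H z v := @differentiable_fst_comp f z v (@ex_derive _ _ _ _ _ _ _ (df z.1)).
  split=> [z|v]; first by have [] := H z 0.
  under eq_fun do rewrite (H _ _).2.
  by apply: smooth2_mul; [exact: (smooth2_fst (smooth1_cst _))|exact: smooth2_fst].
- have H z v := @differentiable_snd_comp f z v (@ex_derive _ _ _ _ _ _ _ (df z.2)).
  split=> [z|v]; first by have [] := H z 0.
  under eq_fun do rewrite (H _ _).2.
  by apply: smooth2_mul; [exact: (smooth2_fst (smooth1_cst _))|exact: smooth2_snd].
- split=> [z|v]; first exact: differentiableD.
  rewrite (_ : (fun z => _) = (fun z => 'D_v F z + 'D_v G z)); first exact: smooth2_add.
  apply/funext => z; rewrite -[LHS]/('D_v (F + G) z).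
  by rewrite deriveD//; apply: diff_derivable.
- split=> [z|v]; first exact: differentiableM.
  rewrite (_ : (fun z => _) = (fun z => F z * 'D_v G z + G z * 'D_v F z)).
    by apply: smooth2_add; exact: smooth2_mul.
  apply/funext => z; rewrite -[LHS]/('D_v (F * G) z).
  by rewrite deriveM//; apply: diff_derivable.
Qed.

Lemma smooth2_smooth F : smooth2 F -> smooth F.
Proof.
move=> sF vs; suff: smooth2 (iter_derive vs F) by move=> /smooth2_derive[].
by elim: vs => //= v vs /smooth2_derive[_]; exact.
Qed.

Lemma derive_tensor f g v : smooth1 f -> smooth1 g ->
  (fun z => 'D_v (tensor f g) z) =
  (fun z => v.1 * tensor f^`()%classic g z + v.2 * tensor f g^`()%classic z).
Proof.
move=> sf sg; have [_ df] := smooth1_is_derive sf; have [_ dg] := smooth1_is_derive sg.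
apply/funext => z.
have [d1 e1] := @differentiable_fst_comp f z v (@ex_derive _ _ _ _ _ _ _ (df z.1)).
have [d2 e2] := @differentiable_snd_comp g z v (@ex_derive _ _ _ _ _ _ _ (dg z.2)).
rewrite -[LHS]/('D_v ((fun w : R * R => f w.1) * (fun w => g w.2)) z).
rewrite deriveM//; [|exact: diff_derivable..].
by rewrite e1 e2 /tensor !scaleRE; ring.
Qed.

Lemma iter_derive_t f g : smooth1 f -> smooth1 g ->
  iter_derive [:: dir_t R] (tensor f g) = tensor f^`()%classic g.
Proof.
move=> sf sg; rewrite /= derive_tensor//; apply/funext => z /=; ring.
Qed.

Lemma iter_derive_xx f g : smooth1 f -> smooth1 g ->
  iter_derive [:: dir_x R; dir_x R] (tensor f g) = tensor f (g^`()^`())%classic.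
Proof.
move=> sf sg; have [sg' _] := smooth1_is_derive sg.
have E h : smooth1 h -> (fun z => 'D_(dir_x R) (tensor f h) z) = tensor f h^`()%classic.
  by move=> sh; rewrite derive_tensor//; apply/funext => z /=; ring.
by rewrite /= E// E.
Qed.

Lemma smooth2_tensor f g : smooth1 f -> smooth1 g -> smooth2 (tensor f g).
Proof. by move=> sf sg; exact: smooth2_mul (smooth2_fst sf) (smooth2_snd sg). Qed.

(** Only products of functions of t and of x are ever used as test functions;
    everything else is reached from them by limits. *)
Lemma test_function_tensor f g (a b c d : R) (U : set (R * R)) :
  smooth1 f -> smooth1 g ->
  (forall t, t \notin `[a, b] -> f t = 0) -> (forall x, x \notin `[c, d] -> g x = 0) ->
  `[a, b] `*` `[c, d] `<=` U -> test_function U (tensor f g).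
Proof.
move=> sf sg f0 g0 sU.
have cK : compact (`[a, b]%classic `*` `[c, d]%classic).
  by apply: compact_setX; exact: segment_compact.
have sK : closure [set z | tensor f g z != 0] `<=` `[a, b] `*` `[c, d].
  have /closure_id -> : closed (`[a, b]%classic `*` `[c, d]%classic).
    by apply: compact_closed => //; exact: norm_hausdorff.
  apply: closureS => -[t x] /= nz; split => /=.
    by apply: contraNT nz => /f0 ft; rewrite /tensor ft mul0r.
  by apply: contraNT nz => /g0 gx; rewrite /tensor gx mulr0.
split; first exact: smooth2_smooth (smooth2_tensor sf sg).
  apply: (subclosed_compact _ cK) => //; exact: closed_closure.
exact: subset_trans sU.
Qed.

Lemma derive1_supp f (a b : R) : smooth1 f -> (forall t, t \notin `[a, b] -> f t = 0) ->
  forall t, t \notin `[a, b] -> f^`()%classic t = 0.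
Proof.
move=> sf f0 t; have [_ /(_ t) df] := smooth1_is_derive sf => tab.
suff d0 : is_derive t 1 f 0 by rewrite derive1E; apply: derive_val.
apply: (@near_eq_is_derive R R R (cst 0) f t 1).
move: tab; rewrite in_itv /= negb_and -!ltNge => /orP[ta|bt]; near=> y; rewrite f0// in_itv/= negb_and -!ltNge.
- by apply/orP; left; near: y; exact: lt_nbhsl.
- by apply/orP; right; near: y; exact: lt_nbhsr.
Unshelve. all: by end_near. Qed.

End PlaneDerivatives.

(** * Plane measures are determined by boxes *)

Section DensityMeasure.
Context d (T : measurableType d) (R : realType).
Variables (mu : {measure set T -> \bar R}) (f : T -> \bar R).

(** The proofs of measurability and nonnegativity are arguments so that the
    measure structure can be attached to the function. *)
Definition density (_ : measurable_fun setT f) (_ : forall x, (0 <= f x)%E) (A : set T) :=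
  (\int[mu]_(x in A) f x)%E.

Hypotheses (mf : measurable_fun setT f) (f0 : forall x, (0 <= f x)%E).

Let density0 : density mf f0 set0 = 0%E.
Proof. by rewrite /density integral_set0. Qed.

Let density_ge0 A : (0 <= density mf f0 A)%E.
Proof. by apply: integral_ge0. Qed.

Let density_sigma_additive : semi_sigma_additive (density mf f0).
Proof.
move=> F mF tF mUF; rewrite /density ge0_integral_bigcup//.
  by apply: is_cvg_ereal_nneg_natsum_cond => n _ _; exact: integral_ge0.
exact: measurable_funTS.
Qed.

HB.instance Definition _ :=
  isMeasure.Build _ _ _ (density mf f0) density0 density_ge0 density_sigma_additive.

End DensityMeasure.

Section IntegralVanishing.
Context d (T : measurableType d) (R : realType).
Variables (mu : {measure set T -> \bar R}) (G : set (set T)) (g : nat -> set T).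
Hypotheses (mG : measurable = <<s G >>) (GI : setI_closed G)
  (Gg : forall i, G (g i)) (gT : \bigcup_k g k = setT).

(** The positive and negative parts of f are densities of two measures that agree
    on a generating pi-system, hence everywhere. *)
Lemma ae_eq0_of_integral_pi (f : T -> R) :
  mu.-integrable setT (EFin \o f) ->
  (forall A, G A -> \int[mu]_(x in A) (f x)%:E = 0)%E ->
  {ae mu, forall x, f x = 0}.
Proof.
move=> intf f0.
have mf : measurable_fun setT (EFin \o f) := measurable_int _ intf.
have mfp := measurable_funepos mf.
have mfn := measurable_funeneg mf.
have ip A : measurable A -> mu.-integrable A (EFin \o f)^\+%E.
  by move=> mA; apply: integrable_funepos => //; exact: integrableS intf.
have inn A : measurable A -> mu.-integrable A (EFin \o f)^\-%E.
  by move=> mA; apply: integrable_funeneg => //; exact: integrableS intf.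
have GA A : G A -> measurable A by move=> ?; rewrite mG; exact: sub_sigma_algebra.
have H A : measurable A -> density mu mfp (@funepos_ge0 _ _ _) A =
    density mu mfn (@funeneg_ge0 _ _ _) A.
  apply: (@measure_unique _ R T G g) => // [B GB|k].
    have mB := GA _ GB; have := f0 _ GB.
    rewrite integralE /= => /eqP.
    rewrite sube_eq ?add0e; [by move/eqP| |].
      by apply: integrable_fin_num => //; exact: ip.
    by rewrite fin_num_adde_defl// integrable_fin_num//; exact: inn.
  have := integrable_fin_num (GA _ (Gg k)) (ip _ (GA _ (Gg k))).
  by rewrite ge0_fin_numE//; exact: integral_ge0.
have : ae_eq mu setT (EFin \o f) (cst 0%E).
  apply: integral_ae_eq => // E _ mE; rewrite integral0 integralE.
  have := H E mE; rewrite /density => ->.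
  by rewrite subee// integrable_fin_num//; exact: inn.
by apply: filterS => x /(_ I) /= [].
Qed.

End IntegralVanishing.

Section BoxGenerator.
Variable R : realType.
Notation T := (measurableTypeR R * measurableTypeR R)%type.

Definition half_open_box : set (set T) :=
  [set X | exists a b c d : R, X = `]a, b] `*` `]c, d]].

Lemma half_open_boxI : setI_closed half_open_box.
Proof.
move=> _ _ [a [b [c [d ->]]]] [a' [b' [c' [d' ->]]]].
exists (Num.max a a'), (Num.min b b'), (Num.max c c'), (Num.min d d').
apply/seteqP; split => -[t x] /=; rewrite !in_itv/= !gt_max !le_min.
  by move=> [[/andP[-> ->] /andP[-> ->]] [/andP[-> ->] /andP[-> ->]]].
by move=> [/andP[/andP[-> ->] /andP[-> ->]] /andP[/andP[-> ->] /andP[-> ->]]].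
Qed.

Lemma itv_oc_cover : \bigcup_k `](- k%:R)%R, k%:R%R]%classic = [set: R].
Proof.
apply/seteqP; split => // x _; exists (Num.truncn `|x|).+1 => //=.
have := truncnS_gt `|x|; rewrite in_itv /= => /[dup] h.
by rewrite ltr_norml => /andP[-> /ltW ->].
Qed.

Lemma half_open_box_cover :
  \bigcup_k (`](- k%:R)%R, k%:R%R] `*` `](- k%:R)%R, k%:R%R]) = [set: R * R].
Proof.
apply/seteqP; split => // -[t x] _.
have: [set: R] t by []. have: [set: R] x by [].
rewrite -!itv_oc_cover => -[m _ /= hm] [n _ /= hn]; exists (maxn m n) => //=.
move: hm hn; rewrite !in_itv /= => /andP[m1 m2] /andP[n1 n2].
have hm : (m%:R : R) <= (maxn m n)%:R by rewrite ler_nat leq_maxl.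
have hn : (n%:R : R) <= (maxn m n)%:R by rewrite ler_nat leq_maxr.
split; apply/andP; split; lra.
Qed.

Lemma measurable_half_open_box : @measurable _ T = <<s half_open_box >>.
Proof.
apply/seteqP; split; last first.
  apply: smallest_sub; first exact: sigma_algebra_measurable.
  by move=> _ [a [b [c [d ->]]]]; exact: measurableX.
rewrite measurable_prod_measurableType; apply: smallest_sub.
  exact: smallest_sigma_algebra.
move=> _ [A mA [B mB <-]].
pose S := g_sigma_algebraType half_open_box.
have SE X : <<s half_open_box >> X = @measurable _ S X by [].
have box a b c d : @measurable _ S (`]a, b] `*` `]c, d])
  by apply: sub_sigma_algebra; exists a, b, c, d.
have preim (pr : R * R -> R) : (forall a b : R, @measurable _ S (pr @^-1` `]a, b])) ->
    forall X : set (measurableTypeR R), measurable X -> @measurable _ S (pr @^-1` X).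
  move=> mpr; pose Q := [set X : set R | @measurable _ S (pr @^-1` X)].
  apply: (@smallest_sub _ _ _ Q); last by move=> _ [[a b] _ <-]; exact: mpr.
  split.
  - by rewrite /Q /= preimage_set0; exact: (@measurable0 _ S).
  - by move=> X mX; rewrite /Q /= setTD preimage_setC; exact: (@measurableC _ S).
  - by move=> F mF; rewrite /Q /= preimage_bigcup; exact: (@bigcupT_measurable _ S).
rewrite SE (_ : A `*` B = (fst @^-1` A) `&` (snd @^-1` B)); last first.
  by apply/seteqP; split => -[t x].
apply: (@measurableI _ S); apply: preim => // a b.
  rewrite (_ : _ @^-1` _ = \bigcup_k (`]a, b] `*` `](- k%:R)%R, k%:R%R])).
    by apply: (@bigcupT_measurable _ S) => k; exact: box.
  by rewrite -setX_bigcupr itv_oc_cover; apply/seteqP; split=> -[t x] //= [].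
rewrite (_ : _ @^-1` _ = \bigcup_k (`](- k%:R)%R, k%:R%R] `*` `]a, b])).
  by apply: (@bigcupT_measurable _ S) => k; exact: box.
by rewrite -setX_bigcupl itv_oc_cover; apply/seteqP; split=> -[t x] //= [].
Qed.

End BoxGenerator.

Lemma leb2_box (R : realType) (a b c d : R) : a <= b -> c <= d ->
  leb2 R (`]a, b] `*` `]c, d]) = ((b - a) * (d - c))%:E.
Proof.
move=> ab cd; rewrite [LHS]product_measure1E//=; rewrite !lebesgue_measure_itv /= !lte_fin EFinM.
have E (u v : R) : u <= v -> (if (u < v)%R then v%:E - u%:E else 0)%E = (v - u)%:E.
  by rewrite le_eqVlt => /orP[/eqP->|->]//; rewrite ltxx subrr.
by rewrite !E.
Qed.

Lemma leb2_sigma_finite (R : realType) : sigma_finite setT (leb2 R).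
Proof.
exists (fun k : nat => `](- k%:R)%R, k%:R%R] `*` `](- k%:R)%R, k%:R%R]).
  by rewrite half_open_box_cover.
move=> k; split; first exact: measurableX.
by rewrite leb2_box ?ltry// ge0_cp.
Qed.

(** A copy of the plane measure that carries a sigma-finite structure, as Fubini's
    theorem requires. *)
Definition sleb2 (R : realType) :
    set (measurableTypeR R * measurableTypeR R) -> \bar R :=
  (@lebesgue_measure R \x @lebesgue_measure R)%E.

HB.instance Definition _ (R : realType) := Measure.copy (@sleb2 R)
  (@lebesgue_measure R \x @lebesgue_measure R)%E.

HB.instance Definition _ (R : realType) :=
  Measure_isSigmaFinite.Build _ _ _ (@sleb2 R) (leb2_sigma_finite R).

(** * The fundamental lemma of the calculus of variations *)

Section RealIntegrals.
Context d (T : measurableType d) (R : realType).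
Variables (mu : {measure set T -> \bar R}) (D : set T).
Hypothesis mD : measurable D.
Implicit Types f g h : T -> R.

Lemma integrable_mul_bounded f h C : mu.-integrable D (EFin \o f) ->
  measurable_fun D h -> (forall x, D x -> `|h x| <= C) ->
  mu.-integrable D (EFin \o (fun x => f x * h x)).
Proof.
move=> intf mh hC.
have mf : measurable_fun D f by apply/measurable_EFinP; exact: measurable_int intf.
have := integrableZl mD C intf; apply: le_integrable => //.
  by apply/measurable_EFinP; exact: measurable_funM.
move=> x Dx /=; rewrite lee_fin !normrM mulrC ler_wpM2r//.
by rewrite (le_trans (hC _ Dx))// ler_norm.
Qed.

Lemma integrable_patch f : mu.-integrable D (EFin \o f) ->
  mu.-integrable setT (EFin \o (f \_ D)).
Proof. by move=> intf; rewrite -restrict_EFin; apply/(integrable_mkcond _ mD). Qed.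

Lemma le_integrableR f g : measurable_fun D f -> (forall x, D x -> `|f x| <= g x) ->
  mu.-integrable D (EFin \o g) -> mu.-integrable D (EFin \o f).
Proof.
move=> mf fg; apply: le_integrable => //; first exact/measurable_EFinP.
by move=> x Dx /=; rewrite lee_fin (le_trans (fg _ Dx))// ler_norm.
Qed.

Lemma dominated_cvg_Rintegral (f_ : nat -> T -> R) f g :
  (forall n, measurable_fun D (f_ n)) -> measurable_fun D f ->
  (forall x, D x -> f_ n x @[n --> \oo] --> f x) ->
  mu.-integrable D (EFin \o g) -> (forall n x, D x -> `|f_ n x| <= g x) ->
  \int[mu]_(x in D) f_ n x @[n --> \oo] --> \int[mu]_(x in D) f x.
Proof.
move=> mf_ mf cf ig fg.
have H1 n : measurable_fun D (EFin \o f_ n) by exact/measurable_EFinP.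
have H2 : measurable_fun D (EFin \o f) by exact/measurable_EFinP.
have H3 : {ae mu, forall x, D x -> (EFin \o f_ n) x @[n --> \oo] --> (EFin \o f) x}.
  apply: aeW => x Dx; apply: cvg_EFin; first exact: nearW.
  exact: cf.
have H4 : {ae mu, forall x n, D x -> (`|(EFin \o f_ n) x| <= (EFin \o g) x)%E}.
  by apply: aeW => x n Dx; exact: fg.
have [ifi _ cv] := dominated_convergence mD H1 H2 H3 ig H4.
apply: fine_cvg; rewrite fineK; last exact: integrable_fin_num.
exact: cv.
Qed.

End RealIntegrals.

Section FundamentalLemma.
Variable R : realType.
Implicit Types (a b c d t x e : R) (n : nat).

Lemma flat1E (y : R) : flat 1 y = if 0 < y then expR (- y^-1) else 0.
Proof. by rewrite /flat hornerC mul1r. Qed.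

Lemma flat1_ge0 (y : R) : 0 <= flat 1 y.
Proof. by rewrite flat1E; case: ifP => // _; exact: expR_ge0. Qed.

Lemma flat1_le1 (y : R) : flat 1 y <= 1.
Proof.
rewrite flat1E; case: ifP => // y0.
by rewrite -expR0 ler_expR oppr_le0 invr_ge0 ltW.
Qed.

Lemma flat1_cvg1 (u : nat -> R) : u n @[n --> \oo] --> +oo ->
  flat 1 (u n) @[n --> \oo] --> (1 : R).
Proof. by move=> /(@flat_cvg _ 1); rewrite hornerC. Qed.

(** With m = n + 1: the first factor vanishes up to a. The argument of the second
    one is m at b and vanishes at b + 1/m, so that b belongs to the limit set. *)
Definition bump n a b t : R := flat 1 (n.+1%:R * t + - (n.+1%:R * a)) *
  flat 1 (- n.+1%:R ^+ 2 * t + (n.+1%:R ^+ 2 * b + n.+1%:R)).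

Lemma smooth1_bump n a b : smooth1 (bump n a b).
Proof. exact: smooth1_mul (smooth1_flat _ _ _) (smooth1_flat _ _ _). Qed.

Lemma bump_ge0 n a b t : 0 <= bump n a b t.
Proof. by rewrite mulr_ge0// flat1_ge0. Qed.

Lemma bump_le1 n a b t : bump n a b t <= 1.
Proof. by rewrite mulr_ile1// ?flat1_ge0// flat1_le1. Qed.

Lemma bump_eq0 n a b e t : n.+1%:R^-1 <= e -> t \notin `[a, b + e] -> bump n a b t = 0.
Proof.
move=> ne; have n0 : (0 : R) < n.+1%:R by rewrite ltr0n.
rewrite in_itv /= negb_and -!ltNge /bump => /orP[ta|bt].
  by rewrite flat_le0 ?mul0r// -mulrBr mulr_ge0_le0 ?ltW// subr_lt0.
rewrite [X in _ * X]flat_le0 ?mulr0//.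
have -> : - n.+1%:R ^+ 2 * t + (n.+1%:R ^+ 2 * b + n.+1%:R) =
    n.+1%:R ^+ 2 * (b + n.+1%:R^-1 - t) by field; rewrite gt_eqF.
by rewrite mulr_ge0_le0 ?sqr_ge0// subr_le0 ltW// (le_lt_trans _ bt)// lerD2l.
Qed.

Lemma cvgr_natr : n.+1%:R @[n --> \oo] --> (+oo : set_system R).
Proof. by apply: ger_cvgy cvgr_idn; apply: nearW => n; rewrite ler_nat. Qed.

Lemma bump_cvg a b t : bump n a b t @[n --> \oo] --> ((t \in `]a, b])%:R : R).
Proof.
have [ta|at_] := leP t a.
  rewrite (_ : (_ \in _) = false) ?in_itv/= ?ltNge ?ta//.
  apply: cvg_near_cst; apply: nearW => n.
  by rewrite /bump flat_le0 ?mul0r// -mulrBr mulr_ge0_le0// subr_le0.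
have c1 : flat 1 (n.+1%:R * t + - (n.+1%:R * a)) @[n --> \oo] --> (1 : R).
  apply: flat1_cvg1; under eq_fun do rewrite -mulrBr.
  apply/cvgryPgt => A; near=> n; rewrite -ltr_pdivrMr ?subr_gt0//.
  by near: n; have := (cvgryPgt _).1 cvgr_natr; apply.
have [tb|bt] := leP t b.
  rewrite in_itv /= at_ tb -[1]mulr1; apply: cvgM => //.
  apply: flat1_cvg1; apply: ger_cvgy cvgr_natr.
  by apply: nearW => n; rewrite addrA lerDr mulNr addrC -mulrBr mulr_ge0 ?sqr_ge0 ?subr_ge0.
rewrite (_ : (_ \in _) = false) ?in_itv/= ?at_ ?leNgt ?bt//.
apply: cvg_near_cst; near=> n; apply: (@bump_eq0 n a b (n.+1%:R^-1)) => //.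
rewrite in_itv /= negb_and -!ltNge; apply/orP; right; rewrite -ltrBrDl.
by near: n; apply: (near_infty_natSinv_lt (PosNum _)); rewrite subr_gt0.
Unshelve. all: by end_near. Qed.

Lemma measurable_smooth1 (f : R -> R) : smooth1 f -> measurable_fun setT f.
Proof. by move=> sf; apply: continuous_measurable_fun; exact: smooth1_continuous. Qed.

Lemma measurable_tensor (f g : R -> R) : measurable_fun setT f -> measurable_fun setT g ->
  @measurable_fun _ _ (measurableTypeR R * measurableTypeR R)%type R setT (tensor f g).
Proof.
move=> mf mg; apply: measurable_funM.
  by apply: measurableT_comp => //; exact: measurable_fst.
by apply: measurableT_comp => //; exact: measurable_snd.
Qed.

(** Integrability on closed rectangles, the only form of local integrability that
    products of test functions need. *)
Definition box_integrable (U : set (R * R)) (g : R * R -> R) : Prop :=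
  forall a b c d, `[a, b] `*` `[c, d] `<=` U ->
    (leb2 R).-integrable (`[a, b] `*` `[c, d]) (EFin \o g).

Definition box_test (U : set (R * R)) (xi eta : R -> R) a b c d : Prop :=
  [/\ smooth1 xi, smooth1 eta, forall t, t \notin `[a, b] -> xi t = 0,
    forall x, x \notin `[c, d] -> eta x = 0 & `[a, b] `*` `[c, d] `<=` U].

(** Bumps tend to indicators of half-open boxes, and these boxes form a
    pi-system that generates the Borel sets. The margin e leaves room for the
    supports of the bumps. *)
Lemma ae_eq0_of_test_function (U : set (R * R)) (g : R * R -> R) a b c d e : 0 < e ->
  @measurable _ (measurableTypeR R * measurableTypeR R)%type U ->
  `[a, b + e] `*` `[c, d + e] `<=` U -> box_integrable U g ->
  (forall xi eta a' b' c' d', box_test U xi eta a' b' c' d' ->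
    \int[leb2 R]_(z in U) (g z * tensor xi eta z) = 0) ->
  {ae leb2 R, forall z, (`]a, b] `*` `]c, d]) z -> g z = 0}.
Proof.
move=> e0 mU KU locg gtest.
set K := `[a, b + e] `*` `[c, d + e]; set B := `]a, b] `*` `]c, d].
pose T := (measurableTypeR R * measurableTypeR R)%type.
have mK : @measurable _ T K by exact: measurableX.
have mB : @measurable _ T B by exact: measurableX.
have BK : B `<=` K.
  move=> [t x]; rewrite /B /K /= !in_itv /= => -[/andP[h1 h2] /andP[h3 h4]].
  by split; apply/andP; split; lra.
have igK : (leb2 R).-integrable K (EFin \o g).
  exact: locg.
have igT : (leb2 R).-integrable setT (EFin \o (g \_ K)).
  by exact: (integrable_patch mK).
have igB : (leb2 R).-integrable setT (EFin \o (g \_ B)).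
  apply: (integrable_patch mB).
  exact: (integrableS mK mB BK igK).
have mg : @measurable_fun _ _ T R setT (g \_ K).
  by apply/measurable_EFinP; exact: (measurable_int _ igT).
have [N HN] : exists N : nat, forall n, (n + N).+1%:R^-1 <= e.
  exists (Num.truncn e^-1) => n.
  rewrite invf_ple ?posrE// (le_trans (ltW (truncnS_gt _)))//.
  by rewrite ler_nat ltnS leq_addl.
have zero a1 b1 c1 d1 : a <= a1 -> b1 <= b -> c <= c1 -> d1 <= d ->
    \int[leb2 R]_z ((g \_ K) z * tensor (fun t => (t \in `]a1, b1])%:R)
      (fun x => (x \in `]c1, d1])%:R) z) = 0.
  move=> aa bb cc dd.
  pose phi n := tensor (bump (n + N) a1 b1) (bump (n + N) c1 d1).
  have sphi n z : ~ K z -> phi n z = 0.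
    move=> nK; apply/eqP; apply: contra_notT nK => nz.
    have [z1|z1] := boolP (z.1 \in `[a1, b1 + e]); last first.
      by move: nz; rewrite /phi /tensor (bump_eq0 _ z1) ?mul0r ?eqxx.
    have [z2|z2] := boolP (z.2 \in `[c1, d1 + e]); last first.
      by move: nz; rewrite /phi /tensor (bump_eq0 _ z2) ?mulr0 ?eqxx.
    move: z1 z2; rewrite !in_itv /= => /andP[h1 h2] /andP[h3 h4].
    by rewrite /K /= !in_itv /=; split; apply/andP; split; lra.
  have I0 n : \int[leb2 R]_z ((g \_ K) z * phi n z) = 0.
    have <- := gtest (bump (n + N) a1 b1) (bump (n + N) c1 d1) a1 (b1 + e) c1 (d1 + e) _.
      rewrite [RHS]Rintegral_mkcond; apply: eq_Rintegral => z _ /=.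
      rewrite !patchE; case: ifPn => zK; case: ifPn => zU //.
      - by move: zU; rewrite notin_setE => /(_ (KU _ (set_mem zK))).
      - by rewrite -/(phi n z) sphi ?mulr0 ?mul0r//; rewrite notin_setE in zK.
      - by rewrite mul0r.
    split; [exact: smooth1_bump|exact: smooth1_bump|by move=> t; exact: bump_eq0|
      by move=> t; exact: bump_eq0|].
    apply: subset_trans KU => -[t x] /=; rewrite !in_itv /= => -[/andP[h1 h2] /andP[h3 h4]].
    by split; apply/andP; split; lra.
  have cv : \int[leb2 R]_z ((g \_ K) z * phi n z) @[n --> \oo] -->
     \int[leb2 R]_z ((g \_ K) z * tensor (fun t => (t \in `]a1, b1])%:R)
      (fun x => (x \in `]c1, d1])%:R) z).
    have mind u v : measurable_fun setT (fun t : R => (t \in `]u, v])%:R : R).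
      have := @measurable_indic _ _ R setT `]u, v]%classic (measurable_itv _).
      by apply: eq_measurable_fun => t _; rewrite indicE mem_setE.
    apply: (@dominated_cvg_Rintegral _ T R (leb2 R) setT measurableT
      (fun n z => (g \_ K) z * phi n z) _ (fun z => `|(g \_ K) z|)).
    - move=> n; apply: measurable_funM => //.
      by apply: measurable_tensor; apply: measurable_smooth1; exact: smooth1_bump.
    - by apply: measurable_funM => //; exact: measurable_tensor.
    - move=> z _; apply: cvgM; first exact: cvg_cst.
      by apply: cvgM; apply: (cvg_comp _ (fun n => bump n _ _ _) (cvg_addnr N)); exact: bump_cvg.
    - by have := integrable_norm igT.
    - move=> n z _; rewrite normrM ler_piMr// ger0_norm.
        by rewrite mulr_ile1 ?bump_ge0 ?bump_le1.
      by rewrite mulr_ge0 ?bump_ge0.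
  have E0 : (fun n => \int[leb2 R]_z ((g \_ K) z * phi n z)) = fun=> 0 by exact/funext.
  by rewrite E0 in cv; apply: cvg_unique cv (cvg_cst _); exact: norm_hausdorff.
have := @ae_eq0_of_integral_pi _ T R (leb2 R) (@half_open_box R) _
  (measurable_half_open_box R) (@half_open_boxI R) _ (half_open_box_cover R) (g \_ B).
case.
- by move=> k; exists (- k%:R), k%:R, (- k%:R), k%:R.
- exact: igB.
- move=> _ [a1 [b1 [c1 [d1 ->]]]].
  have mA : @measurable _ T (`]a1, b1] `*` `]c1, d1]) by exact: measurableX.
  have E : forall z, ((g \_ B) \_ (`]a1, b1] `*` `]c1, d1])) z =
     (g \_ K) z * tensor (fun t => (t \in `]Num.max a a1, Num.min b b1])%:R)
      (fun x => (x \in `]Num.max c c1, Num.min d d1])%:R) z.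
    move=> z; rewrite !patchE /tensor.
    have -> : (z \in `]a1, b1] `*` `]c1, d1]) = (z.1 \in `]a1, b1]) && (z.2 \in `]c1, d1]).
      by rewrite in_setX !mem_setE.
    have -> : (z \in B) = (z.1 \in `]a, b]) && (z.2 \in `]c, d]).
      by rewrite in_setX !mem_setE.
    rewrite !in_itv /= !gt_max !le_min.
    case: (boolP (z \in K)) => zK.
      rewrite -natrM mulnb mulr_natr mulrb -!if_and.
      by congr (if _ then _ else _); apply/idP/idP;
        move=> /andP[/andP[/andP[-> ->] /andP[-> ->]]] /andP[/andP[-> ->] /andP[-> ->]].
    rewrite mul0r; case: ifP => // _; case: ifPn => // zB; exfalso.
    move: zK; rewrite notin_setE; apply; apply: BK.
    by move: zB => /andP[/andP[h1 h2] /andP[h3 h4]]; split; rewrite /= in_itv /= ?h1 ?h2 ?h3 ?h4.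
  rewrite integral_mkcond restrict_EFin.
  have fin : (\int[leb2 R]_z (((g \_ B) \_ (`]a1, b1] `*` `]c1, d1])) z)%:E)%E \is a fin_num.
    apply: integrable_fin_num => //.
    apply: (integrable_patch mA (f := g \_ B)).
    exact: (integrableS measurableT mA (@subsetT _ _) igB).
  rewrite -(fineK fin); congr EFin; under eq_integral do rewrite E.
  by apply: zero; rewrite ?le_max ?ge_min ?lexx.
move=> N0 [mN N00 sN]; exists N0; split => // z /= nz; apply: sN => /= h; apply: nz => Bz.
by rewrite -h patchE mem_set.
Qed.

End FundamentalLemma.

(** * Uniqueness of weak derivatives *)

Lemma ae_leb2_filter (R : realType) : Filter (almost_everywhere (leb2 R)).
Proof. exact: ae_filter_ringOfSetsType. Qed.

Section BoxTests.
Variable R : realType.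
Notation T := (measurableTypeR R * measurableTypeR R)%type.
Implicit Types (xi eta : R -> R) (a b c d : R) (U : set (R * R)) (g : R * R -> R).

Lemma test_function_box U xi eta a b c d : box_test U xi eta a b c d ->
  test_function U (tensor xi eta).
Proof. by move=> [sx se x0 e0 KU]; exact: (test_function_tensor sx se x0 e0 KU). Qed.

Lemma bounded_of_support (f : R -> R) a b : continuous f ->
  (forall t, t \notin `[a, b] -> f t = 0) -> exists C, forall t, `|f t| <= C.
Proof.
move=> cf f0; have [ab|ba] := leP a b; last first.
  exists 0 => t; rewrite f0 ?normr0// in_itv /= negb_and -!ltNge.
  by case: ltP => //= at_; exact: lt_le_trans ba _.
have cnf : {within `[a, b], continuous (fun t => `|f t|)}.
  apply: continuous_subspaceT => t; apply: continuous_comp (cf t) _.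
  exact: norm_continuous.
have [c _ hc] := EVT_max ab cnf; exists `|f c| => t.
by have [/hc//|/f0 ->] := boolP (t \in `[a, b]); rewrite normr0.
Qed.

Lemma box_test_integrable U xi eta a b c d g :
  @measurable _ T U -> box_test U xi eta a b c d -> box_integrable U g ->
  (leb2 R).-integrable U (EFin \o (fun z => g z * tensor xi eta z)).
Proof.
move=> mU [sx se x0 e0 KU] lg; set K := `[a, b] `*` `[c, d].
have mK : @measurable _ T K by exact: measurableX.
have igK : (leb2 R).-integrable K (EFin \o g).
  exact: lg.
have [C1 h1] := bounded_of_support (smooth1_continuous sx) x0.
have [C2 h2] := bounded_of_support (smooth1_continuous se) e0.
have mt : @measurable_fun _ _ T R setT (tensor xi eta).
  by apply: measurable_tensor; exact: measurable_smooth1.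
have iT : (leb2 R).-integrable setT (EFin \o (fun z => (g \_ K) z * tensor xi eta z)).
  apply: (@integrable_mul_bounded _ T R (leb2 R) setT measurableT _ _ (C1 * C2)) => //.
    exact: (integrable_patch mK igK).
  by move=> z _; rewrite normrM ler_pM.
have := integrableS measurableT mU (@subsetT _ _) iT.
apply: eq_integrable => // z _ /=; congr EFin; rewrite patchE; case: ifPn => // zK.
have [z1|z1] := boolP (z.1 \in `[a, b]); last by rewrite /tensor x0// !(mul0r, mulr0).
have [z2|z2] := boolP (z.2 \in `[c, d]); last by rewrite /tensor (e0 _ z2) !(mul0r, mulr0).
by move: zK; rewrite notin_setE; case; split.
Qed.

Lemma locally_integrable_box U g : locally_integrable2 U g -> box_integrable U g.
Proof. by move=> lg a b c d; apply: lg; apply: compact_setX; exact: segment_compact. Qed.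

(** The hypotheses on f and f' are the integral identities rather than the full
    notion of weak derivative, so that they can come from a larger open set or
    from the zero function. *)
Lemma weak_derivative_ae_eq U vs (f f' g g' : R * R -> R) a b c d e :
  @measurable _ T U -> 0 < e -> `[a, b + e] `*` `[c, d + e] `<=` U ->
  box_integrable U g -> box_integrable U g' ->
  (forall phi, test_function U phi -> \int[leb2 R]_(z in U) (f z * iter_derive vs phi z) =
        (-1) ^+ size vs * \int[leb2 R]_(z in U) (g z * phi z)) ->
  (forall phi, test_function U phi -> \int[leb2 R]_(z in U) (f' z * iter_derive vs phi z) =
        (-1) ^+ size vs * \int[leb2 R]_(z in U) (g' z * phi z)) ->
  (forall z, U z -> f z = f' z) ->
  {ae leb2 R, forall z, (`]a, b] `*` `]c, d]) z -> g z = g' z}.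
Proof.
move=> mU e0 KU lg lg' hg hg' ff'.
have lh : box_integrable U (fun z => g z - g' z).
  move=> a' b' c' d' KsU; have mK : @measurable _ T (`[a', b'] `*` `[c', d']) by exact: measurableX.
  exact: (integrableB mK (lg _ _ _ _ KsU) (lg' _ _ _ _ KsU)).
have h xi eta a' b' c' d' : box_test U xi eta a' b' c' d' ->
    \int[leb2 R]_(z in U) ((g z - g' z) * tensor xi eta z) = 0.
  move=> bt; have tf := test_function_box bt.
  have i1 := box_test_integrable mU bt lg; have i2 := box_test_integrable mU bt lg'.
  rewrite (_ : \int[_]_(_ in _) _ = \int[leb2 R]_(z in U)
     (g z * tensor xi eta z - g' z * tensor xi eta z)).
    rewrite RintegralB//.
    have s0 : (-1) ^+ size vs != 0 :> R by rewrite expf_neq0// oppr_eq0 oner_eq0.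
    apply/eqP; rewrite subr_eq0 -(inj_eq (mulfI s0)).
    rewrite -hg// -hg'//; apply/eqP; apply: eq_Rintegral => z; rewrite inE => Uz.
    by rewrite ff'.
  by apply: eq_Rintegral => z _; rewrite mulrBl.
have := ae_eq0_of_test_function e0 mU KU lh h.
by apply: (@filterS _ _ (ae_leb2_filter R)) => z hz Bz; apply/eqP; rewrite -subr_eq0 hz.
Qed.

Lemma smooth1_chain xi u v : smooth1 xi -> smooth1 (fun x => xi (u * x + v)).
Proof.
elim=> [P a b|k|f g _ sf _ sg|f g _ sf _ sg].
- rewrite (_ : (fun x => _) = (fun x => flat P ((a * u) * x + (a * v + b)))).
    exact: smooth1_flat.
  by apply/funext => x; congr flat; ring.
- exact: smooth1_cst.
- exact: smooth1_add.
- exact: smooth1_mul.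
Qed.

Lemma derive1_shift xi c : smooth1 xi ->
  ((fun x => xi (x - c))^`() = (fun x => xi^`() (x - c)))%classic.
Proof.
move=> sx; apply: is_derive1_derive1 => x; have [_ dx] := smooth1_is_derive sx.
rewrite -[X in is_derive _ _ _ X]mulr1; apply: (is_derive1_chain (dx _)).
by derive_eq; ring.
Qed.

(** Testing u_t with xi eta'' and u_xx with xi' eta gives opposite values: both
    are, up to sign, the pairing of u with xi' eta''. *)
Lemma tensor_cancellation (u ut uxx : R * R -> R) xi eta a b c d :
  (forall phi, test_function setT phi ->
    \int[leb2 R]_z (u z * iter_derive [:: dir_t R] phi z) =
        - \int[leb2 R]_z (ut z * phi z)) ->
  (forall phi, test_function setT phi ->
    \int[leb2 R]_z (u z * iter_derive [:: dir_x R; dir_x R] phi z) =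
        \int[leb2 R]_z (uxx z * phi z)) ->
  box_test setT xi eta a b c d ->
  \int[leb2 R]_z (ut z * tensor xi (eta^`()^`())%classic z) +
  \int[leb2 R]_z (uxx z * tensor xi^`()%classic eta z) = 0.
Proof.
move=> ht hxx [sx se x0 e0 _].
have [sx' _] := smooth1_is_derive sx; have [se' _] := smooth1_is_derive se.
have [se'' _] := smooth1_is_derive se'.
have x0' := derive1_supp sx x0; have e0' := derive1_supp se e0.
have e0'' := derive1_supp se' e0'.
have := ht _ (@test_function_tensor _ _ _ _ _ _ _ _ sx se'' x0 e0'' (@subsetT _ _)).
have := hxx _ (@test_function_tensor _ _ _ _ _ _ _ _ sx' se x0' e0 (@subsetT _ _)).
rewrite iter_derive_t// iter_derive_xx// => <-.
by move=> ->; rewrite subrr.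
Qed.

End BoxTests.

(** * Convolution on the line *)

Section CompactSupport1D.
Variable R : realType.
Notation leb := (@lebesgue_measure R).
Implicit Types (f g : R -> R) (a b c x y : R).

Lemma integrable_of_support f a b : continuous f ->
  (forall t, t \notin `[a, b] -> f t = 0) -> leb.-integrable setT (EFin \o f).
Proof.
move=> cf f0; have : leb.-integrable `[a, b] (EFin \o f).
  apply: continuous_compact_integrable; first exact: segment_compact.
  exact: continuous_subspaceT.
have mI : measurable (`[a, b]%classic : set (measurableTypeR R)) by exact: measurable_itv.
move=> h; have := integrable_patch mI h; apply: eq_integrable => // t _ /=.
by congr EFin; rewrite patchE; case: ifPn => //; rewrite mem_setE => /f0.
Qed.

Lemma Rintegral_of_support f a b : (forall t, t \notin `[a, b] -> f t = 0) ->
  \int[leb]_x f x = \int[leb]_(x in `[a, b]) f x.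
Proof.
move=> f0; rewrite [RHS]Rintegral_mkcond; apply: eq_Rintegral => t _.
by rewrite patchE; case: ifPn => //; rewrite mem_setE => /f0.
Qed.

Lemma derivable_LRcontinuous f f' a b : (forall x : R, is_derive x 1 f (f' x)) ->
  derivable_oo_LRcontinuous f a b.
Proof.
move=> df; have cf x : {for x, continuous f} := is_derive1_continuous (df x).
split=> [x _| |]; first by case: (df x).
- by apply: cvg_at_right_filter; exact: cf.
- by apply: cvg_at_left_filter; exact: cf.
Qed.

(** Integration by parts; f is supported inside the interval of integration, which
    is enlarged by 1 so that f vanishes at its endpoints. *)
Lemma integral_convolution_derive f f' g N x :
  (forall y : R, is_derive y 1 f (f' y)) -> continuous f' ->
  (forall y, y \notin `[- N, N] -> f y = 0) -> smooth1 g ->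
  \int[leb]_y (f y * g^`()%classic (x - y)) = \int[leb]_y (f' y * g (x - y)).
Proof.
move=> df cf' f0 sg; have [sg' dg] := smooth1_is_derive sg.
have f0' y : y \notin `[- N, N] -> f' y = 0.
  rewrite in_itv /= negb_and -!ltNge => yN.
  suff [_ d0] : is_derive y 1 f 0 by have [_ <-] := df y.
  apply: (@near_eq_is_derive R R R (cst 0) f y 1); case/orP: yN => yN.
    by near=> z; rewrite f0// in_itv/= negb_and -!ltNge; apply/orP; left; near: z; exact: lt_nbhsl.
  by near=> z; rewrite f0// in_itv/= negb_and -!ltNge; apply/orP; right; near: z; exact: lt_nbhsr.
pose M : R := `|N| + 1.
have fM y : y \notin `[- M, M] -> y \notin `[- N, N].
  apply: contra; rewrite !in_itv /= => /andP[h1 h2]; have := ler_norm N.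
  by rewrite /M => hN; apply/andP; split; lra.
rewrite (@Rintegral_of_support _ (- M) M); last by move=> y /fM/f0 ->; rewrite mul0r.
rewrite (@Rintegral_of_support (fun y => f' y * g (x - y)) (- M) M); last by move=> y /fM/f0' ->; rewrite mul0r.
have dG (y : R) : is_derive y 1 (fun y => - g (x - y)) (g^`()%classic (x - y)).
  have d1 : is_derive y 1 (fun y => x - y) (- 1) by derive_eq; ring.
  have := is_derive1_N (@is_derive1_chain _ g (fun y => x - y) y _ _ (dg (x - y)) d1).
  by rewrite mulrN1 opprK.
rewrite (@Rintegration_by_parts _ f (fun y => - g (x - y)) f' (fun y => g^`()%classic (x - y))).
- have fe y : y = M \/ y = - M -> f y = 0.
    have hN := ler_norm N; move=> hy; apply: f0; rewrite in_itv /= negb_and -!ltNge.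
    by case: hy => ->; apply/orP; [right|left]; rewrite /M; lra.
  rewrite !fe; [|by right|by left].
  rewrite !mul0r subrr add0r.
  have E : \int[leb]_(y in `[- M, M]) (f' y * - g (x - y)) =
      \int[leb]_(y in `[- M, M]) (- 1 * (f' y * g (x - y))).
    by apply: eq_Rintegral => y _; ring.
  rewrite E RintegralZl ?mulN1r ?opprK//.
  apply: continuous_compact_integrable; first exact: segment_compact.
  apply: continuous_subspaceT => y; apply: continuousM; first exact: cf'.
  apply: continuous_comp; last exact: smooth1_continuous.
  by apply: continuousB; [exact: cvg_cst|exact: cvg_id].
- by rewrite /M; have := normr_ge0 N; lra.
- exact: continuous_subspaceT.
- exact: derivable_LRcontinuous df.
- by move=> y _; rewrite (is_derive1_derive1 df).
- apply: continuous_subspaceT => y; apply: continuous_comp; last exact: smooth1_continuous.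
  by apply: continuousB; [exact: cvg_cst|exact: cvg_id].
- exact: derivable_LRcontinuous dG.
- by move=> y _; rewrite (is_derive1_derive1 dG).
Unshelve. all: by end_near. Qed.

Lemma Rintegral_gt0 (D : set (measurableTypeR R)) f a b c : measurable D ->
  leb.-integrable D (EFin \o f) -> (forall x, D x -> 0 <= f x) -> a < b ->
  `[a, b]%classic `<=` D -> 0 < c -> (forall x, x \in `[a, b] -> c <= f x) ->
  0 < \int[leb]_(x in D) f x.
Proof.
move=> mD jf f0 ab sub c0 fc.
have mI : measurable (`[a, b]%classic : set (measurableTypeR R)) by exact: measurable_itv.
have jc : leb.-integrable setT (EFin \o ((fun=> c) \_ `[a, b])).
  apply: (integrable_patch mI); apply: continuous_compact_integrable; first exact: segment_compact.
  by apply: continuous_subspaceT => x; exact: cvg_cst.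
have jcD := integrableS measurableT mD (@subsetT _ _) jc.
apply: (@lt_le_trans _ _ (\int[leb]_(x in D) ((fun=> c) \_ `[a, b]) x)).
  rewrite -Rintegral_mkcondr (setIidr sub) Rintegral_cst//.
  rewrite [X in fine X]lebesgue_measure_itv /= lte_fin ab.
  by rewrite mulr_gt0// -?EFinN -?EFinB /=; lra.
apply: le_Rintegral => // x Dx; rewrite patchE; case: ifPn => [|_]; last exact: f0.
by rewrite mem_setE; exact: fc.
Qed.

Definition rho (e x : R) : R := flat 1 (1 * x + e) * flat 1 (- 1 * x + e).

Lemma smooth1_rho e : smooth1 (rho e).
Proof. exact: smooth1_mul (smooth1_flat _ _ _) (smooth1_flat _ _ _). Qed.

Lemma rho_ge0 e x : 0 <= rho e x.
Proof. by rewrite mulr_ge0 ?flat1_ge0. Qed.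

Lemma rho_eq0 e x : x \notin `[- e, e] -> rho e x = 0.
Proof.
rewrite in_itv /= negb_and -!ltNge /rho mul1r mulN1r => /orP[h|h].
  by rewrite flat_le0 ?mul0r//; lra.
by rewrite [X in _ * X]flat_le0 ?mulr0//; lra.
Qed.

Lemma integral_rho_gt0 e : 0 < e -> 0 < \int[leb]_x rho e x.
Proof.
move=> e0; pose k : R := flat 1 (e / 2) ^+ 2.
have fp y : 0 < y -> 0 < flat 1 y :> R by move=> y0; rewrite flat1E y0 expR_gt0.
have k0 : 0 < k by rewrite exprn_gt0// fp// divr_gt0.
have mono (u v : R) : u <= v -> flat 1 u <= flat 1 v.
  move=> uv; rewrite !flat1E; case: ifPn => [u0|_].
    by rewrite (lt_le_trans u0 uv) ler_expR lerN2 lef_pV2// posrE// (lt_le_trans u0).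
  by case: ifP => // _; exact: expR_ge0.
have ir := integrable_of_support (smooth1_continuous (smooth1_rho e)) (@rho_eq0 e).
apply: (@Rintegral_gt0 setT _ (- (e / 2)) (e / 2) k measurableT ir) => //.
- by move=> x _; exact: rho_ge0.
- by lra.
- move=> x; rewrite in_itv /= => /andP[h1 h2].
  by rewrite /k expr2 /rho ler_pM ?flat1_ge0// mono//; lra.
Qed.

Lemma lebesgue_measure_reflect c (A : set (measurableTypeR R)) : measurable A ->
  pushforward leb ((fun x => c - x) : measurableTypeR R -> measurableTypeR R) A = leb A.
Proof.
move=> mA; have mr : measurable_fun setT ((fun x => c - x) : measurableTypeR R -> measurableTypeR R).
  by apply: measurable_funB.
pose h := isMeasurableFun.Build _ _ _ _ _ mr.
pose r : {mfun measurableTypeR R >-> measurableTypeR R} := HB.pack (fun x : R => c - x) h.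
apply/esym; apply: (@lebesgue_measure_unique R (pushforward leb r)) => //= _ [[a b]] _ <-.
rewrite /pushforward /= (_ : _ @^-1` _ = `[c - b, c - a[%classic); last first.
  by apply/seteqP; split=> x /=; rewrite !in_itv /= => /andP[h1 h2]; apply/andP; split; lra.
rewrite !lebesgue_measure_itv /= !lte_fin ltrD2l ltrN2; case: ifP => // _.
by rewrite -!EFinD; congr EFin; ring.
Qed.

Lemma ge0_integral_reflect c f : measurable_fun setT f -> (forall x, 0 <= f x) ->
  (\int[leb]_x (f (c - x))%:E = \int[leb]_x (f x)%:E)%E.
Proof.
move=> mf f0.
have mr : measurable_fun setT ((fun x => c - x) : measurableTypeR R -> measurableTypeR R).
  by apply: measurable_funB.
have := @ge0_integral_pushforward _ _ _ _ R _ mr leb setT (EFin \o f) measurableT.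
rewrite preimage_setT => <- //; last 2 first.
- exact/measurable_EFinP.
- by move=> x _; rewrite /= lee_fin.
by apply: eq_measure_integral => A mA _; exact: lebesgue_measure_reflect.
Qed.

Lemma integral_rho_shift e t :
  (\int[leb]_y (rho e (t - y))%:E = \int[leb]_y (rho e y)%:E)%E.
Proof.
apply: ge0_integral_reflect => [|x]; last exact: rho_ge0.
exact: measurable_smooth1 (smooth1_rho e).
Qed.

End CompactSupport1D.

(** * Convolution in the plane *)

Section FubiniHelpers.
Context d1 d2 (T1 : measurableType d1) (T2 : measurableType d2) (R : realType).
Variables (m1 : {sigma_finite_measure set T1 -> \bar R})
  (m2 : {sigma_finite_measure set T2 -> \bar R}).

Lemma integral_EFinZl (a : R) (h : T2 -> R) : m2.-integrable setT (EFin \o h) ->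
  (\int[m2]_y (a * h y)%:E)%E = (a * \int[m2]_y h y)%:E.
Proof.
move=> ih; under eq_integral do rewrite EFinM.
by rewrite integralZl// EFinM fineK//; exact: integrable_fin_num.
Qed.

Lemma integrable_prod_mul (f : T1 -> R) (g : T2 -> R) :
  m1.-integrable setT (EFin \o f) -> m2.-integrable setT (EFin \o g) ->
  (m1 \x m2)%E.-integrable setT (EFin \o (fun w => f w.1 * g w.2)).
Proof.
move=> jf jg.
have mf : measurable_fun setT f by apply/measurable_EFinP; exact: (measurable_int _ jf).
have mg : measurable_fun setT g by apply/measurable_EFinP; exact: (measurable_int _ jg).
have ng := integrable_norm jg.
apply/integrable12ltyP.
  apply/measurable_EFinP; apply: measurable_funM.
    by apply: measurableT_comp => //; exact: measurable_fst.
  by apply: measurableT_comp => //; exact: measurable_snd.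
under eq_integral => x _ do under eq_integral => y _ do rewrite /= normrM.
under eq_integral => x _ do rewrite (integral_EFinZl `|f x| ng).
under eq_integral => x _ do rewrite mulrC EFinM.
rewrite integralZl//; last exact: (integrable_norm jf).
have := integrable_fin_num measurableT (integrable_norm jf).
by move=> /= /fineK <-; rewrite -EFinM ltry.
Qed.

End FubiniHelpers.

Section Convolution.
Variable R : realType.
Notation T := (measurableTypeR R * measurableTypeR R)%type.
Implicit Types (A V : R * R -> R) (N C : R).

Definition square N : set (R * R) := `[- N, N] `*` `[- N, N].

Lemma measurable_square N : @measurable _ T (square N).
Proof. exact: measurableX. Qed.

Lemma integrable2_of_support V N C : @measurable_fun _ _ T R setT V ->
  (forall z, `|V z| <= C) -> (forall z, ~ square N z -> V z = 0) ->
  (leb2 R).-integrable setT (EFin \o V).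
Proof.
move=> mV VC V0; have mS := measurable_square N.
have Sfin : (leb2 R (square N) < +oo)%E.
  have mL : @measurable _ T (`](- `|N| - 1), `|N|] `*` `](- `|N| - 1), `|N|]) by exact: measurableX.
  apply: (@le_lt_trans _ _ (leb2 R (`](- `|N| - 1), `|N|] `*` `](- `|N| - 1), `|N|]))).
    apply: le_measure; rewrite ?inE//.
    move=> [t x] /=; rewrite /square /= !in_itv /= => -[/andP[h1 h2] /andP[h3 h4]].
    by have := ler_norm N; split; apply/andP; split; lra.
  by rewrite leb2_box ?ltry//; have := normr_ge0 N; lra.
have jS : (leb2 R).-integrable (square N) (EFin \o V).
  apply: measurable_bounded_integrable => //; first exact: measurable_funTS.
  by exists C; split; [exact: num_real|move=> M CM z _; exact: (le_trans (VC z) (ltW CM))].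
have := integrable_patch mS jS; apply: eq_integrable => // z _ /=; congr EFin.
by rewrite patchE; case: ifPn => //; rewrite notin_setE => /V0.
Qed.

Definition tensor_kernel (k1 k2 : R -> R) (z z' : R * R) : R := k1 (z.1 - z'.1) * k2 (z.2 - z'.2).

Definition convolution (k1 k2 : R -> R) V (z : R * R) : R :=
  \int[leb2 R]_z' (V z' * tensor_kernel k1 k2 z z').

(** The adjoint of convolution: transposing the kernel moves the smoothing from
    the test function V to the locally integrable function A. *)
Definition correlation (k1 k2 : R -> R) A (z' : R * R) : R :=
  \int[leb2 R]_z (A z * tensor_kernel k1 k2 z z').

Section Kernel.
Variables (k1 k2 : R -> R).
Hypotheses (c1 : continuous k1) (c2 : continuous k2).
Hypotheses (s1 : forall t, t \notin `[- 1, 1] -> k1 t = 0)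
  (s2 : forall t, t \notin `[- 1, 1] -> k2 t = 0).

Lemma kernel_bounded : exists C, forall z z', `|tensor_kernel k1 k2 z z'| <= C.
Proof.
have [C1 h1] := bounded_of_support c1 s1; have [C2 h2] := bounded_of_support c2 s2.
by exists (C1 * C2) => z z'; rewrite normrM ler_pM.
Qed.

Lemma kernel_support N z z' : square N z' -> ~ square (N + 1) z -> tensor_kernel k1 k2 z z' = 0.
Proof.
move=> hz' nz; rewrite /tensor_kernel.
have [h1|/s1 ->] := boolP (z.1 - z'.1 \in `[- 1, 1]); last by rewrite mul0r.
have [h2|/s2 ->] := boolP (z.2 - z'.2 \in `[- 1, 1]); last by rewrite mulr0.
exfalso; apply: nz; move: hz' h1 h2; rewrite /square /= !in_itv /=.
move=> [/andP[? ?] /andP[? ?]] /andP[? ?] /andP[? ?].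
by split; apply/andP; split; lra.
Qed.

Lemma measurable_kernel : measurable_fun setT (fun w : T * T => tensor_kernel k1 k2 w.1 w.2).
Proof.
have m1 := continuous_measurable_fun c1; have m2 := continuous_measurable_fun c2.
apply: measurable_funM.
  apply: (measurableT_comp m1); apply: measurable_funB.
    by apply: measurableT_comp; [exact: measurable_fst|exact: measurable_fst].
  by apply: measurableT_comp; [exact: measurable_fst|exact: measurable_snd].
apply: (measurableT_comp m2); apply: measurable_funB.
  by apply: measurableT_comp; [exact: measurable_snd|exact: measurable_fst].
by apply: measurableT_comp; [exact: measurable_snd|exact: measurable_snd].
Qed.

Variables (A V : R * R -> R) (N C : R).
Hypotheses (iA : box_integrable setT A) (mV : @measurable_fun _ _ T R setT V)
  (VC : forall z, `|V z| <= C) (V0 : forall z, ~ square N z -> V z = 0).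

Lemma integrable_convolution z :
  (leb2 R).-integrable setT (EFin \o (fun z' => V z' * tensor_kernel k1 k2 z z')).
Proof.
have [CK hK] := kernel_bounded.
apply: (@integrable2_of_support _ N (C * CK)).
- apply: measurable_funM => //.
  exact: (measurableT_comp measurable_kernel (pair1_measurable z)).
- by move=> z'; rewrite normrM ler_pM.
- by move=> z' /V0 ->; rewrite mul0r.
Qed.

Lemma correlation_bounded : exists M, forall z', square N z' ->
  `|correlation k1 k2 A z'| <= M.
Proof.
have [CK hK] := kernel_bounded.
pose AS := A \_ (square (N + 1)).
have jAS : (leb2 R).-integrable setT (EFin \o AS).
  by apply: (integrable_patch (measurable_square (N + 1))); exact: iA.
have jn := integrable_norm jAS.
exists (CK * \int[leb2 R]_z `|AS z|) => z' w2.
have mK := measurableT_comp measurable_kernel (pair2_measurable z').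
have jAK : (leb2 R).-integrable setT (EFin \o (fun z => AS z * tensor_kernel k1 k2 z z')).
  exact: (@integrable_mul_bounded _ _ R _ setT measurableT _ _ CK jAS mK (fun w _ => hK _ _)).
have -> : correlation k1 k2 A z' = \int[leb2 R]_z (AS z * tensor_kernel k1 k2 z z').
  apply: eq_Rintegral => z _; rewrite /AS patchE; case: ifPn => [//|].
  by rewrite notin_setE => nS; rewrite (kernel_support w2 nS) !mulr0.
apply: le_trans (le_normr_Rintegral measurableT jAK) _.
rewrite -(RintegralZl _ measurableT jn).
apply: (le_Rintegral measurableT (integrable_norm jAK)).
  exact: (integrableZl measurableT CK jn).
by move=> z _ /=; rewrite normrM mulrC ler_wpM2r.
Qed.

Lemma integrable_mul_correlation :
  @measurable_fun _ _ T R setT (fun z' => V z' * correlation k1 k2 A z') ->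
  (leb2 R).-integrable setT (EFin \o (fun z' => V z' * correlation k1 k2 A z')).
Proof.
move=> mG; have [M hM] := correlation_bounded.
apply: (@integrable2_of_support _ N (C * `|M|) mG) => [z'|z' /V0 ->]; last by rewrite mul0r.
have C0 : 0 <= C := le_trans (normr_ge0 _) (VC z').
have [w2|/V0 ->] := pselect (square N z'); last by rewrite mul0r normr0 mulr_ge0.
rewrite normrM; apply: ler_pM; [exact: normr_ge0|exact: normr_ge0|exact: VC|].
exact: le_trans (hM _ w2) (ler_norm M).
Qed.

(** The kernel has bounded range and V has compact support, so A may be cut off to
    a square and the double integral converges absolutely. *)
Lemma convolution_fubini :
  [/\ (leb2 R).-integrable setT (EFin \o (fun z => A z * convolution k1 k2 V z)),
      (leb2 R).-integrable setT (EFin \o (fun z' => V z' * correlation k1 k2 A z')) &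
      \int[leb2 R]_z (A z * convolution k1 k2 V z) =
      \int[leb2 R]_z' (V z' * correlation k1 k2 A z')].
Proof.
have [CK hK] := kernel_bounded.
pose S := square (N + 1); pose AS := A \_ S.
have mS : @measurable _ T S := measurable_square (N + 1).
have jAS : (@sleb2 R).-integrable setT (EFin \o AS).
  by apply: (integrable_patch mS); exact: iA.
have mAS : @measurable_fun _ _ T R setT AS.
  by apply/measurable_EFinP; exact: (measurable_int _ jAS).
have jV : (@sleb2 R).-integrable setT (EFin \o V) by exact: integrable2_of_support VC V0.
pose F (w : T * T) : R := A w.1 * (V w.2 * tensor_kernel k1 k2 w.1 w.2).
have FE w : F w = AS w.1 * (V w.2 * tensor_kernel k1 k2 w.1 w.2).
  rewrite /F /AS patchE; case: ifPn => //; rewrite notin_setE => nS.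
  have [w2|/V0 ->] := pselect (square N w.2); last by rewrite !(mul0r, mulr0).
  by rewrite (kernel_support w2 nS) !(mul0r, mulr0).
have jF : (@sleb2 R \x @sleb2 R)%E.-integrable setT (EFin \o F).
  have := integrable_prod_mul jAS jV.
  have mK := measurable_kernel.
  move=> /(fun h => @integrable_mul_bounded _ _ R _ setT measurableT _ _ CK h mK (fun w _ => hK _ _)).
  by apply: eq_integrable => // w _ /=; rewrite FE mulrA.
have EF z : fubini_F (@sleb2 R) (EFin \o F) z = (A z * convolution k1 k2 V z)%:E.
  exact: (@integral_EFinZl _ T R (@sleb2 R) (A z) _ (integrable_convolution z)).
have EG z' : fubini_G (@sleb2 R) (EFin \o F) z' = (V z' * correlation k1 k2 A z')%:E.
  have [w2|nz'] := pselect (square N z'); last first.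
    rewrite V0// mul0r /fubini_G; apply: integral0_eq => z _ /=.
    by rewrite /F /= V0// mul0r mulr0.
  have jK : (@sleb2 R).-integrable setT (EFin \o (fun z => A z * tensor_kernel k1 k2 z z')).
    have mK := measurableT_comp measurable_kernel (pair2_measurable z').
    have := @integrable_mul_bounded _ _ R _ setT measurableT _ _ CK jAS mK (fun w _ => hK _ _).
    apply: eq_integrable => // z _ /=; congr EFin; rewrite /AS patchE; case: ifPn => //.
    by rewrite notin_setE => nS; rewrite (kernel_support w2 nS) !mulr0.
  rewrite -(@integral_EFinZl _ T R (@sleb2 R) (V z') _ jK); apply: eq_integral => z _ /=.
  by rewrite /F /= mulrCA.
have i1 := integrable_fubini_F jF; have i2 := measurable_fubini_G jF.
have e := Fubini jF.
split.
- by apply: eq_integrable i1 => // z _; rewrite EF.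
- have mG : @measurable_fun _ _ T R setT (fun z' => V z' * correlation k1 k2 A z').
    apply/measurable_EFinP; rewrite (_ : EFin \o _ = fubini_G (@sleb2 R) (EFin \o F))//.
    by apply/funext => z'; rewrite EG.
  exact: integrable_mul_correlation.
- rewrite /Rintegral; congr fine.
  under eq_integral do rewrite -EF; under [RHS]eq_integral do rewrite -EG.
  exact: e.
Qed.

End Kernel.

End Convolution.

(** * Mollification of test functions *)

Section Mollification.
Variable R : realType.
Notation T := (measurableTypeR R * measurableTypeR R)%type.
Notation leb := (@lebesgue_measure R).
Implicit Types (V W h : R * R -> R) (e t x y : R).

Lemma continuous_reflect (g : R -> R) x : continuous g -> continuous (fun y => g (x - y)).
Proof.
move=> cg y; apply: (@continuous_comp _ _ _ (fun y => x - y) g); last exact: cg.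
by apply: continuousB; [exact: cvg_cst|exact: cvg_id].
Qed.

Definition moll e x : R := (\int[leb]_y rho e y)^-1 * rho e x.

Lemma smooth1_moll e : smooth1 (moll e).
Proof. exact: smooth1_mul (smooth1_cst _) (smooth1_rho e). Qed.

Lemma moll_ge0 e x : 0 <= moll e x.
Proof. by rewrite mulr_ge0 ?rho_ge0// invr_ge0; apply: Rintegral_ge0 => y _; exact: rho_ge0. Qed.

Lemma moll_eq0 e x : x \notin `[- e, e] -> moll e x = 0.
Proof. by move=> h; rewrite /moll rho_eq0 ?mulr0. Qed.

Lemma moll_eq0_le1 e x : e <= 1 -> x \notin `[- 1, 1] -> moll e x = 0.
Proof.
move=> e1 h; apply: moll_eq0; apply: contra h; rewrite !in_itv /= => /andP[? ?].
by apply/andP; split; lra.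
Qed.

Lemma integrable_moll_shift e t : leb.-integrable setT (EFin \o (fun y => moll e (t - y))).
Proof.
apply: (@integrable_of_support _ _ (t - e) (t + e)).
  exact: continuous_reflect (smooth1_continuous (smooth1_moll e)).
move=> y hy; apply: moll_eq0; apply: contra hy; rewrite !in_itv /= => /andP[? ?].
by apply/andP; split; lra.
Qed.

Lemma integral_moll_shift e t : 0 < e -> \int[leb]_y moll e (t - y) = 1.
Proof.
move=> e0; have J0 := integral_rho_gt0 e0.
have jr : leb.-integrable setT (EFin \o (fun y => rho e (t - y))).
  apply: (@integrable_of_support _ _ (t - e) (t + e)).
    exact: continuous_reflect (smooth1_continuous (smooth1_rho e)).
  move=> y hy; apply: rho_eq0; apply: contra hy; rewrite !in_itv /= => /andP[? ?].
  by apply/andP; split; lra.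
rewrite /moll RintegralZl// [X in _ * X](_ : _ = \int[leb]_y rho e y) ?mulVf ?gt_eqF//.
by rewrite /Rintegral integral_rho_shift.
Qed.

Lemma moll_kernel_ge0 e z z' : 0 <= tensor_kernel (moll e) (moll e) z z'.
Proof. by apply: mulr_ge0; exact: moll_ge0. Qed.

Lemma integrable_moll_kernel e z :
  (leb2 R).-integrable setT (EFin \o tensor_kernel (moll e) (moll e) z).
Proof.
exact: (integrable_prod_mul (integrable_moll_shift e z.1) (integrable_moll_shift e z.2)).
Qed.

Lemma integral_moll_kernel e z : 0 < e ->
  \int[leb2 R]_z' tensor_kernel (moll e) (moll e) z z' = 1.
Proof.
move=> e0; rewrite /Rintegral -[X in fine X](integral12_prod_meas1 (integrable_moll_kernel e z)).
rewrite /fubini_F /tensor_kernel /=.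
under eq_integral do rewrite (integral_EFinZl _ (integrable_moll_shift e z.2)) integral_moll_shift// mulr1.
exact: integral_moll_shift.
Qed.

Section Convergence.
Variables (W : R * R -> R) (N C : R).
Hypotheses (mW : @measurable_fun _ _ T R setT W) (WC : forall z, `|W z| <= C)
  (W0 : forall z, ~ square N z -> W z = 0).

Let integrable_conv e z : e <= 1 ->
  (leb2 R).-integrable setT (EFin \o (fun z' => W z' * tensor_kernel (moll e) (moll e) z z')).
Proof.
move=> e1; have c := smooth1_continuous (smooth1_moll e).
have s t := @moll_eq0_le1 e t e1.
exact: (integrable_convolution c c s s mW WC W0).
Qed.

Lemma convolution_moll_bounded e z : 0 < e <= 1 ->
  `|convolution (moll e) (moll e) W z| <= C.
Proof.
move=> /andP[e0 e1]; have i1 := integrable_conv z e1.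
apply: le_trans (le_normr_Rintegral measurableT i1) _.
rewrite -[leRHS]mulr1 -(integral_moll_kernel z e0) -(RintegralZl _ measurableT (integrable_moll_kernel e z)).
apply: (le_Rintegral measurableT (integrable_norm i1)).
  exact: (integrableZl measurableT C (integrable_moll_kernel e z)).
move=> z' _ /=; rewrite normrM [X in _ * X]ger0_norm ?moll_kernel_ge0//.
by rewrite ler_wpM2r ?moll_kernel_ge0.
Qed.

Lemma convolution_moll_support e z : e <= 1 -> ~ square (N + 1) z ->
  convolution (moll e) (moll e) W z = 0.
Proof.
move=> e1 nz; have s t := @moll_eq0_le1 e t e1.
rewrite /convolution -[RHS](Rintegral_set0 (leb2 R) W) [RHS]Rintegral_mkcond.
apply: eq_Rintegral => z' _; rewrite patchE in_set0.
have [w2|/W0 ->] := pselect (square N z'); last by rewrite mul0r.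
by rewrite (kernel_support s s w2 nz) mulr0.
Qed.

(** The kernel is a probability density supported in a square of side 2 e. *)
Lemma convolution_moll_cvg z : {for z, continuous W} ->
  convolution (moll n.+1%:R^-1) (moll n.+1%:R^-1) W z @[n --> \oo] --> W z.
Proof.
move=> cW; apply/cvgrPdist_le => eps eps0.
have /nbhs_ballP[d /= d0 hd] : \forall w \near z, `|W z - W w| <= eps.
  by have /cvgrPdist_le := cW; exact.
near=> n.
have: n.+1%:R^-1 < d by near: n; exact: (near_infty_natSinv_lt (PosNum d0)).
set e := n.+1%:R^-1 => ed.
have e0 : 0 < e by rewrite invr_gt0.
have e1 : e <= 1 by rewrite invf_le1 ?ltr0n// ler1n.
have i1 := integrable_conv z e1; have i2 := integrable_moll_kernel e z.
have i3 : (leb2 R).-integrable setT (EFin \o (fun z' => W z * tensor_kernel (moll e) (moll e) z z')).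
  exact: (integrableZl measurableT (W z) i2).
rewrite -[W z in X in X <= _]mulr1 -(integral_moll_kernel z e0) -(RintegralZl _ measurableT i2).
rewrite /convolution -(RintegralB measurableT i3 i1).
have i4 := integrableB measurableT i3 i1.
apply: le_trans (le_normr_Rintegral measurableT i4) _.
rewrite -[leRHS]mulr1 -(integral_moll_kernel z e0) -(RintegralZl _ measurableT i2).
apply: (le_Rintegral measurableT (integrable_norm i4)).
  exact: (integrableZl measurableT eps i2).
move=> z' _ /=; rewrite -mulrBl normrM [X in _ * X]ger0_norm ?moll_kernel_ge0//.
have [h1|/moll_eq0 h1] := boolP (z.1 - z'.1 \in `[- e, e]); last by rewrite /tensor_kernel h1 mul0r !mulr0.
have [h2|/moll_eq0 h2] := boolP (z.2 - z'.2 \in `[- e, e]); last by rewrite /tensor_kernel h2 !mulr0.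
rewrite ler_wpM2r ?moll_kernel_ge0//; apply: hd.
move: h1 h2; rewrite !in_itv /= => /andP[h1 h2] /andP[h3 h4].
by split; rewrite /ball /= ltr_norml; apply/andP; split; lra.
Unshelve. all: by end_near. Qed.

End Convergence.

(** Compactly supported functions of class C^{1,2}. The derivatives are data, so
    that they can be given by formulas; measurability with respect to the product
    of the Borel sigma-algebras is recorded next to continuity. *)
Record compact_C12 (V Vt Vx Vxx : R * R -> R) (N C : R) : Prop := CompactC12 {
  C12_t : forall t x, is_derive t 1 (fun s => V (s, x)) (Vt (t, x));
  C12_x : forall t x, is_derive x 1 (fun y => V (t, y)) (Vx (t, x));
  C12_xx : forall t x, is_derive x 1 (fun y => Vx (t, y)) (Vxx (t, x));
  C12_continuous : continuous Vt /\ continuous Vxx;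
  C12_measurable : [/\ @measurable_fun _ _ T R setT V, @measurable_fun _ _ T R setT Vt &
                       @measurable_fun _ _ T R setT Vxx];
  C12_bound : forall z, `|V z| <= C;
  C12_bound_t : forall z, `|Vt z| <= C;
  C12_bound_xx : forall z, `|Vxx z| <= C;
  C12_supp : forall z, ~ square N z -> V z = 0;
  C12_supp_t : forall z, ~ square N z -> Vt z = 0;
  C12_supp_x : forall z, ~ square N z -> Vx z = 0;
  C12_supp_xx : forall z, ~ square N z -> Vxx z = 0 }.

Section MoveDerivatives.
Variables (V Vt Vx Vxx : R * R -> R) (N C : R).
Hypothesis HV : compact_C12 V Vt Vx Vxx N C.
Variables (k : R -> R).
Hypotheses (sk : smooth1 k) (k0 : forall t, t \notin `[- 1, 1] -> k t = 0).

Let pairl_continuous W t : continuous W -> continuous (fun y => W (t, y)).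
Proof.
move=> cW y; apply: (@continuous_comp _ _ _ (fun y => (t, y)) W); last exact: cW.
by apply: (@cvg_pair _ _ _ (nbhs y) (nbhs t) (nbhs y) _ _ _ (fun=> t) id); [exact: cvg_cst|exact: cvg_id].
Qed.

Let pairr_continuous W x : continuous W -> continuous (fun s => W (s, x)).
Proof.
move=> cW y; apply: (@continuous_comp _ _ _ (fun s => (s, x)) W); last exact: cW.
by apply: (@cvg_pair _ _ _ (nbhs y) (nbhs y) (nbhs x) _ _ _ id (fun=> x)); [exact: cvg_id|exact: cvg_cst].
Qed.

Let notinN y : y \notin `[- N, N] -> forall t, ~ square N (t, y) /\ ~ square N (y, t).
Proof. by move=> /negP hy t; split => -[/= ? ?]; exact: hy. Qed.

Let integrable_mul_shift (f g : R -> R) x : continuous f -> continuous g ->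
  (forall y, y \notin `[- N, N] -> f y = 0) ->
  leb.-integrable setT (EFin \o (fun y => f y * g (x - y))).
Proof.
move=> cf cg f0; apply: (@integrable_of_support _ _ (- N) N).
  by move=> y; apply: continuousM; [exact: cf|exact: continuous_reflect].
by move=> y /f0 ->; rewrite mul0r.
Qed.

(** Both x-derivatives of the kernel are transferred to V, on each line t = const. *)
Lemma convolution_xx z :
  convolution k (k^`()^`())%classic V z = convolution k k Vxx z.
Proof.
have [sk' _] := smooth1_is_derive sk; have [sk'' _] := smooth1_is_derive sk'.
have k0' := derive1_supp sk k0; have k0'' := derive1_supp sk' k0'.
have [mV _ mVxx] := C12_measurable HV; have [_ cVxx] := C12_continuous HV.
have ck := smooth1_continuous sk; have ck'' := smooth1_continuous sk''.
have i1 := integrable_convolution ck ck'' k0 k0'' mV (C12_bound HV) (C12_supp HV) z.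
have i2 := integrable_convolution ck ck k0 k0 mVxx (C12_bound_xx HV) (C12_supp_xx HV) z.
rewrite /convolution /Rintegral; congr fine.
rewrite -[LHS](integral12_prod_meas1 i1) -[RHS](integral12_prod_meas1 i2).
apply: eq_integral => t _; rewrite /fubini_F /tensor_kernel /=.
have cV : continuous (fun y => V (t, y)).
  by move=> y; exact: (is_derive1_continuous (C12_x HV t y)).
have cVx : continuous (fun y => Vx (t, y)).
  by move=> y; exact: (is_derive1_continuous (C12_xx HV t y)).
have V0t y : y \notin `[- N, N] -> V (t, y) = 0 by move=> /notinN /(_ t)[/(C12_supp HV)].
have Vx0t y : y \notin `[- N, N] -> Vx (t, y) = 0 by move=> /notinN /(_ t)[/(C12_supp_x HV)].
have Vxx0t y : y \notin `[- N, N] -> Vxx (t, y) = 0 by move=> /notinN /(_ t)[/(C12_supp_xx HV)].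
have cVt := @pairl_continuous Vxx t cVxx.
under eq_integral do rewrite mulrCA.
under [RHS]eq_integral do rewrite mulrCA.
rewrite (integral_EFinZl _ (integrable_mul_shift z.2 cV ck'' V0t)).
rewrite (integral_EFinZl _ (integrable_mul_shift z.2 cVt ck Vxx0t)).
rewrite (integral_convolution_derive z.2 (C12_x HV t) cVx V0t sk').
by rewrite (integral_convolution_derive z.2 (C12_xx HV t) cVt Vx0t sk).
Qed.

Lemma convolution_t z :
  convolution k^`()%classic k V z = convolution k k Vt z.
Proof.
have [sk' _] := smooth1_is_derive sk.
have k0' := derive1_supp sk k0.
have [mV mVt _] := C12_measurable HV; have [cVt _] := C12_continuous HV.
have ck := smooth1_continuous sk; have ck' := smooth1_continuous sk'.
have i1 := integrable_convolution ck' ck k0' k0 mV (C12_bound HV) (C12_supp HV) z.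
have i2 := integrable_convolution ck ck k0 k0 mVt (C12_bound_t HV) (C12_supp_t HV) z.
rewrite /convolution /Rintegral; congr fine.
rewrite -[LHS](integral21_prod_meas1 i1) -[RHS](integral21_prod_meas1 i2).
apply: eq_integral => x _; rewrite /fubini_G /tensor_kernel /=.
have cV : continuous (fun y => V (y, x)).
  by move=> y; exact: (is_derive1_continuous (C12_t HV y x)).
have V0t y : y \notin `[- N, N] -> V (y, x) = 0 by move=> /notinN /(_ x)[_ /(C12_supp HV)].
have Vt0t y : y \notin `[- N, N] -> Vt (y, x) = 0 by move=> /notinN /(_ x)[_ /(C12_supp_t HV)].
have cVtx := @pairr_continuous Vt x cVt.
under eq_integral do rewrite mulrA mulrC.
under [RHS]eq_integral do rewrite mulrA mulrC.
rewrite (integral_EFinZl _ (integrable_mul_shift z.1 cV ck' V0t)).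
rewrite (integral_EFinZl _ (integrable_mul_shift z.1 cVtx ck Vt0t)).
by rewrite (integral_convolution_derive z.1 (fun t => C12_t HV t x) cVtx V0t sk).
Qed.

End MoveDerivatives.

(** For fixed z', the kernel centred at z' is a product test function, so the
    identity holds for it; integrating against V(z') gives the identity for the
    mollifications of V, and these converge boundedly with their derivatives. *)
Lemma tensor_identity_extends (A B V Vt Vx Vxx : R * R -> R) (N C : R) :
  box_integrable setT A -> box_integrable setT B ->
  (forall xi eta a b c d, box_test setT xi eta a b c d ->
    \int[leb2 R]_z (A z * tensor xi (eta^`()^`())%classic z) +
    \int[leb2 R]_z (B z * tensor xi^`()%classic eta z) = 0) ->
  compact_C12 V Vt Vx Vxx N C ->
  \int[leb2 R]_z (A z * Vxx z) + \int[leb2 R]_z (B z * Vt z) = 0.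
Proof.
move=> jA jB hAB HV.
have [mV mVt mVxx] := C12_measurable HV; have [cVt cVxx] := C12_continuous HV.
pose e n : R := n.+1%:R^-1.
have e0 n : 0 < e n by rewrite invr_gt0.
have e1 n : e n <= 1 by rewrite invf_le1 ?ltr0n// ler1n.
pose P W n := convolution (moll (e n)) (moll (e n)) W.
have step n : \int[leb2 R]_z (A z * P Vxx n z) + \int[leb2 R]_z (B z * P Vt n z) = 0.
  have sk := smooth1_moll (e n); have [sk' _] := smooth1_is_derive sk.
  have [sk'' _] := smooth1_is_derive sk'.
  have k0 t := @moll_eq0_le1 (e n) t (e1 n).
  have k0' := derive1_supp sk k0; have k0'' := derive1_supp sk' k0'.
  have ck := smooth1_continuous sk; have ck' := smooth1_continuous sk'.
  have ck'' := smooth1_continuous sk''.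
  rewrite /P; under eq_Rintegral do rewrite -(convolution_xx HV sk k0).
  under [X in _ + X]eq_Rintegral do rewrite -(convolution_t HV sk k0).
  have [_ iA ->] := convolution_fubini ck ck'' k0 k0'' jA mV (C12_bound HV) (C12_supp HV).
  have [_ iB ->] := convolution_fubini ck' ck k0' k0 jB mV (C12_bound HV) (C12_supp HV).
  (* the identity for the kernel centred at z', integrated against V z' *)
  rewrite -(RintegralD measurableT iA iB) -[RHS](Rintegral_set0 (leb2 R) V) [RHS]Rintegral_mkcond.
  apply: eq_Rintegral => z' _; rewrite patchE in_set0 -mulrDr.
  have shift1 (f : R -> R) c : smooth1 f -> smooth1 (fun x => f (x - c)).
    move=> sf; have := smooth1_chain 1 (- c) sf.
    by under eq_fun do rewrite mul1r.
  have bt : box_test setT (fun t => moll (e n) (t - z'.1)) (fun x => moll (e n) (x - z'.2))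
      (z'.1 - 1) (z'.1 + 1) (z'.2 - 1) (z'.2 + 1).
    by split=> [||t ht|x hx|]//; [exact: shift1|exact: shift1| |];
      apply: k0; [apply: contra ht|apply: contra hx]; rewrite !in_itv /= => /andP[? ?];
      apply/andP; split; lra.
  have := hAB _ _ _ _ _ _ bt; rewrite !derive1_shift// => ->.
  by rewrite mulr0.
have lim Z W : box_integrable setT Z -> @measurable_fun _ _ T R setT W ->
    (forall z, `|W z| <= C) -> (forall z, ~ square N z -> W z = 0) -> continuous W ->
    \int[leb2 R]_z (Z z * P W n z) @[n --> \oo] --> \int[leb2 R]_z (Z z * W z).
  move=> jZ mW bW W0 cW; pose S := square (N + 1); pose ZS := Z \_ S.
  have mS : @measurable _ T S := measurable_square (N + 1).
  have jZS : (leb2 R).-integrable setT (EFin \o ZS).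
    by apply: (integrable_patch mS); exact: jZ.
  have ZE F z : (~ S z -> F z = 0) -> Z z * F z = ZS z * F z.
    by rewrite /ZS patchE; case: ifPn => //; rewrite notin_setE => nS /(_ nS) ->; rewrite !mulr0.
  have SN z : ~ S z -> W z = 0.
    move=> nS; apply: W0 => h; apply: nS; move: h; rewrite /S /square /= !in_itv /=.
    by move=> [/andP[? ?] /andP[? ?]]; split; apply/andP; split; lra.
  apply: (@dominated_cvg_Rintegral _ T R (leb2 R) setT measurableT _ _ (fun z => C * `|ZS z|)).
  - move=> n; have k0 t := @moll_eq0_le1 (e n) t (e1 n).
    have ck := smooth1_continuous (smooth1_moll (e n)).
    have [iA _ _] := convolution_fubini ck ck k0 k0 jZ mW bW W0.
    by apply/measurable_EFinP; exact: (measurable_int _ iA).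
  - rewrite (_ : (fun z => _) = (fun z => ZS z * W z)); last first.
      by apply/funext => z; apply: ZE; exact: SN.
    apply: measurable_funM => //.
    by apply/measurable_EFinP; exact: (measurable_int _ jZS).
  - move=> z _; apply: cvgM; first exact: cvg_cst.
    by apply: (convolution_moll_cvg mW bW W0); exact: cW.
  - exact: (integrableZl measurableT C (integrable_norm jZS)).
  - move=> n z _; rewrite (ZE (P W n)); last exact: (convolution_moll_support W0 (e1 n)).
    rewrite normrM mulrC ler_wpM2r//; apply: (convolution_moll_bounded mW bW W0).
    by rewrite e0 e1.
have c1 := lim _ _ jA mVxx (C12_bound_xx HV) (C12_supp_xx HV) cVxx; have c2 := lim _ _ jB mVt (C12_bound_t HV) (C12_supp_t HV) cVt.
have E : (fun n => \int[leb2 R]_z (A z * P Vxx n z) + \int[leb2 R]_z (B z * P Vt n z)) = fun=> 0.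
  by apply/funext => n; exact: step.
have c := cvgD c1 c2; rewrite -[X in X @ _]/(fun n => _ + _) E in c.
by apply: (cvg_unique _ (c _) (cvg_cst 0)); exact: norm_hausdorff.
Qed.

End Mollification.

(** * Gaussian moments *)

Section PowerIntegrals.
Variable R : realType.
Notation leb := (@lebesgue_measure R).
Implicit Types (a b r s x : R).

(** Meant for powers, which are differentiable on the positive half-line only. *)
Lemma continuous_FTC2_pos (F f : R -> R) a b : 0 < a -> a < b ->
  (forall x, 0 < x -> is_derive x 1 F (f x)) -> (forall x, 0 < x -> {for x, continuous f}) ->
  (\int[leb]_(x in `[a, b]) (f x)%:E = (F b - F a)%:E)%E.
Proof.
move=> a0 ab dF cf; have b0 := lt_trans a0 ab; rewrite EFinB; apply: continuous_FTC2 => //.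
- apply/continuous_within_itvP => //; split=> [x| |].
  + by rewrite in_itv /= => /andP[ax _]; apply: cf; exact: lt_trans ax.
  + by apply: cvg_at_right_filter; exact: cf.
  + by apply: cvg_at_left_filter; exact: cf.
- split=> [x| |].
  + by rewrite in_itv /= => /andP[ax _]; have [] := dF x (lt_trans a0 ax).
  + by apply: cvg_at_right_filter; exact: (is_derive1_continuous (dF _ a0)).
  + by apply: cvg_at_left_filter; exact: (is_derive1_continuous (dF _ b0)).
- move=> x; rewrite in_itv /= => /andP[ax _]; rewrite derive1E.
  by have [_] := dF x (lt_trans a0 ax).
Qed.

Lemma is_derive1_powR a x : 0 < x -> is_derive x 1 (fun y => y `^ a) (a * x `^ (a - 1)).
Proof. by move=> x0; apply: is_derive1_powR. Qed.

Lemma powR_continuous a x : 0 < x -> {for x, continuous (fun y => y `^ a)}.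
Proof. by move=> x0; exact: (is_derive1_continuous (is_derive1_powR a x0)). Qed.

Lemma integrable_powR01 a : - 1 < a -> leb.-integrable `]0, 1] (EFin \o (fun r => r `^ a)).
Proof.
move=> a1; have a10 : 0 < a + 1 by lra.
have mp (D : set R) : measurable_fun D (EFin \o (fun r : R => r `^ a)).
  by apply/measurable_EFinP; apply: measurable_funTS; exact: measurable_powR.
apply/integrableP; split; first exact: mp.
pose F (n : nat) : set (measurableTypeR R) := `[n.+2%:R^-1, 1]%classic.
have E : `]0, 1]%classic = \bigcup_n F n.
  apply/seteqP; split=> [r /= |r [n _]]; rewrite ?/F /= !in_itv /=.
    move=> /andP[r0 r1]; exists (Num.truncn r^-1) => //=.
    rewrite /F /= in_itv /= r1 andbT invf_ple ?posrE// (le_trans (ltW (truncnS_gt _)))//.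
    by rewrite ler_nat.
  by move=> /andP[h ->]; rewrite andbT (lt_le_trans _ h)// invr_gt0.
under eq_integral do rewrite gee0_abs ?lee_fin ?powR_ge0//.
have ndF : nondecreasing_seq F.
  apply/nondecreasing_seqP => n; apply/subsetPset => r; rewrite /F /= !in_itv /=.
  by move=> /andP[h ->]; rewrite andbT (le_trans _ h)// lef_pV2 ?posrE// ler_nat.
have cv := @ge0_nondecreasing_set_cvg_integral _ _ R F (EFin \o (fun r => r `^ a)) leb ndF
  (fun i => measurable_itv _) (fun i => mp _) (fun i r _ => powR_ge0 _ _).
rewrite E -(cvg_lim _ cv)//; apply: (@le_lt_trans _ _ (a + 1)^-1%:E); last exact: ltry.
apply: lime_le; first by apply/cvg_ex; eexists; exact: cv.
apply: nearW => n.
have dP x : 0 < x -> is_derive x 1 (fun y => (a + 1)^-1 * y `^ (a + 1)) (x `^ a).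
  move=> x0; have d := is_derive1_powR (a + 1) x0.
  by derive_eq; rewrite addrK mul0r add0r mulrA mulVf ?mul1r// gt_eqF.
rewrite /F (@continuous_FTC2_pos (fun y => (a + 1)^-1 * y `^ (a + 1))) //.
- rewrite powR1 mulr1 lee_fin lerBlDr lerDl mulr_ge0 ?powR_ge0// invr_ge0 ltW//.
- by rewrite invf_lt1 ?ltr0n// ltr1n.
- by move=> x; exact: powR_continuous.
Qed.

Lemma integrable_invDsqr : leb.-integrable setT (EFin \o (fun x => (1 + x ^+ 2)^-1)).
Proof.
have c : continuous (fun x : R => (1 + x ^+ 2)^-1) by exact: continuous_oneDsqrV.
apply/integrableP; split.
  by apply/measurable_EFinP; exact: continuous_measurable_fun.
have p x : 0 <= (1 + x ^+ 2)^-1 by rewrite invr_ge0 addr_ge0 ?sqr_ge0.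
under eq_integral do rewrite gee0_abs ?lee_fin ?p//.
rewrite (ge0_symfun_integralT p c); last by move=> x; rewrite /= sqrrN.
rewrite -set_itvcy; have := @integral0y_oneDsqr R; rewrite /oneDsqr /= => ->.
by rewrite -EFinM ltry.
Qed.

Definition gauss_exp x r : R := expR (- (2 * x * r) - r ^+ 2).

(** Ipow (- 1 - lambda) is the function phi_ lambda; the whole scale of exponents is
    needed because differentiation in x raises the exponent by one. *)
Definition Ipow a x : R := \int[leb]_(r in `]0, +oo[) (gauss_exp x r * r `^ a).

Lemma measurable_gauss_pow a x (D : set R) :
  measurable_fun D (fun r => gauss_exp x r * r `^ a).
Proof.
apply: measurable_funTS; apply: measurable_funM; last exact: measurable_powR.
apply: continuous_measurable_fun => r.
have d : is_derive r 1 (fun r => expR (- (2 * x * r) - r ^+ 2))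
  (expR (- (2 * x * r) - r ^+ 2) * (- (2 * x) - 2 * r)) by derive_eq; ring.
exact: (is_derive1_continuous d).
Qed.

(** The integrand is controlled by r^a near 0 and by a Cauchy density at
    infinity, up to one constant. *)
Lemma gauss_pow_bound a x : exists2 K : R, 0 <= K & forall r, 0 < r ->
  (r <= 1 -> gauss_exp x r <= K) /\
  (1 < r -> gauss_exp x r * r `^ a <= K * (1 + r ^+ 2)^-1).
Proof.
pose n := (Num.truncn `|a|).+1.
have Kp1 : 0 <= expR (2 * `|x|) by exact: expR_ge0.
have Kp2 : 0 <= n`!%:R * expR ((`|x| + 1) ^+ 2) * 2 :> R.
  by rewrite !mulr_ge0 ?expR_ge0.
exists (expR (2 * `|x|) + n`!%:R * expR ((`|x| + 1) ^+ 2) * 2); first exact: addr_ge0.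
move=> r r0.
have i0 : 0 <= (1 + r ^+ 2)^-1 by rewrite invr_ge0 addr_ge0 ?sqr_ge0.
have xr : - (2 * x * r) <= 2 * `|x| * r.
  have := ler_norm (- x); rewrite normrN => h.
  by have := ler_wpM2r (ltW r0) h; lra.
split=> r1.
  apply: (@le_trans _ _ (expR (2 * `|x|))); last by rewrite lerDl.
  rewrite /gauss_exp ler_expR.
  have h : `|x| * r <= `|x| by rewrite ler_piMr.
  have := sqr_ge0 r; lra.
rewrite mulrDl; apply: (@le_trans _ _ (n`!%:R * expR ((`|x| + 1) ^+ 2) * 2 * (1 + r ^+ 2)^-1)); last first.
  by rewrite lerDr mulr_ge0.
have h1 : r `^ a <= n`!%:R * expR r.
  apply: (@le_trans _ _ (r ^+ n)).
    rewrite -powR_mulrn ?(ltW r0)//; apply: ler_powR; first exact: ltW.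
    by rewrite (le_trans (ler_norm a))// ltW// truncnS_gt.
  have := exprn_expRN_le n (ltW r0).
  by rewrite expRN ler_pdivrMr ?expR_gt0.
have h2 : gauss_exp x r * expR r <= expR ((`|x| + 1) ^+ 2) * expR (- r).
  rewrite /gauss_exp -!expRD ler_expR.
  have := sqr_ge0 (`|x| + 1 - r); lra.
have h3 : expR (- r) <= 2 * (1 + r ^+ 2)^-1.
  rewrite expRN -[leRHS]invrK invfM invrK lef_pV2 ?posrE ?expR_gt0//; last first.
    by rewrite mulr_gt0// ?invr_gt0// ltr_pwDl ?sqr_ge0.
  have e2 : 2`!%:R = 2 :> R by [].
  have := expR_ge1Dxn 1 (ltW r0); rewrite e2; lra.
apply: (@le_trans _ _ (n`!%:R * (gauss_exp x r * expR r))).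
  by rewrite mulrCA ler_wpM2l ?expR_ge0.
rewrite -!mulrA ler_wpM2l//; apply: (le_trans h2).
by rewrite ler_wpM2l ?expR_ge0.
Qed.

Lemma integrable_gauss_pow a x : - 1 < a ->
  leb.-integrable `]0, +oo[ (EFin \o (fun r => gauss_exp x r * r `^ a)).
Proof.
move=> a1; pose D : set (measurableTypeR R) := `]0, +oo[%classic.
have mD : measurable D by exact: measurable_itv.
have mI : measurable (`]0, 1]%classic : set (measurableTypeR R)) by exact: measurable_itv.
have [K K0 HK] := gauss_pow_bound a x.
pose G r : R := K * (((fun r => r `^ a) \_ `]0, 1]) r + (1 + r ^+ 2)^-1).
have jG : leb.-integrable D (EFin \o G).
  apply: (integrableS measurableT mD (@subsetT _ _)).
  exact: (integrableZl measurableT K (integrableD measurableT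
    (integrable_patch mI (integrable_powR01 a1)) integrable_invDsqr)).
apply: (le_integrableR mD _ _ jG); first exact: measurable_gauss_pow.
move=> r; rewrite /D /= in_itv /= andbT => r0.
have i0 : 0 <= (1 + r ^+ 2)^-1 by rewrite invr_ge0 addr_ge0 ?sqr_ge0.
have [H1 H2] := HK r r0; rewrite ger0_norm ?mulr_ge0 ?expR_ge0 ?powR_ge0//.
rewrite /G patchE mem_setE in_itv /= r0 /=; case: ifPn => [/H1 h|].
  by apply: ler_pM; rewrite ?expR_ge0 ?powR_ge0 ?lerDl.
by rewrite -ltNge add0r.
Qed.

Lemma mulr_powRD1 a r : - 1 < a -> 0 < r -> r * r `^ a = r `^ (a + 1).
Proof.
move=> a1 r0; have h : 0 < a + 1 by lra.
by rewrite -(mulr_powRB1 (ltW r0) h) addrK.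
Qed.

(** Differentiation under the integral, with a dominating function that takes the
    worst value of x in an interval of radius 1. *)
Lemma is_derive_Ipow a x : - 1 < a -> is_derive x 1 (Ipow a) (- 2 * Ipow (a + 1) x).
Proof.
move=> a1; pose D : set (measurableTypeR R) := `]0, +oo[%classic.
have mD : measurable D by exact: measurable_itv.
have a11 : - 1 < a + 1 by lra.
pose f x r := gauss_exp x r * r `^ a.
pose G r := 2 * (gauss_exp (- (`|x| + 1)) r * r `^ (a + 1)).
have df (y r : R) : is_derive y 1 (f ^~ r) (- 2 * r * (gauss_exp y r * r `^ a)).
  by rewrite /f /gauss_exp; derive_eq; ring.
have d1 y r : (f ^~ r)^`()%classic y = - 2 * r * (gauss_exp y r * r `^ a).
  by rewrite derive1E; have [] := df y r.
have Ix : `](x - 1), (x + 1)[%classic x by rewrite /= in_itv /=; apply/andP; split; lra.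
have jf y : `](x - 1), (x + 1)[%classic y -> leb.-integrable D (EFin \o f y).
  by move=> _; exact: integrable_gauss_pow.
have dd y r : `](x - 1), (x + 1)[%classic y -> D r -> derivable (f ^~ r) y 1.
  by move=> _ _; have [] := df y r.
have G0 r : 0 <= G r by rewrite !mulr_ge0 ?expR_ge0 ?powR_ge0.
have jG : leb.-integrable D (EFin \o G).
  exact: (integrableZl mD 2 (integrable_gauss_pow _ a11)).
have rr r : 0 < r -> r * r `^ a = r `^ (a + 1).
  by apply: mulr_powRD1; lra.
have E y r : 0 < r -> - 2 * r * (gauss_exp y r * r `^ a) = - 2 * (gauss_exp y r * r `^ (a + 1)).
  by move=> r0; rewrite -rr//; ring.
have GU y r : `](x - 1), (x + 1)[%classic y -> D r -> `|partial1of2 f y r| <= G r.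
  rewrite /D /= !in_itv /= andbT => /andP[y1 y2] r0.
  rewrite /partial1of2 d1 E// mulNr normrN ger0_norm ?mulr_ge0 ?expR_ge0 ?powR_ge0//.
  rewrite /G ler_wpM2l// ler_wpM2r ?powR_ge0// /gauss_exp ler_expR.
  have := ler_norm (- x); rewrite normrN => h.
  have h2 : - y <= `|x| + 1 by lra.
  by have := ler_wpM2r (ltW r0) h2; lra.
have der := @derivable_under_integral R _ (measurableTypeR R) leb f D mD x _ _ Ix jf dd G G0 jG GU.
have := @differentiation_under_integral R _ (measurableTypeR R) leb f D mD x _ _ Ix jf dd G G0 jG GU.
rewrite derive1E => e; split; first exact: der.
rewrite [LHS]e /Ipow -RintegralZl//; last exact: integrable_gauss_pow.
apply: eq_Rintegral => r; rewrite inE /D /= in_itv /= andbT => r0.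
by rewrite [LHS]d1 E.
Qed.

Lemma Ipow_gt0 a x : - 1 < a -> 0 < Ipow a x.
Proof.
move=> a1; have mD : measurable (`]0, +oo[%classic : set (measurableTypeR R)) by exact: measurable_itv.
have [c c0 hc] : exists2 c, 0 < c & forall r, r \in `[1, 2] -> c <= gauss_exp x r * r `^ a.
  have dg r : r \in `[1, 2] -> {for r, continuous (fun r => gauss_exp x r * r `^ a)}.
    rewrite in_itv /= => /andP[r1 _].
    have dp := is_derive1_powR a (lt_le_trans ltr01 r1).
    have [l dl] : exists l, is_derive r 1 (fun r => gauss_exp x r * r `^ a) l.
      by eexists; rewrite /gauss_exp; derive_auto.
    exact: (is_derive1_continuous dl).
  have w : {within `[1, 2], continuous (fun r => gauss_exp x r * r `^ a)}.
    by apply: continuous_in_subspaceT => r; rewrite mem_setE => /dg.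
  have [c c12 hc] := EVT_min (ler1n R 2) w.
  exists (gauss_exp x c * c `^ a) => //; rewrite mulr_gt0 ?expR_gt0// powR_gt0//.
  by move: c12; rewrite in_itv /= => /andP[c1 _]; exact: lt_le_trans c1.
apply: (Rintegral_gt0 mD (integrable_gauss_pow x a1) _ _ _ c0 hc).
- by move=> r _; rewrite mulr_ge0 ?expR_ge0 ?powR_ge0.
- by rewrite ltr1n.
- by move=> r /=; rewrite !in_itv /= andbT => /andP[r1 _]; exact: lt_le_trans r1.
Qed.

(** Integrate the derivative of e^(-2xr - r^2) r^a over the half-line: it vanishes
    at both ends because a > 0. *)
Lemma Ipow_rec a x : 0 < a -> a * Ipow (a - 1) x = 2 * x * Ipow a x + 2 * Ipow (a + 1) x.
Proof.
move=> a0.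
have [h1 h2 h3] : [/\ - 1 < a - 1, - 1 < a & - 1 < a + 1] by split; lra.
pose D : set (measurableTypeR R) := `]0, +oo[%classic.
have mD : measurable D by exact: measurable_itv.
pose g b r := gauss_exp x r * r `^ b.
have jg b : - 1 < b -> leb.-integrable D (EFin \o g b) by exact: integrable_gauss_pow.
have j1 : leb.-integrable D (EFin \o (fun r => a * g (a - 1) r)).
  exact: (integrableZl mD a (jg _ h1)).
have j2 : leb.-integrable D (EFin \o (fun r => 2 * x * g a r)).
  exact: (integrableZl mD (2 * x) (jg _ h2)).
have j3 : leb.-integrable D (EFin \o (fun r => 2 * g (a + 1) r)).
  exact: (integrableZl mD 2 (jg _ h3)).
have j12 := integrableB mD j1 j2; have j := integrableB mD j12 j3.
pose h r := a * g (a - 1) r - 2 * x * g a r - 2 * g (a + 1) r.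
suff h0 : \int[leb]_(r in D) h r = 0.
  move: h0; rewrite /h (RintegralB mD j12 j3) (RintegralB mD j1 j2).
  rewrite (RintegralZl _ mD (jg _ h1)) (RintegralZl _ mD (jg _ h2)) (RintegralZl _ mD (jg _ h3)).
  by move=> E; apply/eqP; rewrite -subr_eq0 opprD addrA; apply/eqP; exact: E.
have rr r : 0 < r -> r * r `^ a = r `^ (a + 1).
  exact: mulr_powRD1.
have dg r : 0 < r -> is_derive r 1 (g a) (h r).
  move=> r0; have dp := is_derive1_powR a r0.
  rewrite /g /gauss_exp; derive_eq; rewrite /h /g -rr// /gauss_exp; ring.
have ch r : 0 < r -> {for r, continuous h}.
  move=> r0; have d b := is_derive1_powR b r0.
  have dgb b : exists l, is_derive r 1 (g b) l.
    by have dp := d b; eexists; rewrite /g /gauss_exp; derive_auto.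
  have [l1 d1] := dgb (a - 1); have [l2 d2] := dgb a; have [l3 d3] := dgb (a + 1).
  have dh : exists l, is_derive r 1 h l by eexists; rewrite /h; derive_auto.
  by case: dh => l dl; exact: (is_derive1_continuous dl).
have mh : measurable_fun D h by apply/measurable_EFinP; exact: (measurable_int _ j).
pose e (n : nat) : R := n.+2%:R; have e0 n : 0 < e n by rewrite ltr0n.
have e1 n : 1 < e n by rewrite ltr1n.
have eoo : e n @[n --> \oo] --> +oo.
  by apply: ger_cvgy cvgr_idn; apply: nearW => n; rewrite /e ler_nat -addn2 leq_addr.
have ev0 : (e n)^-1 @[n --> \oo] --> (0 : R).
  by apply/gtr0_cvgV0 => //; exact: nearW.
pose F n : set (measurableTypeR R) := `[(e n)^-1, e n]%classic.
have mF n : measurable (F n) by exact: measurable_itv.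
have FD n : F n `<=` D.
  move=> r; rewrite /F /D /= !in_itv /= andbT => /andP[r1 _].
  by apply: lt_le_trans r1; rewrite invr_gt0.
have IF n : \int[leb]_(r in D) (h \_ (F n)) r = g a (e n) - g a (e n)^-1.
  rewrite -Rintegral_mkcondr (setIidr (FD n)) /Rintegral (continuous_FTC2_pos _ _ dg ch)//.
    by rewrite invr_gt0.
  by rewrite (lt_trans _ (e1 n))// invf_lt1.
have c1 : \int[leb]_(r in D) (h \_ (F n)) r @[n --> \oo] --> \int[leb]_(r in D) h r.
  apply: (@dominated_cvg_Rintegral _ _ R leb D mD _ h (fun r => `|h r|)) => //.
  - move=> n; apply: measurable_funTS; apply/(measurable_restrictT _ (mF n)).
    exact: measurable_funS mD (FD n) mh.
  - move=> r; rewrite /D /= in_itv /= andbT => r0; apply: cvg_near_cst; near=> n.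
    rewrite patchE ifT// mem_setE in_itv /=; apply/andP; split; last first.
      by near: n; apply: (cvgryPge _).1 eoo _.
    by rewrite invf_ple ?posrE//; near: n; apply: (cvgryPge _).1 eoo _.
  - exact: (integrable_norm j).
  - by move=> n r _; rewrite patchE; case: ifP => // _; rewrite normr0.
have c2 : g a (e n) - g a (e n)^-1 @[n --> \oo] --> (0 : R).
  have [K K0 HK] := gauss_pow_bound a x.
  have p1 : g a (e n) @[n --> \oo] --> (0 : R).
    apply: (@squeeze_cvgr _ _ _ _ (fun=> 0) (fun n => K * (e n)^-1)).
    - apply: nearW => n; rewrite /g mulr_ge0 ?expR_ge0 ?powR_ge0//=.
      apply: le_trans ((HK _ (e0 n)).2 (e1 n)) _.
      rewrite ler_wpM2l// lef_pV2 ?posrE//; last by rewrite ltr_pwDl ?sqr_ge0.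
      by have := sqr_ge0 (e n - 1); have := e0 n; lra.
    - exact: cvg_cst.
    - by rewrite -[X in _ --> X](mulr0 K); apply: cvgM => //; exact: cvg_cst.
  have p2 : g a (e n)^-1 @[n --> \oo] --> (0 : R).
    apply: (@squeeze_cvgr _ _ _ _ (fun=> 0) (fun n => K * (e n)^-1 `^ a)).
    - apply: nearW => n; rewrite /g mulr_ge0 ?expR_ge0 ?powR_ge0//=.
      rewrite ler_wpM2r ?powR_ge0//; apply: (HK _ _).1; rewrite ?invr_gt0//.
      by rewrite invf_le1// ltW.
    - exact: cvg_cst.
    - rewrite -[X in _ --> X](mulr0 K); apply: cvgM; first exact: cvg_cst.
      have /cvg_at_rightP := powR_cvg0 a0; apply; split=> // n.
      by rewrite invr_gt0.
  by rewrite -[X in _ --> X](subrr 0); apply: cvgB.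
have E : (fun n => \int[leb]_(r in D) (h \_ (F n)) r) = fun n => g a (e n) - g a (e n)^-1.
  exact/funext.
by rewrite E in c1; apply: (cvg_unique _ c1 c2); exact: norm_hausdorff.
Unshelve. all: by end_near. Qed.

End PowerIntegrals.

(** * Inflection points of the profile equation *)

Section HermiteEquation.
Variable R : realType.
Implicit Types (g x y c : R).

Lemma mvt_everywhere (f f' : R -> R) (a b : R) :
  (forall x : R, is_derive x 1 f (f' x)) -> a < b ->
  exists2 c, a < c < b & f b - f a = f' c * (b - a).
Proof.
move=> df ab; have w : {within `[a, b], continuous f}.
  by apply: continuous_subspaceT => x; exact: (is_derive1_continuous (df x)).
have [c cab e] := @MVT R f f' a b ab (fun x _ => df x) w.
by exists c => //; move: cab; rewrite in_itv.
Qed.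

(** Positive solutions of psi'' + 2 x psi' + 2 g psi = 0 that do not increase at 0. *)
Record hermite g (psi psi' : R -> R) : Prop := Hermite {
  hermite_d1 : forall x : R, is_derive x 1 psi (psi' x);
  hermite_d2 : forall x : R, is_derive x 1 psi' (- 2 * (x * psi' x + g * psi x));
  hermite_gt0 : forall x, 0 < psi x;
  hermite_le0 : psi' 0 <= 0 }.

Section Inflection.
Variables (g : R) (psi psi' : R -> R).
Hypotheses (g0 : 0 < g) (H : hermite g psi psi').

Let E x : R := expR (x ^+ 2).
Let dE x : is_derive x 1 E (2 * x * E x).
Proof. by rewrite /E; derive_eq; ring. Qed.

Let F x := x * psi' x + g * psi x.

(** Since psi'' = - 2 F, the function E is an integrating factor for both psi' and
    F: after multiplication by E each of them decreases on the half-line x >= 0. *)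
Let dG x : is_derive x 1 (fun x => psi' x * E x) (- (2 * g) * psi x * E x).
Proof.
have d := dE x; have d1 := hermite_d2 H x; derive_eq; ring.
Qed.

Let dK x : is_derive x 1 (fun x => F x * E x) ((1 + g) * (psi' x * E x)).
Proof.
have d := dE x; have d1 := hermite_d2 H x; have d2 := hermite_d1 H x.
by rewrite /F; derive_eq; ring.
Qed.

Let E_gt0 x : 0 < E x. Proof. exact: expR_gt0. Qed.

Let G_decr x y : x < y -> psi' y * E y < psi' x * E x.
Proof.
move=> xy; have [c _ e] := mvt_everywhere dG xy; rewrite -subr_lt0 e.
by rewrite !mulNr oppr_lt0 !mulr_gt0 ?subr_gt0 ?hermite_gt0//; exact: hermite_gt0 H c.
Qed.

Lemma hermite_derive_lt0 x : 0 < x -> psi' x < 0.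
Proof.
move=> x0; rewrite -(pmulr_llt0 _ (E_gt0 x)); apply: lt_le_trans (G_decr x0) _.
by rewrite mulr_le0_ge0 ?(hermite_le0 H)// ltW.
Qed.

Let K_decr x y : 0 <= x -> x < y -> F y * E y < F x * E x.
Proof.
move=> x0 xy; have [c /andP[xc _] e] := mvt_everywhere dK xy; rewrite -subr_lt0 e.
rewrite pmulr_llt0 ?subr_gt0// pmulr_rlt0 ?addr_gt0// pmulr_llt0//.
by apply: hermite_derive_lt0; exact: le_lt_trans xc.
Qed.

Lemma hermite_lt_zero x c : 0 <= c -> 0 <= x ->
  c * psi' c + g * psi c = 0 -> 0 < x * psi' x + g * psi x -> x < c.
Proof.
move=> c0 x0 ec hx; rewrite ltNge le_eqVlt; apply/negP => /orP[/eqP e|h].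
  by move: hx; rewrite -e ec ltxx.
by have := K_decr c0 h; rewrite /F ec mul0r pmulr_llt0 ?E_gt0// => /ltW; rewrite leNgt hx.
Qed.

(** F is positive at 0. For x >= 1 the derivative of F E is at most - (1 + g) k,
    where - k is the value of psi' E at 1, so F E is negative at the point b. *)
Lemma hermite_zero_exists : exists2 c, 0 < c & c * psi' c + g * psi c = 0.
Proof.
pose K x := F x * E x; pose k := - (psi' 1 * E 1).
have k0 : 0 < k by rewrite oppr_gt0 pmulr_llt0//; exact: hermite_derive_lt0.
have gk : 0 < (1 + g) * k by rewrite mulr_gt0// addr_gt0.
pose b := 2 + `|K 1| / ((1 + g) * k).
have b1 : 1 < b by have : 0 <= `|K 1| / ((1 + g) * k) by [rewrite divr_ge0// ltW]; rewrite /b; lra.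
have Kb : K b < 0.
  have [c /andP[c1 cb] e] := mvt_everywhere dK b1.
  have h : psi' c * E c < - k by rewrite opprK; exact: G_decr.
  have h2 : (1 + g) * (psi' c * E c) * (b - 1) < (1 + g) * (- k) * (b - 1).
    by rewrite ltr_pM2r ?subr_gt0// ltr_pM2l ?addr_gt0.
  have h3 : (1 + g) * k * (b - 1) = (1 + g) * k + `|K 1|.
    by rewrite /b; field; rewrite !gt_eqF// addr_gt0.
  have := ler_norm (K 1); rewrite -/(K b) -/(K 1) in e; lra.
have cK x : {for x, continuous K} := is_derive1_continuous (dK x).
have K0 : 0 < K 0 by rewrite /K /F mul0r add0r !mulr_gt0//; exact: hermite_gt0 H 0.
have b0 : 0 <= b by rewrite (le_trans ler01)// ltW.
have [||c] := @IVT R K 0 b 0 b0.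
- by apply: continuous_subspaceT => x; exact: cK.
- by rewrite ge_min le_max (ltW Kb) (ltW K0) orbT.
rewrite in_itv /= => /andP[c0 _] /eqP; rewrite /K mulf_eq0 (gt_eqF (E_gt0 c)) orbF => /eqP ec.
exists c => //; rewrite lt_neqAle c0 andbT; apply/eqP => e; move: ec.
by rewrite -e /F mul0r add0r => /eqP; rewrite mulf_eq0 !gt_eqF//; exact: hermite_gt0 H 0.
Qed.

End Inflection.

(** The Wronskian times e^(x^2) is constant, and negative at 0. Evaluated at the
    inflection point c of psi it says that F is still positive for chi there, so the
    inflection point of chi lies further to the right. *)
Lemma hermite_comparison g psi psi' chi chi' c d :
  0 < g -> hermite g psi psi' -> hermite g chi chi' -> psi' 0 < 0 -> chi' 0 = 0 ->
  0 < c -> 0 < d -> c * psi' c + g * psi c = 0 -> d * chi' d + g * chi d = 0 -> c < d.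
Proof.
move=> g0 Hp Hc p0 q0 c0 d0 ec ed.
pose W x := (psi' x * chi x - chi' x * psi x) * expR (x ^+ 2).
have dW x : is_derive x 1 W 0.
  have d1 := hermite_d1 Hp x; have d2 := hermite_d2 Hp x.
  have d3 := hermite_d1 Hc x; have d4 := hermite_d2 Hc x.
  rewrite /W; derive_eq; ring.
have W0 : W c < 0.
  have [e _ ee] := mvt_everywhere dW c0; rewrite mul0r in ee.
  move/eqP: ee; rewrite subr_eq0 => /eqP ->.
  rewrite /W q0 mul0r subr0 pmulr_llt0 ?expR_gt0// pmulr_llt0//; exact: hermite_gt0 Hc 0.
apply: (hermite_lt_zero g0 Hc (ltW d0) (ltW c0) ed).
have pc := hermite_gt0 Hp c; rewrite -(pmulr_rgt0 _ pc).
have -> : psi c * (c * chi' c + g * chi c) =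
    c * (- (psi' c * chi c - chi' c * psi c)) + chi c * (c * psi' c + g * psi c) by ring.
by rewrite ec mulr0 addr0 mulr_gt0// oppr_gt0; move: W0; rewrite /W pmulr_llt0 ?expR_gt0.
Qed.

Section Phi.
Variable g : R.
Hypothesis g01 : 0 < g < 1.
Let g0 : 0 < g. Proof. by case/andP: g01. Qed.
Let g1 : g < 1. Proof. by case/andP: g01. Qed.

(** The solution that decays as x -> +oo. *)
Definition right_solution x : R := Ipow (- g) x * expR (- x ^+ 2).
Definition right_solution' x : R :=
  (- 2 * Ipow (1 - g) x - 2 * x * Ipow (- g) x) * expR (- x ^+ 2).

Definition even_solution x : R := right_solution x + right_solution (- x).
Definition even_solution' x : R := right_solution' x - right_solution' (- x).

Let dI x : is_derive x 1 (Ipow (- g)) (- 2 * Ipow (1 - g) x).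
Proof. by rewrite [1 - g]addrC; apply: is_derive_Ipow; move: g1; lra. Qed.

Let dI1 x : is_derive x 1 (Ipow (1 - g)) (- (1 - g) * Ipow (- g) x + 2 * x * Ipow (1 - g) x).
Proof.
apply: (is_derive1_eq (@is_derive_Ipow R (1 - g) x _)); first by move: g1; lra.
have := @Ipow_rec R (1 - g) x; rewrite (_ : 1 - g - 1 = - g); last by ring.
rewrite subr_gt0 => /(_ g1); move: (Ipow _ x) (Ipow _ x) (Ipow _ x) => I J L e.
by rewrite !mulNr e; ring.
Qed.

Lemma right_solution_d1 x : is_derive x 1 right_solution (right_solution' x).
Proof.
have := dI x; rewrite /right_solution /right_solution'.
by move: (Ipow (- g)) (Ipow (1 - g)) => I J d; derive_eq; ring.
Qed.

Lemma right_solution_d2 x :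
  is_derive x 1 right_solution' (- 2 * (x * right_solution' x + g * right_solution x)).
Proof.
have := dI x; have := dI1 x; rewrite /right_solution /right_solution'.
by move: (Ipow (- g)) (Ipow (1 - g)) => I J d d1; derive_eq; ring.
Qed.

Lemma right_solution_gt0 x : 0 < right_solution x.
Proof. by rewrite mulr_gt0 ?expR_gt0// Ipow_gt0//; move: g1; lra. Qed.

Lemma right_solution'0_lt0 : right_solution' 0 < 0.
Proof.
rewrite /right_solution' mulr0 mul0r subr0 pmulr_llt0 ?expR_gt0//.
by rewrite mulNr oppr_lt0 mulr_gt0// Ipow_gt0//; move: g1; lra.
Qed.

Lemma hermite_right : hermite g right_solution right_solution'.
Proof.
split; [exact: right_solution_d1|exact: right_solution_d2|exact: right_solution_gt0|].
exact: ltW right_solution'0_lt0.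
Qed.

Lemma hermite_even : hermite g even_solution even_solution'.
Proof.
have dN (x : R) : is_derive x 1 (fun x => - x) (- 1) by derive_eq.
split=> [x|x|x|].
- have h := @is_derive1_chain _ right_solution (fun x => - x) x _ _ (right_solution_d1 (- x)) (dN x).
  have h1 := right_solution_d1 x.
  by rewrite /even_solution /even_solution'; derive_eq; ring.
- have h := @is_derive1_chain _ right_solution' (fun x => - x) x _ _ (right_solution_d2 (- x)) (dN x).
  have h1 := right_solution_d2 x.
  by rewrite /even_solution /even_solution'; derive_eq; ring.
- by rewrite addr_gt0 ?right_solution_gt0.
- by rewrite /even_solution' oppr0 subrr.
Qed.

Lemma even_solution'0 : even_solution' 0 = 0.
Proof. by rewrite /even_solution' oppr0 subrr. Qed.

Lemma even_solutionN x : even_solution (- x) = even_solution x.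
Proof. by rewrite /even_solution opprK addrC. Qed.

Lemma even_solution'N x : even_solution' (- x) = - even_solution' x.
Proof. by rewrite /even_solution' opprK opprB. Qed.

Lemma phi_right x : phi_ (g - 1) x * expR (- x ^+ 2) = right_solution x.
Proof.
have -> : phi_ (g - 1) x = Ipow (- g) x.
  by rewrite /phi_ (_ : - 1 - (g - 1) = - g)//; ring.
by [].
Qed.

Lemma u_even x : u_ (g - 1) x * expR (- x ^+ 2) = even_solution x.
Proof.
rewrite /u_ mulrDl phi_right -[in X in _ + X](sqrrN x) phi_right.
by [].
Qed.

(** By the equation, the second derivative is - 2 (c psi' c + g psi c). *)
Lemma inflection_set_hermite (h psi psi' : R -> R) : hermite g psi psi' ->
  (forall x, h x * expR (- x ^+ 2) = psi x) ->
  inflection_set h = [set c | 0 < c /\ c * psi' c + g * psi c = 0].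
Proof.
move=> H hE; have e : (fun x => h x * expR (- x ^+ 2)) = psi by exact/funext.
have D c : ((fun x => h x * expR (- x ^+ 2))^`(2))%classic c = - 2 * (c * psi' c + g * psi c).
  rewrite e derive1nS derive1n1.
  by rewrite (is_derive1_derive1 (hermite_d1 H)) (is_derive1_derive1 (hermite_d2 H)).
apply/seteqP; split=> c [c0 ec]; split=> //; first by rewrite D in ec; lra.
by rewrite D ec mulr0.
Qed.

Lemma c1_spec : 0 < c1 (g - 1) /\ c1 (g - 1) * right_solution' (c1 (g - 1)) + g * right_solution (c1 (g - 1)) = 0.
Proof.
rewrite /c1 (inflection_set_hermite hermite_right phi_right).
have [c c0 ec] := hermite_zero_exists g0 hermite_right.
exact: (@xgetPex _ 0 [set c | 0 < c /\ _] (ex_intro _ c (conj c0 ec))).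
Qed.

Lemma c0_spec : 0 < c0 (g - 1) /\ c0 (g - 1) * even_solution' (c0 (g - 1)) + g * even_solution (c0 (g - 1)) = 0.
Proof.
rewrite /c0 (inflection_set_hermite hermite_even u_even).
have [c c0 ec] := hermite_zero_exists g0 hermite_even.
exact: (@xgetPex _ 0 [set c | 0 < c /\ _] (ex_intro _ c (conj c0 ec))).
Qed.

Lemma c1_lt_c0 : c1 (g - 1) < c0 (g - 1).
Proof.
have [p1 e1] := c1_spec; have [p0 e0] := c0_spec.
exact: (hermite_comparison g0 hermite_right hermite_even right_solution'0_lt0
  even_solution'0 p1 p0 e1 e0).
Qed.

End Phi.
End HermiteEquation.

(** * The C^2 profile *)

Section Profile.
Variable R : realType.
Implicit Types (f h : R -> R) (c x y : R).

Definition glue c f h x : R := if x < c then f x else h x.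

Lemma glue_continuous c f h : continuous f -> continuous h -> f c = h c ->
  continuous (glue c f h).
Proof.
move=> cf ch fh x; apply/cvgrPdist_le => e e0.
have /cvgrPdist_le/(_ e e0) nf := cf x; have /cvgrPdist_le/(_ e e0) nh := ch x.
have [xc|cx|xc] := ltgtP x c.
- near=> y; rewrite /glue xc ifT; last by near: y; exact: lt_nbhsl.
  by near: y.
- near=> y; rewrite /glue ltNge (ltW cx) /= ifF; last first.
    by apply/negbTE; rewrite -leNgt ltW//; near: y; exact: lt_nbhsr.
  by near: y.
- near=> y; rewrite {1}/glue xc ltxx -xc /glue; case: ifP => _; last by near: y.
  by rewrite -[h x]/(h x) {1}xc -fh -xc; near: y.
Unshelve. all: by end_near. Qed.

Lemma glue_is_derive c f f' h h' : (forall x : R, is_derive x 1 f (f' x)) ->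
  (forall x : R, is_derive x 1 h (h' x)) -> f c = h c -> f' c = h' c ->
  forall x : R, is_derive x 1 (glue c f h) (glue c f' h' x).
Proof.
move=> df dh fh fh' x; have [xc|cx|->] := ltgtP x c.
- rewrite {2}/glue xc; apply: (@near_eq_is_derive R R R f _ x 1).
  by near=> y; rewrite /glue ifT//; near: y; exact: lt_nbhsl.
- rewrite {2}/glue ltNge (ltW cx) /=; apply: (@near_eq_is_derive R R R h _ x 1).
  near=> y; rewrite /glue ifF//; apply/negbTE; rewrite -leNgt ltW//.
  by near: y; exact: lt_nbhsr.
- have gc : glue c f' h' c = f' c by rewrite /glue ltxx fh'.
  have cv : u^-1 *: (glue c f h (u *: 1 + c) - glue c f h c) @[u --> 0^'] --> f' c.
    have [df1 df2] := df c; have [dh1 dh2] := dh c.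
    have lf : u^-1 *: (f (u *: 1 + c) - f c) @[u --> 0^'] --> f' c.
      by rewrite -df2; exact: df1.
    have lh : u^-1 *: (h (u *: 1 + c) - h c) @[u --> 0^'] --> f' c.
      by rewrite fh' -dh2; exact: dh1.
    apply/cvgrPdist_le => e e0.
    have /cvgrPdist_le/(_ e e0) nf := lf; have /cvgrPdist_le/(_ e e0) nh := lh.
    near=> u; rewrite /glue ltxx; case: ifP => _; last by near: u.
    by rewrite -fh; near: u.
  by rewrite gc; split; [apply/cvg_ex; exists (f' c)|exact: cvg_lim cv].
Unshelve. all: by end_near. Qed.

Local Opaque Ipow.

Section Bounds.
Variable g : R.
Hypothesis g01 : 0 < g < 1.

Lemma Ipow_decr a x : - 1 < a -> 0 <= x -> Ipow a x <= Ipow a 0.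
Proof.
move=> a1; rewrite le_eqVlt => /orP[/eqP <-//|x0].
have a11 : - 1 < a + 1 by lra.
have [c _ e] := mvt_everywhere (fun x => is_derive_Ipow x a1) x0.
rewrite -subr_le0 e mulNr mulNr oppr_le0 !mulr_ge0 ?subr_ge0//; last exact: ltW.
exact: ltW (Ipow_gt0 c a11).
Qed.

Lemma gauss_decay x : (1 + x ^+ 2) ^+ 2 * expR (- x ^+ 2) <= 2 * expR 1.
Proof.
have p0 : 0 <= 1 + x ^+ 2 by rewrite addr_ge0 ?sqr_ge0.
have := exprn_expRN_le 2 p0; have e2 : 2`!%:R = 2 :> R by [].
rewrite e2 => h.
have -> : expR (- x ^+ 2) = expR 1 * expR (- (1 + x ^+ 2)) by rewrite -expRD; congr expR; ring.
by rewrite mulrCA [leRHS]mulrC ler_wpM2l ?expR_ge0.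
Qed.

Lemma gauss_weight_decay (M k x : R) : 0 <= M -> 0 <= k -> k <= 10 * M * (1 + x ^+ 2) ->
  k * expR (- x ^+ 2) <= M * (20 * expR 1) / (1 + x ^+ 2).
Proof.
move=> M0 k0 kM; have e0 : 0 < expR (- x ^+ 2) := expR_gt0 _.
have p0 : 0 < 1 + x ^+ 2 by rewrite ltr_pwDl ?sqr_ge0.
rewrite ler_pdivlMr//.
apply: (@le_trans _ _ (10 * M * ((1 + x ^+ 2) ^+ 2 * expR (- x ^+ 2)))).
  rewrite mulrAC expr2 mulrA [10 * M * _]mulrA ler_wpM2r ?(ltW e0)//.
  by rewrite ler_wpM2r// ltW.
have := gauss_decay x => h; have M10 : 0 <= 10 * M by lra.
by have := ler_wpM2l M10 h; lra.
Qed.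

Lemma gauss_combination_bound (M I J x : R) : 0 <= x -> 0 < I <= M / 2 -> 0 < J <= M / 2 ->
  let e := expR (- x ^+ 2) in let s := I * e in let s' := (- 2 * J - 2 * x * I) * e in
  let D := M * (20 * expR 1) / (1 + x ^+ 2) in
  [/\ `|s| <= D, (1 + x) * `|s'| <= D & `|- 2 * (x * s' + g * s)| <= D].
Proof.
have /andP[g0 g1] := g01.
move=> x0 /andP[I0 IM] /andP[J0 JM] e s s' D.
have M0 : 0 <= M by lra.
have e0 : 0 < e := expR_gt0 _.
have x2 := sqr_ge0 (x - 1).
have d1 : `|- 2 * J - 2 * x * I| <= M * (1 + x).
  have h : x * I <= x * (M / 2) by rewrite ler_wpM2l.
  have h' : 0 <= x * I by rewrite mulr_ge0// ltW.
  by rewrite ler_norml; apply/andP; split; lra.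
have Mx : 0 <= M * (x - 1) ^+ 2 by rewrite mulr_ge0.
have Mx' : 0 <= M * x ^+ 2 by rewrite mulr_ge0 ?sqr_ge0.
have s1 : `|s| <= M / 2 * e by rewrite gtr0_norm ?mulr_gt0// ler_wpM2r// ltW.
have s2 : `|s'| <= M * (1 + x) * e.
  by rewrite /s' normrM (gtr0_norm e0) ler_wpM2r// ltW.
split.
- by apply: le_trans s1 _; apply: gauss_weight_decay; lra.
- apply: (@le_trans _ _ ((1 + x) * (M * (1 + x)) * e)).
    by rewrite -mulrA ler_wpM2l// addr_ge0.
  apply: gauss_weight_decay => //; first by rewrite !mulr_ge0// addr_ge0.
  lra.
- rewrite normrM normrN (ger0_norm (ler0n R 2)).
  have h : `|x * s' + g * s| <= (x * (M * (1 + x)) + M / 2) * e.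
    apply: le_trans (ler_normD _ _) _; rewrite (normrM x) (normrM g) (ger0_norm x0) (gtr0_norm g0) [leRHS]mulrDl.
    apply: lerD; first by rewrite -mulrA ler_wpM2l.
    by apply: le_trans s1; rewrite ler_piMl// ltW.
  apply: (@le_trans _ _ (2 * (x * (M * (1 + x)) + M / 2) * e)).
    by rewrite -[leRHS]mulrA; apply: ler_wpM2l.
  apply: gauss_weight_decay => //; last by lra.
  by rewrite !mulr_ge0// addr_ge0 ?divr_ge0// !mulr_ge0// addr_ge0.
Qed.

(** Gaussian decay, in the polynomial form that suffices for integrability; the
    weight 1 + x on the derivative serves the term y Psi' of V_t. *)
Lemma right_solution_bound : exists C, forall x, 0 <= x ->
  [/\ `|right_solution g x| <= C / (1 + x ^+ 2),
      (1 + x) * `|right_solution' g x| <= C / (1 + x ^+ 2) &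
      `|- 2 * (x * right_solution' g x + g * right_solution g x)| <= C / (1 + x ^+ 2)].
Proof.
have /andP[g0 g1] := g01.
have ag : - 1 < - g by lra.
have ag1 : - 1 < 1 - g by lra.
exists (2 * (Ipow (- g) 0 + Ipow (1 - g) 0) * (20 * expR 1)) => x x0.
apply: (gauss_combination_bound x0).
  rewrite Ipow_gt0//= mulrAC divff// mul1r (le_trans (Ipow_decr ag x0))// lerDl.
  by rewrite ltW// Ipow_gt0.
rewrite Ipow_gt0//= mulrAC divff// mul1r (le_trans (Ipow_decr ag1 x0))// lerDr.
by rewrite ltW// Ipow_gt0.
Qed.

End Bounds.

Local Opaque right_solution right_solution' even_solution even_solution'.

(** Psi1 and Psi2 are the first two derivatives of the profile Psi, and A is the
    diffusion coefficient as a function of the similarity variable. *)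
Record profile g (alpha : R) (Psi Psi1 Psi2 A : R -> R) (C : R) : Prop := Profile {
  profile_d1 : forall y : R, is_derive y 1 Psi (Psi1 y);
  profile_d2 : forall y : R, is_derive y 1 Psi1 (Psi2 y);
  profile_continuous : continuous Psi2;
  profile_measurable : measurable_fun setT A;
  profile_range : forall y, 1 <= A y <= alpha;
  profile_eq : forall y, A y * Psi2 y + 2 * y * Psi1 y + 2 * g * Psi y = 0;
  profile_bound : forall y, [/\ `|Psi y| <= C / (1 + y ^+ 2),
     (1 + `|y|) * `|Psi1 y| <= C / (1 + y ^+ 2) & `|Psi2 y| <= C / (1 + y ^+ 2)];
  profile_lt0 : Psi2 0 < 0 }.

(** Glue the even solution P on [-c, c] to k Q(r |y|) outside. The scaling r sends
    the inflection point c of P to the inflection point d of Q, and k matches the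
    values. *)
Lemma profile_of_hermite g c d (P P' Q Q' : R -> R) CQ : 0 < g -> 0 < d -> d < c ->
  hermite g P P' -> hermite g Q Q' ->
  (forall y, P (- y) = P y) -> (forall y, P' (- y) = - P' y) ->
  c * P' c + g * P c = 0 -> d * Q' d + g * Q d = 0 ->
  (forall x, 0 <= x -> [/\ `|Q x| <= CQ / (1 + x ^+ 2),
      (1 + x) * `|Q' x| <= CQ / (1 + x ^+ 2) &
      `|- 2 * (x * Q' x + g * Q x)| <= CQ / (1 + x ^+ 2)]) ->
  exists Psi Psi1 Psi2 A C, profile g ((c / d) ^+ 2) Psi Psi1 Psi2 A C.
Proof.
move=> g0 d_gt0 dc HP HQ PN P'N ec ed bQ; have c_gt0 : 0 < c := lt_trans d_gt0 dc.
pose P'' y := - 2 * (y * P' y + g * P y).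
pose Q'' y := - 2 * (y * Q' y + g * Q y).
have Qd : 0 < Q d := hermite_gt0 HQ d.
have Pc : 0 < P c := hermite_gt0 HP c.
pose k := P c / Q d; pose r := d / c.
have r0 : 0 < r by rewrite divr_gt0.
have r1 : r < 1 by rewrite ltr_pdivrMr// mul1r.
have rc : r * c = d by rewrite /r mulfVK// gt_eqF.
have P'c : P' c = - (g * P c) / c.
  by apply: (mulfI (lt0r_neq0 c_gt0)); rewrite mulrCA divff ?gt_eqF// mulr1; lra.
have Q'd : Q' d = - (g * Q d) / d.
  by apply: (mulfI (lt0r_neq0 d_gt0)); rewrite mulrCA divff ?gt_eqF// mulr1; lra.
have dP y : is_derive y 1 P (P' y) := hermite_d1 HP y.
have dP' y : is_derive y 1 P' (P'' y) := hermite_d2 HP y.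
have dQ y : is_derive y 1 Q (Q' y) := hermite_d1 HQ y.
have dQ' y : is_derive y 1 Q' (Q'' y) := hermite_d2 HQ y.
have P''c : P'' c = 0 by rewrite /P'' ec mulr0.
have Q''d : Q'' d = 0 by rewrite /Q'' ed mulr0.
have kd : k * Q d = P c by rewrite /k mulfVK// gt_eqF.
(* the first derivatives match because y Psi' = - g Psi at an inflection point *)
have k1d : k * r * Q' d = P' c.
  by rewrite Q'd P'c -kd /r; field; rewrite !gt_eqF.
have P''N y : P'' (- y) = P'' y by rewrite /P'' PN P'N; ring.
have dl (s y : R) : is_derive y 1 (fun y => s * y) s by derive_eq; ring.
pose R0 s y := k * Q (s * y); pose R1 s y := k * s * Q' (s * y); pose R2 s y := k * s ^+ 2 * Q'' (s * y).
have dR0 s (y : R) : is_derive y 1 (R0 s) (R1 s y).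
  have h := @is_derive1_chain _ Q (fun y => s * y) y _ _ (dQ (s * y)) (dl s y).
  by rewrite /R0 /R1; derive_eq; ring.
have dR1 s (y : R) : is_derive y 1 (R1 s) (R2 s y).
  have h := @is_derive1_chain _ Q' (fun y => s * y) y _ _ (dQ' (s * y)) (dl s y).
  by rewrite /R1 /R2; derive_eq; ring.
have rNc : - r * - c = d by rewrite mulrNN.
pose Psi := glue (- c) (R0 (- r)) (glue c P (R0 r)).
pose Psi1 := glue (- c) (R1 (- r)) (glue c P' (R1 r)).
pose Psi2 := glue (- c) (R2 (- r)) (glue c P'' (R2 r)).
have cc : - c < c by rewrite gtrN.
have g1c : forall y : R, is_derive y 1 (glue c P (R0 r)) (glue c P' (R1 r) y).
  apply: glue_is_derive => //; first by rewrite /R0 rc kd.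
  by rewrite /R1 rc k1d.
have g2c : forall y : R, is_derive y 1 (glue c P' (R1 r)) (glue c P'' (R2 r) y).
  apply: glue_is_derive => //; first by rewrite /R1 rc k1d.
  by rewrite /R2 rc Q''d mulr0.
have dPsi : forall y : R, is_derive y 1 Psi (Psi1 y).
  apply: glue_is_derive => //; first by rewrite /glue cc PN /R0 rNc.
  by rewrite /glue cc P'N /R1 rNc mulrN mulNr k1d.
have dPsi1 : forall y : R, is_derive y 1 Psi1 (Psi2 y).
  apply: glue_is_derive => //; first by rewrite /glue cc P'N /R1 rNc mulrN mulNr k1d.
  by rewrite /glue cc P''N /R2 rNc Q''d mulr0 P''c.
have cP'' : continuous P''.
  move=> y; have [l dl'] : exists l, is_derive y 1 P'' l.
    by have h1 := dP y; have h2 := dP' y; eexists; rewrite /P''; derive_auto.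
  exact: (is_derive1_continuous dl').
have cR2 s : continuous (R2 s).
  move=> y; have [l dl'] : exists l, is_derive y 1 (R2 s) l.
    have h1 := @is_derive1_chain _ Q (fun y => s * y) y _ _ (dQ (s * y)) (dl s y).
    have h2 := @is_derive1_chain _ Q' (fun y => s * y) y _ _ (dQ' (s * y)) (dl s y).
    by eexists; rewrite /R2 /Q''; derive_auto.
  exact: (is_derive1_continuous dl').
have cPsi2 : continuous Psi2.
  apply: glue_continuous; first exact: cR2.
    by apply: glue_continuous; [exact: cP''|exact: cR2|rewrite /R2 rc Q''d mulr0].
  by rewrite /glue cc P''N /R2 rNc Q''d mulr0 P''c.
pose A y : R := r ^- 2 + (1 - r ^- 2) * \1_(`]- c, c[) y.
have AE y : A y = if (- c < y) && (y < c) then 1 else r ^- 2.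
  rewrite /A indicE mem_setE in_itv /=; case: ifP => _; first by rewrite mulr1 addrC subrK.
  by rewrite mulr0 addr0.
have r2 : 1 < r ^- 2 by rewrite invf_gt1 ?exprn_gt0// exprn_ilt1// ltW.
have rn0 : r != 0 by rewrite gt_eqF.
have k0 : 0 < k by rewrite divr_gt0.
have [M M0 bP] : exists2 M, 0 <= M & forall y, y \in `[- c, c] -> [/\ `|P y| <= M, `|P' y| <= M & `|P'' y| <= M].
  have bnd (f : R -> R) : continuous f -> exists2 M, 0 <= M & forall y, y \in `[- c, c] -> `|f y| <= M.
    move=> cf; have cnf : {within `[- c, c], continuous (fun t => `|f t|)}.
      apply: continuous_subspaceT => t; apply: (@continuous_comp _ _ _ f (fun x => `|x|)); first exact: cf.
      exact: norm_continuous.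
    by have [t _ ht] := EVT_max (ltW cc) cnf; exists `|f t|.
  have [M1 p1 b1] := bnd P (fun y => is_derive1_continuous (dP y)).
  have [M2 p2 b2] := bnd P' (fun y => is_derive1_continuous (dP' y)).
  have [M3 p3 b3] := bnd P'' cP''.
  exists (M1 + M2 + M3) => [|y hy]; first by rewrite !addr_ge0.
  by have := b1 y hy; have := b2 y hy; have := b3 y hy; split; lra.
have far s y : s * y = r * `|y| -> `|s| = r ->
    [/\ `|R0 s y| <= k * CQ * r ^- 2 / (1 + y ^+ 2),
     (1 + `|y|) * `|R1 s y| <= k * CQ * r ^- 2 / (1 + y ^+ 2) &
     `|R2 s y| <= k * CQ * r ^- 2 / (1 + y ^+ 2)].
  move=> sy sr; set z := r * `|y| in sy *.
  have z0 : 0 <= z by rewrite mulr_ge0// ltW.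
  have [b1 b2 b3] := bQ z z0.
  have CQ0 : 0 <= CQ.
    have q0 : 0 < 1 + z ^+ 2 by rewrite ltr_pwDl ?sqr_ge0.
    have := le_trans (normr_ge0 _) b1; by rewrite pmulr_lge0 ?invr_gt0.
  have cmp : CQ / (1 + z ^+ 2) <= CQ * r ^- 2 / (1 + y ^+ 2).
    have zE : z ^+ 2 = r ^+ 2 * y ^+ 2 by rewrite /z exprMn real_normK ?num_real.
    have q1 : 0 < 1 + y ^+ 2 by rewrite ltr_pwDl ?sqr_ge0.
    have q2 : 0 < r ^+ 2 by rewrite exprn_gt0.
    have q3 : r ^+ 2 <= 1 by rewrite exprn_ile1// ltW.
    rewrite zE -mulrA ler_wpM2l// -invfM lef_pV2 ?posrE; last 2 first.
    - by rewrite ltr_pwDl// mulr_ge0// ?sqr_ge0// ltW.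
    - exact: mulr_gt0.
    by rewrite mulrDr mulr1 lerD2r.
  have e0 : `|R0 s y| = k * `|Q z| by rewrite /R0 sy normrM (gtr0_norm k0).
  have e1 : `|R1 s y| = k * (r * `|Q' z|) by rewrite /R1 sy (normrM (k * s)) (normrM k) (gtr0_norm k0) sr -mulrA.
  have e2 : `|R2 s y| = k * (r ^+ 2 * `|Q'' z|).
    by rewrite /R2 sy (normrM (k * s ^+ 2)) (normrM k) normrX (gtr0_norm k0) sr -mulrA.
  rewrite e0 e1 e2 -2!mulrA.
  have kle u : u <= CQ / (1 + z ^+ 2) -> k * u <= k * (CQ * (r ^- 2 / (1 + y ^+ 2))).
    by move=> h; rewrite ler_pM2l// mulrA; exact: le_trans cmp.
  split; first exact: kle.
    rewrite mulrCA; apply: kle; apply: le_trans b2.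
    rewrite mulrA ler_wpM2r// mulrDl mul1r [`|y| * r]mulrC lerD2r; exact: ltW.
  apply: kle; apply: le_trans b3; rewrite ler_piMl//.
  by rewrite exprn_ile1// ltW.
pose C := M * (1 + c) * (1 + c ^+ 2) + k * CQ * r ^- 2.
have C1 : 0 <= M * (1 + c) * (1 + c ^+ 2).
  by rewrite !mulr_ge0// ?addr_ge0 ?sqr_ge0// ltW.
have C2 : 0 <= k * CQ * r ^- 2.
  have [b1 _ _] := bQ 0 (lexx 0); rewrite expr0n /= addr0 divr1 in b1.
  have CQ0 : 0 <= CQ by exact: le_trans (normr_ge0 _) b1.
  by rewrite mulr_ge0 ?invr_ge0 ?sqr_ge0// mulr_ge0// ltW.
have up u y : u <= k * CQ * r ^- 2 / (1 + y ^+ 2) -> u <= C / (1 + y ^+ 2).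
  move=> h; apply: (le_trans h); rewrite ler_wpM2r ?invr_ge0 ?addr_ge0 ?sqr_ge0//.
  by rewrite /C lerDr.
exists Psi, Psi1, Psi2, A, C; split.
- exact: dPsi.
- exact: dPsi1.
- exact: cPsi2.
- apply: measurable_funD => //; apply: measurable_funM => //; exact: measurable_indic.
- have -> : (c / d) ^+ 2 = r ^- 2 by rewrite /r -exprVn invf_div.
  by move=> y; rewrite AE; case: ifP => _; rewrite ?lexx ?(ltW r2).
- move=> y; rewrite AE /Psi /Psi1 /Psi2 /glue; case: (ltP y (- c)) => [yc|yc].
    rewrite (_ : (- c < y) = false) /=; last by rewrite ltNge (ltW yc).
    by rewrite /R0 /R1 /R2 /Q''; field.
  case: (ltP y c) => [cy|cy]; last first.
    by rewrite andbF /R0 /R1 /R2 /Q''; field.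
  rewrite andbT; case: (ltP (- c) y) => [h|h]; first by rewrite /P''; ring.
  have yE : y = - c by apply/eqP; rewrite eq_le h yc.
  have e0 : y * P' y + g * P y = 0 by rewrite yE PN P'N mulrNN.
  have -> : P'' y = 0 by rewrite /P'' e0 mulr0.
  by rewrite mulr0 add0r -!mulrA -mulrDr e0 mulr0.
- move=> y; rewrite /Psi /Psi1 /Psi2 /glue; case: (ltP y (- c)) => [yc|yc].
    have yn : `|y| = - y by rewrite ltr0_norm// (lt_trans yc)// oppr_lt0.
    have h1 : - r * y = r * `|y| by rewrite yn mulrN mulNr.
    have h2 : `|- r| = r by rewrite normrN gtr0_norm.
    have [b1 b2 b3] := far _ _ h1 h2.
    by split; exact: up.
  case: (ltP y c) => [cy|cy]; last first.
    have yn : `|y| = y by rewrite ger0_norm// (le_trans (ltW c_gt0)).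
    have h1 : r * y = r * `|y| by rewrite yn.
    have [b1 b2 b3] := far _ _ h1 (gtr0_norm r0).
    by split; exact: up.
  have hy : y \in `[- c, c] by rewrite in_itv /= yc ltW.
  have [b1 b2 b3] := bP y hy.
  have yc' : `|y| <= c by rewrite ler_norml yc ltW.
  have q0 : 0 < 1 + y ^+ 2 by rewrite ltr_pwDl ?sqr_ge0.
  have ysq : y ^+ 2 <= c ^+ 2 by rewrite -(real_normK (num_real y)) ler_sqr ?nnegrE// ltW.
  have main u : 0 <= u -> u <= M * (1 + c) -> u <= C / (1 + y ^+ 2).
    move=> u0 uM; rewrite ler_pdivlMr//.
    apply: (@le_trans _ _ (M * (1 + c) * (1 + c ^+ 2))); last by rewrite /C lerDl.
    by apply: ler_pM => //; [exact: ltW|rewrite lerD2l].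
  have Mc : M <= M * (1 + c) by rewrite ler_peMr// lerDl ltW.
  split; apply: main.
  + exact: normr_ge0.
  + exact: le_trans Mc.
  + by apply: mulr_ge0; [exact: addr_ge0|exact: normr_ge0].
  + rewrite mulrC; apply: ler_pM; [exact: normr_ge0|exact: addr_ge0|exact: b2|].
    by rewrite lerD2l.
  + exact: normr_ge0.
  + exact: le_trans Mc.
- have nc : - c < 0 by rewrite oppr_lt0.
  rewrite /Psi2 /glue (ltNge 0) (ltW nc) /= c_gt0 /P'' mul0r add0r.
  by rewrite mulNr oppr_lt0 mulr_gt0// mulr_gt0//; exact: hermite_gt0 HP 0.
Qed.

Lemma profile_exists g : 0 < g < 1 ->
  exists Psi Psi1 Psi2 A C, profile g (beta_ g) Psi Psi1 Psi2 A C.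
Proof.
move=> g01; have /andP[g0 _] := g01.
have [c_gt0 ec] := c0_spec g01; have [d_gt0 ed] := c1_spec g01.
have [CQ bQ] := right_solution_bound g01.
exact: (profile_of_hermite g0 d_gt0 (c1_lt_c0 g01) (hermite_even g01) (hermite_right g01)
  (even_solutionN g) (even_solution'N g) ec ed bQ).
Qed.

End Profile.

(** * Cutoff functions *)

Section Cutoffs.
Variable R : realType.
Implicit Types (t x y : R) (n : nat).

Let P1 : {poly R} := dflat 1.
Let P2 : {poly R} := dflat P1.

(** With m = n + 1, the first factor is a function of m (1 - t) - 1, so that it
    vanishes for 1 - t <= 1/m; the second one vanishes for t <= -1. *)
Definition time_cutoff n t : R :=
  flat 1 (- n.+1%:R * t + n%:R) * flat 1 (n.+1%:R * t + n.+1%:R).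

Definition time_cutoff' n t : R :=
  - n.+1%:R * flat P1 (- n.+1%:R * t + n%:R) * flat 1 (n.+1%:R * t + n.+1%:R) +
  flat 1 (- n.+1%:R * t + n%:R) * (n.+1%:R * flat P1 (n.+1%:R * t + n.+1%:R)).

Definition space_cutoff n x : R := flat 1 (n%:R + x) * flat 1 (n%:R - x).

Definition space_cutoff' n x : R :=
  flat P1 (n%:R + x) * flat 1 (n%:R - x) - flat 1 (n%:R + x) * flat P1 (n%:R - x).

Definition space_cutoff'' n x : R :=
  flat P2 (n%:R + x) * flat 1 (n%:R - x) - 2 * (flat P1 (n%:R + x) * flat P1 (n%:R - x)) +
  flat 1 (n%:R + x) * flat P2 (n%:R - x).

Lemma is_derive_flat_affine P (a b x : R) :
  is_derive x 1 (fun y => flat P (a * y + b)) (a * flat (dflat P) (a * x + b)).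
Proof.
have h := is_derive_flat P (a * x + b).
apply: (is_derive1_eq (@is_derive1_chain _ _ (fun y => a * y + b) x _ a h _)); last by rewrite mulrC.
by derive_eq; ring.
Qed.

Lemma is_derive_time_cutoff n t : is_derive t 1 (time_cutoff n) (time_cutoff' n t).
Proof.
have h1 := is_derive_flat_affine 1 (- n.+1%:R) n%:R t.
have h2 := is_derive_flat_affine 1 n.+1%:R n.+1%:R t.
exact: (is_derive1_M h1 h2).
Qed.

Lemma is_derive_flatD P n x :
  is_derive x 1 (fun y => flat P (n%:R + y)) (flat (dflat P) (n%:R + x)).
Proof.
have h := is_derive_flat P (n%:R + x).
apply: (is_derive1_eq (@is_derive1_chain _ _ (fun y => n%:R + y) x _ 1 h _)); last by rewrite mulr1.
by derive_eq; ring.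
Qed.

Lemma is_derive_flatB P n x :
  is_derive x 1 (fun y => flat P (n%:R - y)) (- flat (dflat P) (n%:R - x)).
Proof.
have h := is_derive_flat P (n%:R - x).
apply: (is_derive1_eq (@is_derive1_chain _ _ (fun y => n%:R - y) x _ (- 1) h _)); last by rewrite mulrN1.
by derive_eq; ring.
Qed.

Lemma is_derive_space_cutoff n x : is_derive x 1 (space_cutoff n) (space_cutoff' n x).
Proof.
apply: (is_derive1_eq (is_derive1_M (is_derive_flatD 1 n x) (is_derive_flatB 1 n x))).
by rewrite mulrN.
Qed.

Lemma is_derive_space_cutoff' n x : is_derive x 1 (space_cutoff' n) (space_cutoff'' n x).
Proof.
have h1 := is_derive1_M (is_derive_flatD P1 n x) (is_derive_flatB 1 n x).
have h2 := is_derive1_M (is_derive_flatD 1 n x) (is_derive_flatB P1 n x).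
apply: (is_derive1_eq (is_derive1_D h1 (is_derive1_N h2))).
by rewrite /space_cutoff'' /P2 /P1; ring.
Qed.

Lemma time_cutoff_eq0 n t : t <= - 1 \/ 1 - n.+1%:R^-1 <= t ->
  time_cutoff n t = 0 /\ time_cutoff' n t = 0.
Proof.
have n0 : (0 : R) < n.+1%:R by rewrite ltr0n.
case=> h; rewrite /time_cutoff /time_cutoff'.
  have e : n.+1%:R * t + n.+1%:R <= 0.
    by rewrite -[X in _ + X]mulr1 -mulrDr mulr_ge0_le0//; lra.
  by rewrite !(flat_le0 _ e) !mulr0 addr0.
have e : - n.+1%:R * t + n%:R <= 0.
  have := ler_wpM2l (ltW n0) h; rewrite mulrBr mulr1 divff ?gt_eqF//.
  by rewrite -natr1 mulNr; lra.
by rewrite !(flat_le0 _ e) mulr0 !mul0r addr0.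
Qed.

Lemma space_cutoff_eq0 n x : n%:R <= `|x| ->
  [/\ space_cutoff n x = 0, space_cutoff' n x = 0 & space_cutoff'' n x = 0].
Proof.
rewrite /space_cutoff /space_cutoff' /space_cutoff''.
have [x0|x0] := leP 0 x; rewrite ?(ger0_norm x0) ?(ltr0_norm x0) => h.
  have e : n%:R - x <= 0 by rewrite subr_le0.
  by rewrite !(flat_le0 _ e) !mulr0 subr0 addr0.
have e : n%:R + x <= 0 by rewrite -[x]opprK subr_le0.
by rewrite !(flat_le0 _ e) !mul0r mulr0 subrr addr0.
Qed.

Lemma space_cutoff_cvg x :
  [/\ space_cutoff n x @[n --> \oo] --> (1 : R), space_cutoff' n x @[n --> \oo] --> (0 : R) &
      space_cutoff'' n x @[n --> \oo] --> (0 : R)].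
Proof.
have cn : n%:R @[n --> \oo] --> (+oo : set_system R) := cvgr_idn.
have u1 : n%:R + x @[n --> \oo] --> +oo.
  apply/cvgryPge => A; near=> n; rewrite -lerBlDr; near: n.
  by have := (cvgryPge _).1 cn; apply.
have u2 : n%:R - x @[n --> \oo] --> +oo.
  apply/cvgryPge => A; near=> n; rewrite -lerBlDr opprK; near: n.
  by have := (cvgryPge _).1 cn; apply.
have one : (1 : {poly R}).[0] = 1 by rewrite hornerC.
have f P := @flat_cvg _ P _ u1; have g P := @flat_cvg _ P _ u2.
have f1 := f 1; have g1 := g 1; rewrite one in f1 g1.
have f2 := f P1; have g2 := g P1; rewrite dflat0 in f2 g2.
have f3 := f P2; have g3 := g P2; rewrite dflat0 in f3 g3.
split.
- by rewrite -[X in _ --> X]mulr1; exact: cvgM.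
- by rewrite -[X in _ --> X](_ : 0 * 1 - 1 * 0 = 0); [apply: cvgB; exact: cvgM|ring].
- rewrite -[X in _ --> X](_ : 0 * 1 - 2 * (0 * 0) + 1 * 0 = 0); last by ring.
  apply: cvgD; last exact: cvgM.
  by apply: cvgB; [exact: cvgM|apply: cvgM; [exact: cvg_cst|exact: cvgM]].
Unshelve. all: by end_near. Qed.

Lemma space_cutoff_bounded : exists2 C, 0 <= C & forall n x,
  [/\ `|space_cutoff n x| <= C, `|space_cutoff' n x| <= C & `|space_cutoff'' n x| <= C].
Proof.
have [C1 p1 b1] := flat_bounded P1; have [C2 p2 b2] := flat_bounded P2.
have b0 y : `|flat (1 : {poly R}) y| <= 1 by rewrite ger0_norm ?flat1_ge0// flat1_le1.
exists (1 + C1 * 2 + C2 * 2 + 2 * C1 ^+ 2) => [|n x].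
  by rewrite !addr_ge0// ?mulr_ge0 ?exprn_ge0.
have m P Q C D y z : `|flat P y| <= C -> `|flat Q z| <= D -> `|flat P y * flat Q z| <= C * D.
  by move=> h h'; rewrite normrM ler_pM.
have s2 : 0 <= C1 ^+ 2 by rewrite sqr_ge0.
split; rewrite /space_cutoff /space_cutoff' /space_cutoff''.
- have := m 1 1 _ _ _ _ (b0 (n%:R + x)) (b0 (n%:R - x)); rewrite mulr1; lra.
- apply: le_trans (ler_normB _ _) _.
  have := m P1 1 _ _ _ _ (b1 (n%:R + x)) (b0 (n%:R - x)).
  have := m 1 P1 _ _ _ _ (b0 (n%:R + x)) (b1 (n%:R - x)).
  by rewrite mulr1 mul1r; lra.
- have := m P2 1 _ _ _ _ (b2 (n%:R + x)) (b0 (n%:R - x)).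
  have := m 1 P2 _ _ _ _ (b0 (n%:R + x)) (b2 (n%:R - x)).
  have := m P1 P1 _ _ _ _ (b1 (n%:R + x)) (b1 (n%:R - x)).
  rewrite mulr1 mul1r -expr2 => h1 h2 h3.
  apply: le_trans (ler_normD _ _) _.
  apply: (@le_trans _ _ (C2 + 2 * C1 ^+ 2 + C2)); last lra.
  apply: lerD h2; apply: le_trans (ler_normB _ _) _; apply: lerD h3 _.
  by rewrite normrM ger0_norm// ler_wpM2l.
Qed.

Lemma time_argument_scale n t : t < 1 ->
  n.+1%:R = (1 + (- n.+1%:R * t + n%:R)) / (1 - t) :> R.
Proof. by move=> t1; rewrite -natr1; field; rewrite subr_eq0 gt_eqF. Qed.

(** The derivative of the time cutoff is of order 1/(1 - t), the one loss that
    the integrability of the dual solution can absorb. *)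
Lemma time_cutoff'E n t : 0 < t < 1 ->
  time_cutoff' n t =
   - (1 - t)^-1 * (flat P1 (- n.+1%:R * t + n%:R) + flat ('X * 1) (- n.+1%:R * t + n%:R)) *
     flat 1 (n.+1%:R * t + n.+1%:R) +
   flat 1 (- n.+1%:R * t + n%:R) * ((1 + t)^-1 * flat ('X * 1) (n.+1%:R * t + n.+1%:R)).
Proof.
move=> /andP[t0 t1]; rewrite /time_cutoff'.
have PE : P1 = 'X * ('X * 1) by rewrite /P1 /dflat -polyC1 derivC subr0 polyC1 !mulr1 expr2.
have s0 : 1 - t != 0 by rewrite subr_eq0 gt_eqF.
have s1 : 1 + t != 0 by rewrite gt_eqF// addr_gt0.
set y := - n.+1%:R * t + n%:R; set z := n.+1%:R * t + n.+1%:R.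
have e1 : - n.+1%:R * flat P1 y = - (1 - t)^-1 * (flat P1 y + flat ('X * 1) y).
  rewrite (time_argument_scale n t1) -/y -(flat_mulX ('X * 1) y) -PE.
  by field.
have e2 : n.+1%:R * flat P1 z = (1 + t)^-1 * flat ('X * 1) z.
  rewrite -(flat_mulX ('X * 1) z) -PE (_ : n.+1%:R = (1 + t)^-1 * z); first by rewrite mulrA.
  by rewrite /z; field.
by rewrite e1 e2.
Qed.

Lemma time_cutoff_cvg t : 0 < t < 1 ->
  time_cutoff n t @[n --> \oo] --> (1 : R) /\ time_cutoff' n t @[n --> \oo] --> (0 : R).
Proof.
move=> t01; have /andP[t0 t1] := t01.
have s0 : 0 < 1 - t by rewrite subr_gt0.
have cn : n%:R @[n --> \oo] --> (+oo : set_system R) := cvgr_idn.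
have u1 : - n.+1%:R * t + n%:R @[n --> \oo] --> +oo.
  apply/cvgryPge => A; near=> n.
  rewrite -natr1; apply: (@le_trans _ _ ((1 - t) * n%:R - t)); last by lra.
  rewrite lerBrDr -ler_pdivrMl//; near: n.
  by have := (cvgryPge _).1 cn; apply.
have u2 : n.+1%:R * t + n.+1%:R @[n --> \oo] --> +oo.
  apply/cvgryPge => A; near=> n; rewrite (@le_trans _ _ n.+1%:R)//; last first.
    by rewrite lerDr mulr_ge0// ltW.
  by near: n; have := (cvgryPge _).1 (@cvgr_natr R); apply.
have one : (1 : {poly R}).[0] = 1 by rewrite hornerC.
have z1 : ('X * 1 : {poly R}).[0] = 0 by rewrite mulr1 hornerX.
have f P := @flat_cvg _ P _ u1; have g P := @flat_cvg _ P _ u2.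
have f1 := f 1; have g1 := g 1; rewrite one in f1 g1.
have f2 := f P1; rewrite dflat0 in f2.
have f3 := f ('X * 1); have g3 := g ('X * 1); rewrite z1 in f3 g3.
split; first by rewrite -[X in _ --> X]mulr1; exact: cvgM.
rewrite -[X in _ --> X](_ : - (1 - t)^-1 * (0 + 0) * 1 + 1 * ((1 + t)^-1 * 0) = 0);
  last by rewrite addr0 !mulr0 mul0r addr0.
rewrite (funext (fun n => time_cutoff'E n t01)).
apply: cvgD; apply: cvgM => //.
  by apply: cvgM; [exact: cvg_cst|exact: cvgD].
by apply: cvgM; [exact: cvg_cst|].
Unshelve. all: by end_near. Qed.

Lemma time_cutoff_le1 n t : `|time_cutoff n t| <= 1.
Proof. by rewrite ger0_norm ?mulr_ge0 ?flat1_ge0// mulr_ile1 ?flat1_ge0 ?flat1_le1. Qed.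

Lemma time_cutoff'_bounded : exists2 C, 0 <= C & forall n t, 0 < t < 1 ->
  `|time_cutoff' n t| <= C / (1 - t).
Proof.
have [C1 p1 b1] := flat_bounded P1; have [C2 p2 b2] := flat_bounded ('X * 1 : {poly R}).
have b0 y : `|flat (1 : {poly R}) y| <= 1 by rewrite ger0_norm ?flat1_ge0// flat1_le1.
exists (C1 + C2 + C2) => [|n t t01]; first by rewrite !addr_ge0.
have /andP[t0 t1] := t01; have s0 : 0 < 1 - t by rewrite subr_gt0.
have st0 : 0 < 1 + t by rewrite addr_gt0.
rewrite time_cutoff'E// (le_trans (ler_normD _ _))// [leRHS]mulrDl; apply: lerD.
  rewrite normrM normrM normrN (gtr0_norm (x := _^-1)) ?invr_gt0// -mulrA [leRHS]mulrC.
  rewrite ler_wpM2l ?invr_ge0 ?(ltW s0)// -[leRHS]mulr1 ler_pM//.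
  by apply: le_trans (ler_normD _ _) _; apply: lerD.
rewrite normrM normrM (gtr0_norm (x := _^-1)) ?invr_gt0// -[leRHS]mul1r.
apply: ler_pM => //; first by rewrite mulr_ge0// invr_ge0 ltW.
rewrite mulrC ler_pM ?invr_ge0 ?(ltW st0)// lef_pV2 ?posrE//; lra.
Qed.

End Cutoffs.

(** * Self-similar functions *)

Section SelfSimilar.
Variable R : realType.
Notation T := (measurableTypeR R * measurableTypeR R)%type.
Implicit Types (F : R -> R) (e t x : R) (z : R * R).

Definition similarity t x : R := x * (1 - t) `^ (- 2^-1) / 2.

(** The similarity variable is x / (2 sqrt (1 - t)). Derivatives in t and x stay in
    this family and lower the exponent e by 1 and 1/2. *)
Definition selfsim e F z : R := (1 - z.1) `^ e * F (similarity z.1 z.2).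

Lemma is_derive_similarity_x t x : is_derive x 1 (similarity t) ((1 - t) `^ (- 2^-1) / 2).
Proof. by rewrite /similarity; derive_eq; ring. Qed.

Lemma is_derive_powR1B e t : t < 1 ->
  is_derive t 1 (fun s => (1 - s) `^ e) (- e * (1 - t) `^ (e - 1)).
Proof.
move=> t1; have s0 : 0 < 1 - t by rewrite subr_gt0.
have h := is_derive1_powR e s0.
apply: (is_derive1_eq (@is_derive1_chain _ (fun s => s `^ e) (fun s => 1 - s) t _ (- 1) h _)).
  by derive_eq; ring.
by rewrite mulrN1 mulNr.
Qed.

Lemma powR1B_split e t : t < 1 -> (1 - t) `^ e = (1 - t) `^ (e - 1) * (1 - t).
Proof.
move=> t1; have s0 : 0 < 1 - t by rewrite subr_gt0.
have {1}-> : e = (e - 1) + 1 by ring.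
by rewrite powRD ?powRr1 ?ltW//; apply/implyP => _; rewrite gt_eqF.
Qed.

Lemma powR1BD e e' t : t < 1 -> (1 - t) `^ (e + e') = (1 - t) `^ e * (1 - t) `^ e'.
Proof.
by move=> t1; rewrite powRD//; apply/implyP => _; rewrite gt_eqF// subr_gt0.
Qed.

Lemma is_derive_similarity_t t x : t < 1 ->
  is_derive t 1 (fun s => similarity s x) (similarity t x / 2 / (1 - t)).
Proof.
move=> t1; have s0 : 1 - t != 0 by rewrite subr_eq0 gt_eqF.
have h := is_derive_powR1B (- 2^-1) t1; rewrite /similarity; derive_eq.
by rewrite (powR1B_split _ t1); field.
Qed.

Lemma selfsim_dx e F F' t x : t < 1 -> (forall y : R, is_derive y 1 F (F' y)) ->
  is_derive x 1 (fun y => selfsim e F (t, y)) (selfsim (e - 2^-1) F' (t, x) / 2).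
Proof.
move=> t1 dF; have h1 := is_derive_similarity_x t x.
have h := @is_derive1_chain _ F (similarity t) x _ _ (dF _) h1.
by rewrite /selfsim /= (powR1BD _ _ t1); derive_eq; ring.
Qed.

Lemma selfsim_dt e F F' t x : t < 1 -> (forall y : R, is_derive y 1 F (F' y)) ->
  is_derive t 1 (fun s => selfsim e F (s, x))
    (selfsim (e - 1) (fun y => - e * F y + y / 2 * F' y) (t, x)).
Proof.
move=> t1 dF; have s0 : 1 - t != 0 by rewrite subr_eq0 gt_eqF.
have h1 := is_derive_similarity_t x t1; have h2 := is_derive_powR1B e t1.
have h := @is_derive1_chain _ F (fun s => similarity s x) t _ _ (dF _) h1.
by rewrite /selfsim /=; derive_eq; rewrite (powR1B_split e t1); field.
Qed.

Lemma selfsim_continuous e F z : continuous F -> z.1 < 1 -> {for z, continuous (selfsim e F)}.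
Proof.
move=> cF t1; have s0 : 0 < 1 - z.1 by rewrite subr_gt0.
have c1 : {for z, continuous (fun w : R * R => 1 - w.1)}.
  by apply: cvgB; [exact: cvg_cst|exact: cvg_fst].
have cp a : {for z, continuous (fun w : R * R => (1 - w.1) `^ a)}.
  exact: (cvg_comp _ (fun s => s `^ a) c1 (powR_continuous s0)).
apply: cvgM; first exact: cp.
apply: (cvg_comp _ F _ (cF _)); apply: cvgM; last exact: cvg_cst.
by apply: cvgM; [exact: cvg_snd|exact: cp].
Qed.

Lemma measurable_selfsim e F : measurable_fun setT F -> @measurable_fun _ _ T R setT (selfsim e F).
Proof.
move=> mF; have mp a : @measurable_fun _ _ T R setT (fun w : R * R => (1 - w.1) `^ a).
  apply: (@measurableT_comp _ _ _ _ _ _ (fun s : R => s `^ a)); first exact: measurable_powR.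
  by apply: measurable_funB => //; exact: measurable_fst.
apply: measurable_funM; first exact: mp.
apply: measurableT_comp => //; apply: measurable_funM => //.
by apply: measurable_funM; [exact: measurable_snd|exact: mp].
Qed.

End SelfSimilar.

(** * Truncation *)

Section Truncation.
Variable R : realType.
Notation T := (measurableTypeR R * measurableTypeR R)%type.
Implicit Types (c k : R -> R) (n : nat) (t x : R) (z : R * R).

Lemma bounded_of_square_support (f : R * R -> R) N : continuous f ->
  (forall z, ~ square N z -> f z = 0) -> exists C, forall z, `|f z| <= C.
Proof.
move=> cf f0; have cK : compact (square N) by apply: compact_setX; exact: segment_compact.
have cn : {within square N, continuous (fun z => `|f z|)}.
  apply: continuous_subspaceT => z; apply: (@continuous_comp _ _ _ f (fun x => `|x|)).
    exact: cf.
  exact: norm_continuous.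
have [[z0 Kz0]|h] := pselect (square N !=set0); last first.
  by exists 0 => z; rewrite f0 ?normr0// => Kz; apply: h; exists z.
have [w _ hw] := compact_EVT_max (ex_intro _ z0 Kz0) cK cn; exists `|f w| => z.
by have [Kz|/f0 ->] := pselect (square N z); [apply: hw; rewrite inE|rewrite normr0].
Qed.

(** H may be arbitrary for t >= 1, where the cutoff c vanishes identically. *)
Lemma cutoff_continuous c k (H : R * R -> R) (tau : R) : tau < 1 ->
  continuous c -> continuous k -> (forall t, tau <= t -> c t = 0) ->
  (forall z, z.1 < 1 -> {for z, continuous H}) ->
  continuous (fun z => c z.1 * k z.2 * H z).
Proof.
move=> tau1 cc ck c0 cH z; have [z1|z1] := ltP z.1 1.
  apply: cvgM; last exact: cH.
  apply: cvgM; first by apply: (cvg_comp _ c _ (cc _)); exact: cvg_fst.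
  by apply: (cvg_comp _ k _ (ck _)); exact: cvg_snd.
rewrite /continuous_at c0 ?mul0r; last by rewrite (le_trans (ltW tau1)).
apply: cvg_near_cst; have : \forall w \near z, tau < w.1.
  have cf : w.1 @[w --> z] --> z.1 by exact: cvg_fst.
  by have := cf _ (lt_nbhsr (lt_le_trans tau1 z1)).
by apply: filterS => w h; rewrite c0 ?mul0r// ltW.
Qed.

Lemma cutoff_is_derive c c' (h h' : R -> R) (tau t : R) : tau < 1 ->
  (forall t : R, is_derive t 1 c (c' t)) -> (forall t, tau <= t -> c t = 0 /\ c' t = 0) ->
  (forall t : R, t < 1 -> is_derive t 1 h (h' t)) ->
  is_derive t 1 (fun s => c s * h s) (c' t * h t + c t * h' t).
Proof.
move=> tau1 dc c0 dh; have [t1|t1] := ltP t 1; first exact: (is_derive1_M (dc t) (dh _ t1)).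
have [-> ->] := c0 _ (le_trans (ltW tau1) t1); rewrite !mul0r addr0.
apply: (@near_eq_is_derive R R R (fun=> 0) _ t 1).
have h0 : tau < t := lt_le_trans tau1 t1.
near=> s; have [|-> _] := c0 s; last by rewrite mul0r.
by rewrite ltW//; near: s; exact: lt_nbhsr.
Unshelve. all: by end_near. Qed.

(** Classical derivatives on the half-plane t < 1, without control at t = 1. *)
Record half_plane_C12 (H Ht Hx Hxx : R * R -> R) : Prop := HalfPlaneC12 {
  hp_t : forall t x, t < 1 -> is_derive t 1 (fun s => H (s, x)) (Ht (t, x));
  hp_x : forall t x, t < 1 -> is_derive x 1 (fun y => H (t, y)) (Hx (t, x));
  hp_xx : forall t x, t < 1 -> is_derive x 1 (fun y => Hx (t, y)) (Hxx (t, x));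
  hp_continuous : forall z, z.1 < 1 -> [/\ {for z, continuous H}, {for z, continuous Ht},
                    {for z, continuous Hx} & {for z, continuous Hxx}];
  hp_measurable : [/\ @measurable_fun _ _ T R setT H, @measurable_fun _ _ T R setT Ht,
                      @measurable_fun _ _ T R setT Hx & @measurable_fun _ _ T R setT Hxx] }.

Section Truncate.
Variables (H Ht Hx Hxx : R * R -> R) (n : nat).
Hypothesis hH : half_plane_C12 H Ht Hx Hxx.

Definition trunc z : R := time_cutoff n z.1 * space_cutoff n z.2 * H z.
Definition trunc_t z : R := time_cutoff' n z.1 * space_cutoff n z.2 * H z +
  time_cutoff n z.1 * space_cutoff n z.2 * Ht z.
Definition trunc_x z : R := time_cutoff n z.1 * space_cutoff' n z.2 * H z +
  time_cutoff n z.1 * space_cutoff n z.2 * Hx z.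
Definition trunc_xx z : R := time_cutoff n z.1 * space_cutoff'' n z.2 * H z +
  2 * (time_cutoff n z.1 * space_cutoff' n z.2 * Hx z) +
  time_cutoff n z.1 * space_cutoff n z.2 * Hxx z.

Let tau : R := 1 - n.+1%:R^-1.
Let tau1 : tau < 1. Proof. by rewrite ltrBlDr ltrDl invr_gt0 ltr0n. Qed.

Let c0 t : tau <= t -> time_cutoff n t = 0 /\ time_cutoff' n t = 0.
Proof. by move=> h; apply: time_cutoff_eq0; right. Qed.

Lemma trunc_support z : ~ square n.+1%:R z ->
  [/\ trunc z = 0, trunc_t z = 0, trunc_x z = 0 & trunc_xx z = 0].
Proof.
move=> nz; suff: (time_cutoff n z.1 = 0 /\ time_cutoff' n z.1 = 0) \/
   [/\ space_cutoff n z.2 = 0, space_cutoff' n z.2 = 0 & space_cutoff'' n z.2 = 0].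
  rewrite /trunc /trunc_t /trunc_x /trunc_xx.
  by case=> [[-> ->]|[-> -> ->]]; rewrite !(mulr0, mul0r, addr0).
have n1 : (1 : R) <= n.+1%:R by rewrite ler1n.
have n0 : 0 < n.+1%:R^-1 :> R by rewrite invr_gt0 ltr0n.
have [h|h] := pselect (n%:R <= `|z.2|); first by right; exact: space_cutoff_eq0.
left; apply: time_cutoff_eq0; have [t1|t1] := leP z.1 (- 1); first by left.
right; have [//|t2] := leP (1 - n.+1%:R^-1) z.1.
case: nz; move/negP: h; rewrite -ltNge ltr_norml => /andP[h1 h2].
have e : n.+1%:R = n%:R + 1 :> R by rewrite -natr1.
have m0 : 0 <= n%:R :> R := ler0n _ _.
have {n0 n1} t3 : z.1 < 1 by rewrite (lt_trans t2)// ltrBlDr ltrDl.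
move: (n.+1%:R : R) (n%:R : R) e m0 h1 h2 => M m e m0 h1 h2.
by split; rewrite /= in_itv /=; apply/andP; split; lra.
Qed.

Let ctc : continuous (time_cutoff n : R -> R).
Proof. by move=> t; exact: is_derive1_continuous (is_derive_time_cutoff n t). Qed.

Let ctc' : continuous (time_cutoff' n : R -> R).
Proof.
move=> t; have h P := is_derive_flat_affine P (- n.+1%:R) n%:R t.
have k P := is_derive_flat_affine P n.+1%:R n.+1%:R t.
have [l dl] : exists l, is_derive t 1 (time_cutoff' n) l.
  have h1 := h 1; have k1 := k 1; have h2 := h (dflat 1); have k2 := k (dflat 1).
  by eexists; rewrite /time_cutoff'; derive_auto.
exact: (is_derive1_continuous dl).
Qed.

Let csc : continuous (space_cutoff n : R -> R).
Proof. by move=> t; exact: is_derive1_continuous (is_derive_space_cutoff n t). Qed.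

Let csc' : continuous (space_cutoff' n : R -> R).
Proof. by move=> t; exact: is_derive1_continuous (is_derive_space_cutoff' n t). Qed.

Let csc'' : continuous (space_cutoff'' n : R -> R).
Proof.
move=> t; have h P := is_derive_flatD P n t; have k P := is_derive_flatB P n t.
have [l dl] : exists l, is_derive t 1 (space_cutoff'' n) l.
  have h1 := h 1; have k1 := k 1; have h2 := h (dflat 1); have k2 := k (dflat 1).
  have h3 := h (dflat (dflat 1)); have k3 := k (dflat (dflat 1)).
  by eexists; rewrite /space_cutoff''; derive_auto.
exact: (is_derive1_continuous dl).
Qed.

Lemma trunc_continuous : [/\ continuous trunc, continuous trunc_t & continuous trunc_xx].
Proof.
have cc := cutoff_continuous tau1.
have c1 t : tau <= t -> time_cutoff n t = 0 by move=> /c0[].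
have c2 t : tau <= t -> time_cutoff' n t = 0 by move=> /c0[].
have h1 z : z.1 < 1 -> {for z, continuous H} by move=> /(hp_continuous hH)[].
have h2 z : z.1 < 1 -> {for z, continuous Ht} by move=> /(hp_continuous hH)[].
have h3 z : z.1 < 1 -> {for z, continuous Hx} by move=> /(hp_continuous hH)[].
have h4 z : z.1 < 1 -> {for z, continuous Hxx} by move=> /(hp_continuous hH)[].
split=> [|z|z].
- exact: cc.
- by apply: cvgD; apply: cc.
- apply: cvgD; last exact: cc.
  by apply: cvgD; [exact: cc|apply: cvgM; [exact: cvg_cst|exact: cc]].
Qed.

Lemma trunc_measurable : [/\ @measurable_fun _ _ T R setT trunc,
  @measurable_fun _ _ T R setT trunc_t & @measurable_fun _ _ T R setT trunc_xx].
Proof.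
have [m1 m2 m3 m4] := hp_measurable hH.
have mc (c k : R -> R) h : continuous c -> continuous k -> @measurable_fun _ _ T R setT h ->
    @measurable_fun _ _ T R setT (fun z => c z.1 * k z.2 * h z).
  move=> cc ck mh; apply: measurable_funM => //.
  by apply: measurable_tensor; exact: continuous_measurable_fun.
split.
- exact: mc.
- by apply: measurable_funD; exact: mc.
- apply: measurable_funD; last exact: mc.
  by apply: measurable_funD; [exact: mc|apply: measurable_funM => //; exact: mc].
Qed.

Lemma trunc_C12 : exists C, compact_C12 trunc trunc_t trunc_x trunc_xx n.+1%:R C.
Proof.
have [k1 k2 k3] := trunc_continuous.
have [C1 b1] := bounded_of_square_support k1 (fun z h => let: And4 e _ _ _ := trunc_support h in e).
have [C2 b2] := bounded_of_square_support k2 (fun z h => let: And4 _ e _ _ := trunc_support h in e).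
have [C3 b3] := bounded_of_square_support k3 (fun z h => let: And4 _ _ _ e := trunc_support h in e).
exists (C1 + C2 + C3); split.
- move=> t x; have dc := fun s : R => is_derive_time_cutoff n s.
  have dh (s : R) : s < 1 -> is_derive s 1 (fun s => space_cutoff n x * H (s, x))
      (space_cutoff n x * Ht (s, x)).
    by move=> s1; have h := hp_t hH x s1; derive_eq; ring.
  rewrite /trunc /trunc_t /=; under eq_fun do rewrite -mulrA.
  apply: is_derive1_eq (cutoff_is_derive t tau1 dc c0 dh) _; ring.
- move=> t x; have [t1|t1] := ltP t 1.
    have h := hp_x hH x t1; have h' := is_derive_space_cutoff n x.
    by rewrite /trunc /trunc_x /=; derive_eq; ring.
  have [e _] := c0 (le_trans (ltW tau1) t1).
  rewrite /trunc /trunc_x /= e; under eq_fun do rewrite !mul0r.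
  by rewrite !mul0r addr0; exact: is_derive1_cst.
- move=> t x; have [t1|t1] := ltP t 1.
    have h := hp_x hH x t1; have h' := is_derive_space_cutoff n x.
    have h2 := hp_xx hH x t1; have h2' := is_derive_space_cutoff' n x.
    by rewrite /trunc_x /trunc_xx /=; derive_eq; ring.
  have [e _] := c0 (le_trans (ltW tau1) t1).
  rewrite /trunc_x /trunc_xx /= e; under eq_fun do rewrite !mul0r addr0.
  by rewrite !mul0r mulr0 !addr0; exact: is_derive1_cst.
- by [].
- exact: trunc_measurable.
- by move=> z; apply: le_trans (b1 z) _; rewrite -addrA lerDl addr_ge0 ?(le_trans _ (b2 z)) ?(le_trans _ (b3 z)).
- by move=> z; apply: le_trans (b2 z) _; rewrite addrAC lerDr addr_ge0 ?(le_trans _ (b1 z)) ?(le_trans _ (b3 z)).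
- by move=> z; apply: le_trans (b3 z) _; rewrite lerDr addr_ge0 ?(le_trans _ (b1 z)) ?(le_trans _ (b2 z)).
- by move=> z /trunc_support[].
- by move=> z /trunc_support[].
- by move=> z /trunc_support[].
- by move=> z /trunc_support[].
Qed.

End Truncate.
End Truncation.

(** * An integrable majorant *)

Section Dominator.
Variable R : realType.
Notation T := (measurableTypeR R * measurableTypeR R)%type.
Notation leb := (@lebesgue_measure R).
Implicit Types (c e t x : R) (z : R * R).

Lemma integrable_reflect c (f : R -> R) : leb.-integrable setT (EFin \o f) ->
  leb.-integrable setT (EFin \o (fun x => f (c - x))).
Proof.
move=> jf; have mf : measurable_fun setT f by apply/measurable_EFinP; exact: (measurable_int _ jf).
apply/integrableP; split.
  by apply/measurable_EFinP; apply: measurableT_comp => //; exact: measurable_funB.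
have /integrableP[_] := jf; rewrite -(ge0_integral_reflect c (f := fun x => `|f x|))//.
exact: measurableT_comp.
Qed.

Definition power01 e : R -> R := (fun r => r `^ e) \_ `]0, 1].

Lemma integrable_power01 e : - 1 < e -> leb.-integrable setT (EFin \o power01 e).
Proof.
move=> e1; have mI : measurable (`]0, 1]%classic : set (measurableTypeR R)) by exact: measurable_itv.
exact: (integrable_patch mI (integrable_powR01 e1)).
Qed.

Lemma power01_ge0 e x : 0 <= power01 e x.
Proof. by rewrite /power01 patchE; case: ifP => // _; exact: powR_ge0. Qed.

Lemma power01E e x : 0 < x <= 1 -> power01 e x = x `^ e.
Proof. by move=> h; rewrite /power01 patchE mem_set//= in_itv. Qed.

(** Majorant in x: a power singularity at 0 and quadratic decay at infinity. *)
Definition space_kernel e x : R := power01 e x + power01 e (0 - x) + 2 / (1 + x ^+ 2).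

Lemma integrable_space_kernel e : - 1 < e -> leb.-integrable setT (EFin \o space_kernel e).
Proof.
move=> e1; have i1 := integrable_power01 e1.
have i3 := integrableZl measurableT 2 (integrable_invDsqr R).
have := integrableD measurableT (integrableD measurableT i1 (integrable_reflect 0 i1)) i3.
by apply: eq_integrable => // x _ /=.
Qed.

Lemma space_kernel_ge0 e x : 0 <= space_kernel e x.
Proof. by rewrite !addr_ge0 ?power01_ge0// divr_ge0// addr_ge0 ?sqr_ge0. Qed.

Lemma space_kernel_ge e x : x != 0 -> `|x| <= 1 -> `|x| `^ e <= space_kernel e x.
Proof.
move=> x0 x1; have d : 0 <= 2 / (1 + x ^+ 2) by rewrite divr_ge0// addr_ge0 ?sqr_ge0.
apply: (@le_trans _ _ (power01 e x + power01 e (0 - x))); last by rewrite lerDl.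
have [xp|xn] := leP 0 x.
  rewrite ger0_norm// in x1 *; rewrite -(@power01E e x) ?lerDl ?power01_ge0//.
  by rewrite x1 lt0r x0 xp.
rewrite ltr0_norm// in x1 *; rewrite sub0r -(@power01E e (- x)) ?lerDr ?power01_ge0//.
by rewrite x1 oppr_gt0 xn.
Qed.

Lemma space_kernel_ge_inv e x : 1 <= `|x| -> (x ^+ 2)^-1 <= space_kernel e x.
Proof.
move=> x1; have x2 : 1 <= x ^+ 2 by rewrite -real_normK ?num_real// exprn_ege1.
apply: (@le_trans _ _ (2 / (1 + x ^+ 2))); last by rewrite lerDr addr_ge0 ?power01_ge0.
by rewrite ler_pdivlMr ?ltr_pwDl ?sqr_ge0// ler_pdivrMl; lra.
Qed.

(** The common size of V / (1 - t), V_t and V_xx. *)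
Definition dominator g z : R := (1 - z.1) `^ (- g / 2 - 1) / (1 + similarity z.1 z.2 ^+ 2).

Lemma dominatorE g t x : t < 1 ->
  dominator g (t, x) = 4 * ((1 - t) `^ (- g / 2) / (4 * (1 - t) + x ^+ 2)).
Proof.
move=> t1; have s0 : 0 < 1 - t by rewrite subr_gt0.
have e : ((1 - t) `^ (- 2^-1)) ^+ 2 = (1 - t)^-1.
  rewrite -powR_mulrn ?powR_ge0// -powRrM.
  by rewrite (_ : _ * _ = - 1) ?powR_inv1 ?ltW//; field.
rewrite /dominator /similarity /= (powR1B_split (- g / 2) t1) !exprMn e.
have x2 := sqr_ge0 x; have d1 : 4 * (1 - t) + x ^+ 2 != 0.
  by rewrite gt_eqF// ltr_pwDl// mulr_gt0.
have d2 : 1 + x ^+ 2 * (1 - t)^-1 * 2^-1 ^+ 2 != 0.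
  have h : 0 <= x ^+ 2 * (1 - t)^-1 by exact: divr_ge0 x2 (ltW s0).
  by rewrite gt_eqF// ltr_pwDl//; exact: mulr_ge0 h (sqr_ge0 _).
have s1 : 1 - t != 0 by rewrite gt_eqF.
move: d1 d2 s1; move: (1 - t) (x ^+ 2) ((1 - t) `^ _) => s y r d1 d2 s1; field.
by rewrite s1 d1 andbT.
Qed.

End Dominator.

Section DominatorPower.
Variable R : realType.
Notation T := (measurableTypeR R * measurableTypeR R)%type.
Notation leb := (@lebesgue_measure R).
Implicit Types (a b e g q t x : R) (z : R * R).

Lemma powRN_le a b e : 0 < a -> a <= b -> 0 <= e -> b `^ (- e) <= a `^ (- e).
Proof.
move=> a0 ab e0; have b0 := lt_le_trans a0 ab.
by rewrite !powRN lef_pV2 ?posrE ?powR_gt0// ge0_ler_powR// nnegrE ltW.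
Qed.

(** The interpolation 4 s + x^2 >= s^th |x|^(2 (1 - th)), a form of the
    arithmetic-geometric inequality, separates the variables near the
    singularity. *)
Lemma parabolic_interpolation (s x th q : R) : 0 < s <= 1 -> x != 0 -> 0 <= th <= 1 -> 1 <= q ->
  (4 * s + x ^+ 2) `^ (- q) <= s `^ (- (th * q)) * space_kernel (- (2 * (1 - th) * q)) x.
Proof.
move=> /andP[s0 s1] x0 /andP[th0 th1] q1.
have q0 : 0 <= q by lra.
have x2 : 0 < x ^+ 2 by rewrite exprn_even_gt0.
have xn : 0 < `|x| by rewrite normr_gt0.
set m := 4 * s + x ^+ 2; have ms : s <= m by rewrite /m; lra.
have mx : x ^+ 2 <= m by rewrite /m lerDr mulr_ge0// ltW.
have m0 : 0 < m := lt_le_trans s0 ms.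
have a0 : 0 <= th * q by rewrite mulr_ge0.
have b0 : 0 <= (1 - th) * q by rewrite mulr_ge0// subr_ge0.
have [x1|x1] := leP `|x| 1.
  have -> : - q = - (th * q) + - ((1 - th) * q) by ring.
  rewrite powRD; last by apply/implyP => _; rewrite gt_eqF.
  apply: ler_pM; rewrite ?powR_ge0//; first exact: powRN_le.
  apply: le_trans (space_kernel_ge _ x0 x1); apply: (le_trans (powRN_le x2 mx b0)).
  rewrite -(real_normK (num_real x)) -(powR_mulrn 2 (ltW xn)) -powRrM.
  by have -> : 2%:R * - ((1 - th) * q) = - (2 * (1 - th) * q) by ring.
apply: (@le_trans _ _ (1 * space_kernel (- (2 * (1 - th) * q)) x)); last first.
  apply: (ler_wpM2r (space_kernel_ge0 _ _)).
  by rewrite -[leLHS](powRr0 s) ger_powR ?s0// oppr_le0.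
rewrite mul1r; apply: le_trans (space_kernel_ge_inv _ (ltW x1)).
have x21 : 1 <= x ^+ 2 by rewrite -real_normK ?num_real// exprn_ege1// ltW.
have qN : - q <= - 1 by rewrite lerN2.
have := ler_powR x21 qN; rewrite powR_inv1 ?(ltW x2)//; apply: le_trans.
exact: (powRN_le x2 mx q0).
Qed.

Lemma dominator_powR_le g q th t x : 0 < t < 1 -> x != 0 -> 0 <= th <= 1 -> 1 <= q ->
  dominator g (t, x) `^ q <=
  4 `^ q * ((1 - t) `^ (- (q * (g / 2 + th))) * space_kernel (- (2 * (1 - th) * q)) x).
Proof.
move=> /andP[t0 t1] x0 th01 q1; have s0 : 0 < 1 - t by rewrite subr_gt0.
have s1 : 1 - t <= 1 by rewrite lerBlDr lerDl ltW.
have m0 : 0 <= 4 * (1 - t) + x ^+ 2 by rewrite addr_ge0 ?sqr_ge0// mulr_ge0// ltW.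
rewrite dominatorE// powRM ?divr_ge0 ?powR_ge0//; apply: ler_wpM2l; first exact: powR_ge0.
have mi : 0 <= (4 * (1 - t) + x ^+ 2)^-1 by rewrite invr_ge0.
rewrite (powRM _ (powR_ge0 _ _) mi) -powRrM -(powR_inv1 m0) -powRrM mulN1r.
have -> : - (q * (g / 2 + th)) = - g / 2 * q + - (th * q) by ring.
rewrite [in leRHS]powRD; last by apply/implyP => _; rewrite gt_eqF.
rewrite -[leRHS]mulrA; apply: ler_wpM2l; first exact: powR_ge0.
by apply: parabolic_interpolation; rewrite ?s0.
Qed.

Lemma leb2_axis : leb2 R [set z | z.2 = 0] = 0%E.
Proof.
rewrite (_ : [set z : R * R | z.2 = 0] = setT `*` [set 0]); last first.
  by apply/seteqP; split=> -[t x] //= [].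
rewrite [LHS]product_measure1E//.
transitivity (@lebesgue_measure R setT * 0)%E; last exact: mule0.
by congr (_ * _)%E; exact: lebesgue_measure_set1.
Qed.

Lemma measurable_Qdom : @measurable _ T (@Qdom R).
Proof.
rewrite (_ : @Qdom R = `]0, 1[ `*` setT); first exact: measurableX.
by apply/seteqP; split=> -[t x] /=; rewrite in_itv /=; [move=> [-> ->]|case=> /andP[]].
Qed.

Lemma measurable_dominator g : @measurable_fun _ _ T R setT (dominator g).
Proof.
have m : measurable_fun setT (fun y : R => (1 + y ^+ 2)^-1).
  by apply: continuous_measurable_fun; exact: continuous_oneDsqrV.
exact: (measurable_selfsim (- g / 2 - 1) m).
Qed.

Lemma dominator_ge0 g z : 0 <= dominator g z.
Proof. by rewrite divr_ge0 ?powR_ge0// addr_ge0 ?sqr_ge0. Qed.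

(** This is where the admissible range of g comes from: an exponent th as
    required exists exactly when g < 3 / q - 2. *)
Lemma integrable_dominator_powR g q : 1 < q -> 0 < g -> g < 3 / q - 2 ->
  (leb2 R).-integrable (@Qdom R) (EFin \o (fun z => dominator g z `^ q)).
Proof.
move=> q1 g0 gq; have q0 : 0 < q by lra.
have [u [u0 u1 qu gu]] : exists u, [/\ 0 < u, u < 1, q * u = 1 & g < 3 * u - 2].
  by exists q^-1; split; rewrite ?invr_gt0 ?invf_lt1 ?divff// gt_eqF.
have [th [th01 e1 e2]] : exists th, [/\ 0 <= th <= 1, g / 2 + th < u & 2 * (1 - th) < u].
  by exists ((1 - u / 2 + (u - g / 2)) / 2); split; [apply/andP; split|..]; lra.
have h1 : - 1 < - (q * (g / 2 + th)) by rewrite ltrN2 -[ltRHS]qu ltr_pM2l.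
have h2 : - 1 < - (2 * (1 - th) * q) by rewrite ltrN2 mulrC -[ltRHS]qu ltr_pM2l.
pose E z := 4 `^ q * (power01 (- (q * (g / 2 + th))) (1 - z.1) *
  space_kernel (- (2 * (1 - th) * q)) z.2).
have iE : (leb2 R).-integrable setT (EFin \o E).
  have i1 := integrable_reflect 1 (integrable_power01 h1).
  have i2 := integrable_space_kernel h2.
  exact: (integrableZl measurableT (4 `^ q) (integrable_prod_mul i1 i2)).
have mE : @measurable_fun _ _ T R setT E by apply/measurable_EFinP; exact: (measurable_int _ iE).
have mQ := measurable_Qdom.
have mD : @measurable_fun _ _ T R setT (fun z => dominator g z `^ q).
  apply: (@measurableT_comp _ _ _ _ _ _ (fun s : R => s `^ q)); first exact: measurable_powR.
  exact: measurable_dominator.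
apply/integrableP; split; first by apply/measurable_EFinP; exact: measurable_funTS.
have iEQ := integrableS measurableT mQ (@subsetT _ _) iE.
have /integrableP[_] := iEQ; apply: le_lt_trans.
apply: ae_ge0_le_integral => //.
- by apply: measurableT_comp => //; apply/measurable_EFinP; exact: measurable_funTS.
- by apply: measurableT_comp => //; apply/measurable_EFinP; exact: measurable_funTS.
- exists [set z | z.2 = 0]; split.
  + rewrite (_ : [set z : R * R | z.2 = 0] = setT `*` [set 0]); first exact: measurableX.
    by apply/seteqP; split=> -[t x] //= [].
  + exact: leb2_axis.
  + move=> [t x] /= h; apply: contra_notP h => /eqP x0 [/= t0 t1].
    rewrite lee_fin ger0_norm ?powR_ge0// (le_trans _ (ler_norm _))// /E /=.
    have t01 : 0 < t < 1 by rewrite t0.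
    rewrite power01E; first exact: dominator_powR_le (ltW q1).
    by rewrite subr_gt0 t1 lerBlDr lerDl ltW.
Qed.

End DominatorPower.

(** * Locality of weak derivatives *)

Section Localization.
Variable R : realType.
Notation T := (measurableTypeR R * measurableTypeR R)%type.
Implicit Types (U W : set (R * R)) (a b : R) (f g phi : R * R -> R) (z : R * R).

Lemma iter_derive_near0 vs phi z : (\near z, phi z = 0) ->
  \near z, iter_derive vs phi z = 0.
Proof.
move=> h; elim: vs => [//|v vs IH] /=.
have /nbhs_interior IH' := IH; near=> w.
rewrite (@near_eq_derive R _ _ _ (fun=> 0) w v); last by near: w.
exact: derive_cst.
Unshelve. all: by end_near. Qed.

Lemma iter_derive_support U vs phi z : test_function U phi -> ~ U z ->
  iter_derive vs phi z = 0.
Proof.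
move=> [_ _ sU] nz; have nc : ~ closure [set z | phi z != 0] z by move=> /sU.
have [|h] := pselect (\near z, phi z = 0); first by move=> /(iter_derive_near0 vs)/nbhs_singleton.
case: nc => B zB; apply: contrapT => nB; apply: h.
apply: filterS zB => w Bw; apply/eqP; apply: contra_notT nB => pw.
by exists w.
Qed.

Lemma test_functionS U W phi : U `<=` W -> test_function U phi -> test_function W phi.
Proof. by move=> UW [? ? s]; split=> //; exact: subset_trans UW. Qed.

Lemma integral_test_restrict U W vs f phi : @measurable _ T U -> @measurable _ T W -> U `<=` W ->
  test_function U phi ->
  \int[leb2 R]_(z in W) (f z * iter_derive vs phi z) =
  \int[leb2 R]_(z in U) (f z * iter_derive vs phi z).
Proof.
move=> mU mW UW hp; rewrite [LHS]Rintegral_mkcond [RHS]Rintegral_mkcond.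
congr fine; apply: eq_integral => z _; rewrite !patchE.
have [zU|zU] := boolP (z \in U); first by rewrite (mem_set (UW _ (set_mem zU))).
case: ifP => // _; rewrite (iter_derive_support vs hp) ?mulr0//.
by move: zU; rewrite notin_setE.
Qed.

Definition strip a b : set (R * R) := [set z | a < z.1 < b].

Lemma measurable_strip a b : @measurable _ T (strip a b).
Proof.
rewrite (_ : strip a b = `]a, b[ `*` setT); first exact: measurableX.
by apply/seteqP; split=> -[t x] /=; rewrite in_itv /= /strip /=; [|case].
Qed.

(** Exhaust the strip by boxes at distance e n from its boundary. *)
Lemma weak_derivative_ae_eq_strip vs a b f f' g g' : a < b ->
  box_integrable (strip a b) g -> box_integrable (strip a b) g' ->
  (forall phi, test_function (strip a b) phi ->
    \int[leb2 R]_(z in strip a b) (f z * iter_derive vs phi z) =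
        (-1) ^+ size vs * \int[leb2 R]_(z in strip a b) (g z * phi z)) ->
  (forall phi, test_function (strip a b) phi ->
    \int[leb2 R]_(z in strip a b) (f' z * iter_derive vs phi z) =
        (-1) ^+ size vs * \int[leb2 R]_(z in strip a b) (g' z * phi z)) ->
  (forall z, strip a b z -> f z = f' z) ->
  {ae leb2 R, forall z, strip a b z -> g z = g' z}.
Proof.
move=> ab ig ig' hg hg' ff'.
pose e n : R := (b - a) / n.+3%:R.
have e0 n : 0 < e n by rewrite divr_gt0 ?subr_gt0.
have e3 n : 3 * e n <= b - a.
  by rewrite mulrC -mulrA ler_piMr ?subr_ge0 ?(ltW ab)// ler_pdivrMl// mulr1 ler_nat.
have sub n : `[a + e n, b - 2 * e n + e n] `*` `[- n%:R, n%:R + e n] `<=` strip a b.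
  move=> [t x] [/= + _]; rewrite in_itv /= /strip /= => /andP[h1 h2].
  by have := e0 n; have := e3 n; move: (e n) h1 h2 => u h1 h2 h3 h4; apply/andP; split; lra.
have H n := weak_derivative_ae_eq (measurable_strip a b) (e0 n) (@sub n) ig ig' hg hg' ff'.
have := ae_foralln H.
apply: (@filterS _ _ (ae_leb2_filter R)) => -[t x] h; rewrite /strip /= => /andP[ta tb].
pose m := maxn (Num.truncn `|x|).+1 (Num.truncn ((b - a) * (2 / (b - t) + 1 / (t - a)))).
have [xm em] : `|x| < m%:R /\ e m * (2 / (b - t) + 1 / (t - a)) < 1.
  have s0 : 0 < 2 / (b - t) + 1 / (t - a) by rewrite addr_gt0 ?divr_gt0 ?subr_gt0.
  split; first by rewrite (lt_le_trans (truncnS_gt _))// ler_nat leq_max leqnn.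
  rewrite /e mulrAC ltr_pdivrMr// [ltRHS]mul1r; apply: (lt_le_trans (truncnS_gt _)).
  rewrite ler_nat ltnS; do 2 apply: leqW.
  exact: leq_maxr.
have := h m; have := e0 m; move: em; move: (e m) => u em u0 hu.
have r1 : 0 < t - a by rewrite subr_gt0.
have r2 : 0 < b - t by rewrite subr_gt0.
have p1 : 0 < u * (1 / (t - a)) by rewrite mulr_gt0// divr_gt0.
have p2 : 0 < u * (2 / (b - t)) by rewrite mulr_gt0// divr_gt0.
rewrite mulrDr in em.
have q1 : u < t - a.
  have : u * (1 / (t - a)) < 1 by lra.
  by rewrite mul1r ltr_pdivrMr// mul1r.
have q2 : u * 2 < b - t.
  have : u * (2 / (b - t)) < 1 by lra.
  by rewrite mulrA ltr_pdivrMr// mul1r.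
move: xm; rewrite ltr_norml => /andP[x1 x2].
by apply: hu; split; rewrite /= in_itv /=; apply/andP; split; lra.
Qed.

Lemma QdomE : @Qdom R = strip 0 1.
Proof. by apply/seteqP; split=> z; rewrite /strip /= => /andP. Qed.

End Localization.

(** * The dual solution *)

Section DualSolution.
Variable R : realType.
Notation T := (measurableTypeR R * measurableTypeR R)%type.
Implicit Types (z : R * R) (t x y e : R).
Variables (g alpha : R) (Psi Psi1 Psi2 A : R -> R) (C : R).
Hypothesis hp : profile g alpha Psi Psi1 Psi2 A C.
Hypothesis g0 : 0 < g.

Definition dual z := selfsim (- g / 2) Psi z.
Definition dual_t z := selfsim (- g / 2 - 1) (fun y => g / 2 * Psi y + y / 2 * Psi1 y) z.
Definition dual_x z := selfsim (- g / 2 - 2^-1) Psi1 z / 2.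
Definition dual_xx z := selfsim (- g / 2 - 1) Psi2 z / 4.

Lemma dual_heat z : dual_t z = - (A (similarity z.1 z.2) * dual_xx z).
Proof.
have := profile_eq hp (similarity z.1 z.2); rewrite /dual_t /dual_xx /selfsim.
move: (similarity _ _) (_ `^ _) => y r h; move: (A y) (Psi y) (Psi1 y) (Psi2 y) h => a u v w h.
have e : a * w = - (2 * y * v + 2 * g * u) by lra.
have -> : a * (r * w / 4) = r / 4 * (a * w) by field.
by rewrite e; field.
Qed.

Let cPsi : continuous Psi. Proof. by move=> y; exact: is_derive1_continuous (profile_d1 hp y). Qed.
Let cPsi1 : continuous Psi1. Proof. by move=> y; exact: is_derive1_continuous (profile_d2 hp y). Qed.

Lemma dual_half_plane : half_plane_C12 dual dual_t dual_x dual_xx.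
Proof.
have cf : continuous (fun y => g / 2 * Psi y + y / 2 * Psi1 y).
  move=> y; apply: cvgD; apply: cvgM; [exact: cvg_cst|exact: cPsi| |exact: cPsi1].
  by apply: cvgM; [exact: cvg_id|exact: cvg_cst].
have cPsi2 := profile_continuous hp.
have m (F : R -> R) : continuous F -> measurable_fun setT F by exact: continuous_measurable_fun.
split.
- move=> t x t1; apply: (is_derive1_eq (selfsim_dt (- g / 2) x t1 (profile_d1 hp))).
  by rewrite /dual_t /selfsim /=; congr (_ * _); ring.
- by move=> t x t1; exact: selfsim_dx t1 (profile_d1 hp).
- move=> t x t1; have h := selfsim_dx (- g / 2 - 2^-1) x t1 (profile_d2 hp).
  rewrite /dual_x; derive_eq; rewrite /dual_xx (_ : - g / 2 - 2^-1 - 2^-1 = - g / 2 - 1).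
    by field.
  by field.
- move=> z z1; split.
  + exact: selfsim_continuous.
  + exact: selfsim_continuous.
  + by apply: cvgM; [exact: selfsim_continuous|exact: cvg_cst].
  + by apply: cvgM; [exact: selfsim_continuous|exact: cvg_cst].
- split.
  + by apply: measurable_selfsim; exact: m.
  + by apply: measurable_selfsim; exact: m.
  + by apply: measurable_funM => //; apply: measurable_selfsim; exact: m.
  + by apply: measurable_funM => //; apply: measurable_selfsim; exact: m.
Qed.

Lemma selfsim_le e F K z : @Qdom R z -> - g / 2 - 1 <= e ->
  (forall y, `|F y| <= K / (1 + y ^+ 2)) -> `|selfsim e F z| <= K * dominator g z.
Proof.
move=> [t0 t1] he hF; have s0 : 0 < 1 - z.1 by rewrite subr_gt0.
have s1 : 1 - z.1 <= 1 by rewrite lerBlDr lerDl ltW.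
rewrite /selfsim /dominator normrM ger0_norm ?powR_ge0//.
rewrite (_ : K * _ = (1 - z.1) `^ (- g / 2 - 1) * (K / (1 + similarity z.1 z.2 ^+ 2))); last by ring.
by apply: ler_pM; rewrite ?powR_ge0// ger_powR// s0.
Qed.

Let C0 : 0 <= C.
Proof.
have [+ _ _] := profile_bound hp 0; rewrite expr0n addr0 divr1; exact: le_trans.
Qed.

(** All the terms produced by the truncation share one majorant: the singular
    factor 1/(1 - t) only ever multiplies the function itself. *)
Lemma dual_bounds : exists2 K, 0 <= K & forall z, @Qdom R z ->
  [/\ `|dual z| <= K * dominator g z, `|dual z| / (1 - z.1) <= K * dominator g z,
      `|dual_t z| <= K * dominator g z, `|dual_x z| <= K * dominator g z &
      `|dual_xx z| <= K * dominator g z].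
Proof.
have b0 y : `|Psi y| <= C / (1 + y ^+ 2) by have [] := profile_bound hp y.
have b1 y : (1 + `|y|) * `|Psi1 y| <= C / (1 + y ^+ 2) by have [] := profile_bound hp y.
have b2 y : `|Psi2 y| <= C / (1 + y ^+ 2) by have [] := profile_bound hp y.
have b1' y : `|Psi1 y| <= C / (1 + y ^+ 2).
  by apply: le_trans (b1 y); rewrite ler_peMl// lerDl.
have bt y : `|g / 2 * Psi y + y / 2 * Psi1 y| <= (g + 1) * C / (1 + y ^+ 2).
  apply: le_trans (ler_normD _ _) _; rewrite !normrM (gtr0_norm g0) ger0_norm//.
  have h1 : `|y| * `|Psi1 y| <= C / (1 + y ^+ 2).
    by apply: le_trans (b1 y); rewrite ler_wpM2r// lerDr.
  have h2 := ler_wpM2l (ltW g0) (b0 y).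
  have c1 : 0 <= C / (1 + y ^+ 2) by rewrite divr_ge0// addr_ge0 ?sqr_ge0.
  have c2 : 0 <= g * (C / (1 + y ^+ 2)) by rewrite mulr_ge0// ltW.
  rewrite -[leRHS]mulrA; move: h1 h2 c1 c2; move: (C / _) => d.
  by move: `|y| `|Psi y| `|Psi1 y| => a b c; lra.
exists ((g + 1) * C) => [|z Qz]; first by rewrite mulr_ge0// addr_ge0// ltW.
have D0 := dominator_ge0 g z.
have up u : u <= C * dominator g z -> u <= (g + 1) * C * dominator g z.
  move=> h; apply: le_trans h _; rewrite ler_wpM2r//.
  by rewrite mulrDl mul1r lerDr mulr_ge0// ltW.
have [t0 t1] := Qz.
split.
- by apply: up; apply: selfsim_le => //; lra.
- apply: up; have s0 : 0 < 1 - z.1 by rewrite subr_gt0.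
  rewrite -{1}(gtr0_norm s0) -normf_div.
  rewrite (_ : dual z / _ = selfsim (- g / 2 - 1) Psi z); first exact: selfsim_le.
  by rewrite /dual /selfsim (powR1B_split (- g / 2) t1); field; rewrite gt_eqF.
- exact: selfsim_le.
- rewrite /dual_x normrM (ger0_norm (x := 2^-1))//.
  apply: (@le_trans _ _ `|selfsim (- g / 2 - 2^-1) Psi1 z|).
    by rewrite ler_piMr// invf_le1// ler1n.
  by apply: up; apply: selfsim_le => //; lra.
- rewrite /dual_xx normrM (ger0_norm (x := 4^-1))//.
  apply: (@le_trans _ _ `|selfsim (- g / 2 - 1) Psi2 z|).
    by rewrite ler_piMr// invf_le1// ler1n.
  by apply: up; apply: selfsim_le.
Qed.

End DualSolution.

(** * The dual identity *)

Section DualIdentity.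
Variable R : realType.
Notation T := (measurableTypeR R * measurableTypeR R)%type.
Implicit Types (A F : R * R -> R) (z : R * R) (t x p q : R).

Lemma Lp_setT p A : 1 <= p -> Lp p setT A -> @measurable_fun _ _ T R setT A /\
  (leb2 R).-integrable setT (EFin \o (fun z => `|A z| `^ p)).
Proof.
move=> p1; rewrite /Lp (_ : A \_ setT = A); last first.
  by apply/funext => z; rewrite patchE in_setT.
move=> LA; split; last exact: (Lfun_integrable p1 LA).
by move: LA; rewrite inE => /andP[/[!inE]/= mA _].
Qed.

(** Dominated convergence against a fixed L_p function, with Young's inequality
    in place of Hoelder's. *)
Lemma Lp_dual_limit p q A D (F_ : nat -> R * R -> R) F (U : set (R * R)) :
  @measurable _ T U -> 0 < p -> 0 < q -> p^-1 + q^-1 = 1 ->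
  @measurable_fun _ _ T R setT A ->
  (leb2 R).-integrable setT (EFin \o (fun z => `|A z| `^ p)) ->
  (leb2 R).-integrable U (EFin \o (fun z => D z `^ q)) -> (forall z, U z -> 0 <= D z) ->
  (forall n, @measurable_fun _ _ T R setT (F_ n)) -> @measurable_fun _ _ T R setT F ->
  (exists2 K, 0 <= K & forall n z, U z -> `|F_ n z| <= K * D z) ->
  (forall z, U z -> F_ n z @[n --> \oo] --> F z) ->
  (leb2 R).-integrable U (EFin \o (fun z => A z * F z)) /\
  \int[leb2 R]_(z in U) (A z * F_ n z) @[n --> \oo] --> \int[leb2 R]_(z in U) (A z * F z).
Proof.
move=> mU p0 q0 pq mA iA iD D0 mF_ mF [K K0 FK] cF.
pose G z := K * (p^-1 * `|A z| `^ p + q^-1 * D z `^ q).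
have iG : (leb2 R).-integrable U (EFin \o G).
  have iA' := integrableS measurableT mU (@subsetT _ _) iA.
  have h := integrableD mU (integrableZl mU p^-1 iA') (integrableZl mU q^-1 iD).
  exact: (integrableZl mU K h).
have bnd n z : U z -> `|A z * F_ n z| <= G z.
  move=> Uz; rewrite normrM /G.
  apply: (@le_trans _ _ (K * (`|A z| * D z))).
    by rewrite mulrCA ler_wpM2l// FK.
  rewrite ler_wpM2l//.
  by have := conjugate_powR (normr_ge0 (A z)) (D0 _ Uz) p0 q0 pq; rewrite !(mulrC _^-1).
have cAF z : U z -> A z * F_ n z @[n --> \oo] --> A z * F z.
  by move=> Uz; apply: cvgM; [exact: cvg_cst|exact: cF].
have mAF_ n : @measurable_fun _ _ T R U (fun z => A z * F_ n z).
  by apply: measurable_funTS; exact: measurable_funM.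
have mAF : @measurable_fun _ _ T R U (fun z => A z * F z).
  by apply: measurable_funTS; exact: measurable_funM.
split.
  apply: (@le_integrableR _ T R (leb2 R) U mU _ G) => // z Uz.
  have c : `|A z * F_ n z| @[n --> \oo] --> `|A z * F z|.
    exact: cvg_norm (cAF z Uz).
  by apply: (ler_cvg_to c (cvg_cst (G z))); apply: nearW => n; exact: bnd.
exact: (@dominated_cvg_Rintegral _ T R (leb2 R) U mU _ _ G).
Qed.

Lemma ae_eq_Rintegral (U : set (R * R)) A F : @measurable _ T U ->
  @measurable_fun _ _ T R U A -> @measurable_fun _ _ T R U F ->
  {ae leb2 R, forall z, U z -> A z = F z} ->
  \int[leb2 R]_(z in U) A z = \int[leb2 R]_(z in U) F z.
Proof.
move=> mU mA mF h; congr fine; apply: ae_eq_integral => //; try exact/measurable_EFinP.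
by apply: (@filterS _ _ (ae_leb2_filter R)) h => z h Uz; rewrite /= h.
Qed.

Lemma leb2_vertical (c : R) : leb2 R [set z | z.1 = c] = 0%E.
Proof.
rewrite (_ : [set z : R * R | z.1 = c] = [set c] `*` setT); last first.
  by apply/seteqP; split=> -[t x] //= [].
rewrite [LHS]product_measure1E//.
transitivity (0 * @lebesgue_measure R setT)%E; last exact: mul0e.
by congr (_ * _)%E; exact: lebesgue_measure_set1.
Qed.

Lemma integral_eq_Qdom A F : @measurable_fun _ _ T R setT A -> @measurable_fun _ _ T R setT F ->
  {ae leb2 R, forall z, z.1 < 0 -> A z = 0} -> (forall z, 1 <= z.1 -> F z = 0) ->
  \int[leb2 R]_z (A z * F z) = \int[leb2 R]_(z in @Qdom R) (A z * F z).
Proof.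
move=> mA mF A0 F1; have mQ := @measurable_Qdom R.
have mAF : @measurable_fun _ _ T R setT (fun z => A z * F z) by exact: measurable_funM.
rewrite [RHS]Rintegral_mkcond; apply: ae_eq_Rintegral => //.
  by apply/(measurable_restrictT _ mQ); exact: measurable_funTS.
have N0 : {ae leb2 R, forall z, z.1 <> 0}.
  exists [set z | z.1 = 0]; split; [|exact: leb2_vertical|by move=> z /= /contrapT].
  rewrite (_ : [set z : R * R | z.1 = 0] = [set 0] `*` setT); first exact: measurableX.
  by apply/seteqP; split=> -[t x] //= [].
have N1 : {ae leb2 R, forall z, z.1 <> 0 /\ (z.1 < 0 -> A z = 0)}.
  exact: (@filterI _ _ (ae_leb2_filter R) _ _ N0 A0).
apply: (@filterS _ _ (ae_leb2_filter R)) N1 => z [/eqP nz hz] _.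
rewrite patchE; case: ifPn => // /negP nQ.
have [z1|z1] := ltP z.1 0; first by rewrite hz// mul0r.
have [z2|z2] := ltP z.1 1; last by rewrite F1// mulr0.
by case: nQ; apply: mem_set; split => //; rewrite lt0r nz z1.
Qed.

Section Truncations.
Variables (H Ht Hx Hxx D : R * R -> R) (K : R).
Hypothesis hH : half_plane_C12 H Ht Hx Hxx.
Hypotheses (K0 : 0 <= K) (D0 : forall z, 0 <= D z).
Hypothesis HD : forall z, @Qdom R z -> [/\ `|H z| <= K * D z, `|H z| / (1 - z.1) <= K * D z,
  `|Ht z| <= K * D z, `|Hx z| <= K * D z & `|Hxx z| <= K * D z].

Lemma trunc_dominated : exists2 M, 0 <= M & forall n z, @Qdom R z ->
  `|trunc_t H Ht n z| <= M * D z /\ `|trunc_xx H Hx Hxx n z| <= M * D z.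
Proof.
have [C1 p1 b1] := space_cutoff_bounded R; have [C2 p2 b2] := time_cutoff'_bounded R.
have c1 n t : `|time_cutoff n t| <= 1 by exact: time_cutoff_le1.
exists ((C2 * C1 + 4 * C1) * K) => [|n z Qz].
  by rewrite mulr_ge0// addr_ge0// mulr_ge0.
have [t0 t1] := Qz; have [e1 e2 e3 e4 e5] := HD Qz.
have [f1 f2 f3] := b1 n z.2; have t01 : 0 < z.1 < 1 by rewrite t0.
have h2 := b2 n z.1 t01; have h1 := c1 n z.1.
have KD : 0 <= K * D z by rewrite mulr_ge0.
have m (a b c u v w : R) : `|a| <= u -> `|b| <= v -> `|c| <= w -> `|a * b * c| <= u * v * w.
  by move=> ha hb hc; rewrite !normrM !ler_pM// mulr_ge0.
have k1 : `|time_cutoff' n z.1 * space_cutoff n z.2 * H z| <= C2 * C1 * (K * D z).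
  apply: le_trans (m _ _ _ _ _ _ h2 f1 (lexx _)) _.
  have -> : C2 / (1 - z.1) * C1 * `|H z| = C2 * C1 * (`|H z| / (1 - z.1)) by ring.
  by rewrite ler_wpM2l// mulr_ge0.
rewrite /trunc_t /trunc_xx; split.
  apply: le_trans (ler_normD _ _) _.
  have := m _ _ _ _ _ _ h1 f1 e3; rewrite mul1r => k2.
  have : 0 <= C1 * (K * D z) by rewrite mulr_ge0.
  by move: k1 k2; rewrite -!mulrA; lra.
apply: le_trans (ler_normD _ _) _; apply: (@le_trans _ _ (4 * (C1 * (K * D z)))); last first.
  have : 0 <= C2 * (C1 * (K * D z)) by rewrite !mulr_ge0.
  by rewrite -!mulrA; lra.
have := ler_normD (time_cutoff n z.1 * space_cutoff'' n z.2 * H z)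
  (2 * (time_cutoff n z.1 * space_cutoff' n z.2 * Hx z)).
rewrite (normrM 2) (ger0_norm (ler0n R 2)).
have := m _ _ _ _ _ _ h1 f3 e1; have := m _ _ _ _ _ _ h1 f2 e4; have := m _ _ _ _ _ _ h1 f1 e5.
by rewrite mul1r; lra.
Qed.

Lemma trunc_cvg z : @Qdom R z ->
  trunc_t H Ht n z @[n --> \oo] --> Ht z /\ trunc_xx H Hx Hxx n z @[n --> \oo] --> Hxx z.
Proof.
move=> [t0 t1]; have t01 : 0 < z.1 < 1 by rewrite t0.
have [ct ct'] := time_cutoff_cvg t01; have [cs cs' cs''] := space_cutoff_cvg z.2.
rewrite /trunc_t /trunc_xx; split.
  rewrite -[X in _ --> X](_ : 0 * 1 * H z + 1 * 1 * Ht z = Ht z); last by ring.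
  apply: cvgD; apply: cvgM; (try exact: cvg_cst); exact: cvgM.
rewrite -[X in _ --> X](_ : 1 * 0 * H z + 2 * (1 * 0 * Hx z) + 1 * 1 * Hxx z = Hxx z);
  last by ring.
apply: cvgD; last by apply: cvgM; [exact: cvgM|exact: cvg_cst].
apply: cvgD; first by apply: cvgM; [exact: cvgM|exact: cvg_cst].
by apply: cvgM; [exact: cvg_cst|apply: cvgM; [exact: cvgM|exact: cvg_cst]].
Qed.

(** Passing to the limit in the truncations. No boundary term survives at t = 1
    because the derivative of the time cutoff is absorbed by the majorant, and
    none appears at t = 0 because the data vanish for t < 0. *)
Lemma dual_identity p q (ut uxx : R * R -> R) : 0 < p -> 0 < q -> p^-1 + q^-1 = 1 ->
  (leb2 R).-integrable (@Qdom R) (EFin \o (fun z => D z `^ q)) ->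
  @measurable_fun _ _ T R setT ut -> @measurable_fun _ _ T R setT uxx ->
  (leb2 R).-integrable setT (EFin \o (fun z => `|ut z| `^ p)) ->
  (leb2 R).-integrable setT (EFin \o (fun z => `|uxx z| `^ p)) ->
  {ae leb2 R, forall z, z.1 < 0 -> ut z = 0} -> {ae leb2 R, forall z, z.1 < 0 -> uxx z = 0} ->
  box_integrable setT ut -> box_integrable setT uxx ->
  (forall xi eta a b c d, box_test setT xi eta a b c d ->
    \int[leb2 R]_z (ut z * tensor xi (eta^`()^`())%classic z) +
    \int[leb2 R]_z (uxx z * tensor xi^`()%classic eta z) = 0) ->
  [/\ (leb2 R).-integrable (@Qdom R) (EFin \o (fun z => ut z * Hxx z)),
      (leb2 R).-integrable (@Qdom R) (EFin \o (fun z => uxx z * Ht z)) &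
      \int[leb2 R]_(z in @Qdom R) (ut z * Hxx z) +
      \int[leb2 R]_(z in @Qdom R) (uxx z * Ht z) = 0].
Proof.
move=> p0 q0 pq iD mut muxx iut iuxx ut0 uxx0 but buxx cancel.
have mQ := @measurable_Qdom R; have [_ mHt _ mHxx] := hp_measurable hH.
have [M M0 bM] := trunc_dominated.
have [mt mxx] : (forall n, @measurable_fun _ _ T R setT (trunc_t H Ht n)) /\
    (forall n, @measurable_fun _ _ T R setT (trunc_xx H Hx Hxx n)).
  by split=> n; have [_ ? ?] := trunc_measurable n hH.
have [i1 c1] := Lp_dual_limit mQ p0 q0 pq mut iut iD (fun z _ => D0 z) mxx mHxx
  (ex_intro2 _ _ M M0 (fun n z Qz => (bM n z Qz).2)) (fun z Qz => (trunc_cvg Qz).2).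
have [i2 c2] := Lp_dual_limit mQ p0 q0 pq muxx iuxx iD (fun z _ => D0 z) mt mHt
  (ex_intro2 _ _ M M0 (fun n z Qz => (bM n z Qz).1)) (fun z Qz => (trunc_cvg Qz).1).
split=> //.
have zero n : \int[leb2 R]_(z in @Qdom R) (ut z * trunc_xx H Hx Hxx n z) +
    \int[leb2 R]_(z in @Qdom R) (uxx z * trunc_t H Ht n z) = 0.
  have [C HC] := trunc_C12 n hH.
  have late z : 1 <= z.1 -> time_cutoff n z.1 = 0 /\ time_cutoff' n z.1 = 0.
    by move=> h; apply: time_cutoff_eq0; right; rewrite (le_trans _ h)// lerBlDr lerDl.
  rewrite -integral_eq_Qdom//; last first.
    by move=> z /late[e _]; rewrite /trunc_xx e !mul0r mulr0 !addr0.
  rewrite -integral_eq_Qdom//; last first.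
    by move=> z /late[e e']; rewrite /trunc_t e e' !mul0r addr0.
  exact: tensor_identity_extends but buxx cancel HC.
have c0 : (0 : R) @[n --> \oo] --> \int[leb2 R]_(z in @Qdom R) (ut z * Hxx z) +
    \int[leb2 R]_(z in @Qdom R) (uxx z * Ht z).
  by rewrite -(funext zero); exact: cvgD c1 c2.
by apply: cvg_unique c0 (cvg_cst _); exact: norm_hausdorff.
Qed.

End Truncations.
End DualIdentity.

(** * The counterexample *)

Section WeakDerivativeLocality.
Variable R : realType.
Notation T := (measurableTypeR R * measurableTypeR R)%type.
Implicit Types (u v g h : R * R -> R) (a b : R) (vs : seq (R * R)).

Lemma weak_derivative_restrict vs u g a b phi : weak_derivative setT vs u g ->
  test_function (strip a b) phi ->
  \int[leb2 R]_(z in strip a b) (u z * iter_derive vs phi z) =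
    (-1) ^+ size vs * \int[leb2 R]_(z in strip a b) (g z * phi z).
Proof.
move=> [_ _ h] hp; have mS := @measurable_strip R a b.
have hpT := test_functionS (@subsetT _ _) hp.
rewrite -(integral_test_restrict vs u mS measurableT (@subsetT _ _) hp).
by rewrite -(integral_test_restrict [::] g mS measurableT (@subsetT _ _) hp) -h.
Qed.

Lemma box_integrable_restrict g (U : set (R * R)) : box_integrable setT g -> box_integrable U g.
Proof. by move=> h a b c d _; exact: h. Qed.

Lemma weak_derivative_box_integrable vs u g U : weak_derivative U vs u g -> box_integrable U g.
Proof. by move=> [_ lg _]; exact: locally_integrable_box. Qed.

Lemma weak_derivative_Qdom_eq vs u v g h : weak_derivative setT vs u g ->
  weak_derivative (@Qdom R) vs v h -> (forall z, Qdom z -> v z = u z) ->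
  {ae leb2 R, forall z, Qdom z -> h z = g z}.
Proof.
move=> hu hv vu; have ih := weak_derivative_box_integrable hv.
move: hv vu ih; rewrite QdomE => -[_ _ hv] vu ih.
apply: (@weak_derivative_ae_eq_strip R vs 0 1 v u h g) => //.
- exact: box_integrable_restrict (weak_derivative_box_integrable hu).
- by move=> phi; exact: weak_derivative_restrict.
Qed.

(** On each strip ending at t = 0 the zero function has the same values as u. *)
Lemma weak_derivative_past_eq0 vs u g : weak_derivative setT vs u g ->
  (forall z, z.1 <= 0 -> u z = 0) -> {ae leb2 R, forall z, z.1 < 0 -> g z = 0}.
Proof.
move=> hu u0; have H (n : nat) : {ae leb2 R, forall z, strip (- n.+1%:R) 0 z -> g z = 0}.
  apply: (@weak_derivative_ae_eq_strip R vs (- n.+1%:R) 0 u (fun=> 0) g (fun=> 0)).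
  - by rewrite oppr_lt0.
  - exact: box_integrable_restrict (weak_derivative_box_integrable hu).
  - move=> a b c d _; have mB : @measurable _ T (`[a, b] `*` `[c, d]) by exact: measurableX.
    exact: integrable0.
  - by move=> phi; exact: weak_derivative_restrict.
  - move=> phi _; under eq_Rintegral do rewrite mul0r.
    under [in RHS]eq_Rintegral do rewrite mul0r.
    by rewrite /Rintegral integral0 mulr0.
  - by move=> z /andP[_ /ltW]; exact: u0.
have := ae_foralln H; apply: (@filterS _ _ (ae_leb2_filter R)) => z h z0.
apply: (h (Num.truncn (- z.1))); rewrite /strip /= z0 andbT ltrNl; exact: truncnS_gt.
Qed.

End WeakDerivativeLocality.

Section Counterexample.
Variable R : realType.
Notation T := (measurableTypeR R * measurableTypeR R)%type.

Lemma Lp_indic p (U B : set (R * R)) : 0 < p -> @measurable _ T B -> B `<=` U ->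
  (leb2 R B < +oo)%E -> Lp p U \1_B.
Proof.
move=> p0 mB BU Bfin; rewrite /Lp (_ : (\1_B : R * R -> R) \_ U = \1_B); last first.
  apply/funext => z; rewrite patchE indicE; case: ifPn => // zU.
  by rewrite memNset// => /BU/mem_set; apply/negP.
have mI : @measurable_fun _ _ T R setT (\1_B : R * R -> R) by exact: measurable_indic.
rewrite inE; apply/andP; split; first by rewrite inE.
rewrite inE /= /finite_norm unlock /Lnorm /=; apply: poweR_lty.
suff : (\int[leb2 R]_z (`|\1_B z| `^ p)%:E < +oo)%E by [].
have E (z : T) : (`|\1_B z| `^ p)%:E = (\1_B z : R)%:E.
  rewrite indicE; case: (z \in B); first by rewrite normr1 powR1.
  by rewrite normr0 powR0// gt_eqF.
under eq_integral do rewrite E.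
by rewrite (@integral_indic _ T R (leb2 R) setT measurableT B mB) setIT.
Qed.

(** At (1/2, 0) the similarity variable is 0, where Psi'' is negative. *)
Lemma dual_xx_lt0_box g alpha (Psi Psi1 Psi2 A : R -> R) C :
  profile g alpha Psi Psi1 Psi2 A C ->
  exists2 d, 0 < d < 2^-1 & exists2 k, 0 < k &
    forall z, (`]2^-1, 2^-1 + d] `*` `](- d), d]) z ->
      - (4 * k) <= dual_xx g Psi2 z <= - k.
Proof.
move=> hp; pose z0 : R * R := (2^-1, 0).
have h0 : dual_xx g Psi2 z0 < 0.
  rewrite /dual_xx /selfsim /similarity /= !mul0r pmulr_llt0// pmulr_rlt0 ?(profile_lt0 hp)//.
  by rewrite powR_gt0// subr_gt0 invf_lt1// ltr1n.
have z01 : z0.1 < 1 by rewrite invf_lt1// ltr1n.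
have c : {for z0, continuous (dual_xx g Psi2)}.
  apply: cvgM; last exact: cvg_cst.
  by apply: selfsim_continuous => //; exact: (profile_continuous hp).
have lt : dual_xx g Psi2 z0 < dual_xx g Psi2 z0 / 2 by lra.
have gt : 2 * dual_xx g Psi2 z0 < dual_xx g Psi2 z0 by lra.
have : nbhs z0 [set z | dual_xx g Psi2 z < dual_xx g Psi2 z0 / 2 /\
    2 * dual_xx g Psi2 z0 < dual_xx g Psi2 z].
  exact: filterI (c _ (lt_nbhsl lt)) (c _ (lt_nbhsr gt)).
move=> /nbhs_ballP[e /= e0 he].
exists (Num.min (e / 2) 4^-1).
  rewrite lt_min divr_gt0//= invr_gt0 ltr0n /= gt_min.
  by apply/orP; right; rewrite ltf_pV2 ?posrE// ltr_nat.
exists (- (dual_xx g Psi2 z0 / 2)); first by lra.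
move=> [t x] [/=]; rewrite !in_itv /= opprK => /andP[t1 t2] /andP[x1 x2].
have d1 : Num.min (e / 2) 4^-1 < e by rewrite gt_min ltr_pdivrMr// ltr_pMr// ltr1n.
have [] : dual_xx g Psi2 (t, x) < dual_xx g Psi2 z0 / 2 /\
    2 * dual_xx g Psi2 z0 < dual_xx g Psi2 (t, x).
  apply: (he (t, x)); split; rewrite /ball /= ltr_norml.
    by move: d1 t1 t2; move: (Num.min _ _) => d *; apply/andP; split; lra.
  by move: d1 x1 x2; move: (Num.min _ _) => d *; apply/andP; split; lra.
by move: (dual_xx g Psi2 z0) (dual_xx g Psi2 (t, x)) => h w *; apply/andP; split; lra.
Qed.

(** The lower bound on w serves integrability, the upper one gives the sign. *)
Lemma integral_indic_mul_lt0 (B : set (R * R)) (w : R * R -> R) k : @measurable _ T B ->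
  B `<=` @Qdom R -> (0 < leb2 R B < +oo)%E -> @measurable_fun _ _ T R setT w -> 0 < k ->
  (forall z, B z -> - (4 * k) <= w z <= - k) ->
  \int[leb2 R]_(z in @Qdom R) (\1_B z * w z) < 0.
Proof.
move=> mB BQ /andP[B0 Bfin] mw k0 wk; have mQ := @measurable_Qdom R.
pose f : R * R -> R := \1_B.
have mf : @measurable_fun _ _ T R setT f by exact: measurable_indic.
have iB : (leb2 R).-integrable (@Qdom R) (EFin \o f).
  apply: (integrableS measurableT mQ (@subsetT _ _)); apply/integrableP; split.
    exact/measurable_EFinP.
  rewrite (_ : (fun z => _) = (fun z => (f z)%:E)).
    by rewrite (@integral_indic _ T R (leb2 R) setT measurableT B mB) setIT.
  by apply/funext => z; rewrite /= ger0_norm// /f indicE.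
have fE z : f z = if z \in B then 1 else 0 by rewrite /f indicE; case: ifP.
have ifw : (leb2 R).-integrable (@Qdom R) (EFin \o (fun z => f z * w z)).
  apply: (@le_integrableR _ T R (leb2 R) _ mQ _ (fun z => 4 * k * f z)).
  - by apply: measurable_funTS; exact: measurable_funM.
  - move=> z _; rewrite fE; case: ifPn => [/set_mem/wk/andP[h1 h2]|_].
      by rewrite mul1r mulr1 ler_norml; apply/andP; split; lra.
    by rewrite mul0r mulr0 normr0.
  - exact: (integrableZl mQ (4 * k) iB).
apply: (@le_lt_trans _ _ (\int[leb2 R]_(z in @Qdom R) (- k * f z))).
  apply: le_Rintegral => //; first exact: (integrableZl mQ (- k) iB).
  move=> z _; rewrite -/(f z) fE; case: ifPn => [/set_mem/wk/andP[h1 h2]|_].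
    by rewrite mul1r mulr1.
  by rewrite mul0r mulr0.
rewrite RintegralZl// /Rintegral (@integral_indic _ T R (leb2 R) _ mQ B mB).
rewrite (setIidl BQ) mulNr oppr_lt0 mulr_gt0//.
by rewrite fine_gt0// B0.
Qed.

End Counterexample.

Theorem theorem2p3 (R : realType) (gamma : R -> R) (hgamma : admissible_gamma gamma)
    (p : R) (hp : 3 < p) :
  exists a f : R * R -> R,
    [/\ coeff_class 1 (alpha_ gamma (p / (p - 1))) a,
        Lp p (@Qdom R) f &
        ~ exists v : R * R -> R, W12_0 p v /\ solves a f v].
Proof.
pose T := (measurableTypeR R * measurableTypeR R)%type.
have p0 : 0 < p by lra.
have p1 : 0 < p - 1 by lra.
have [q [qE q1 q32 pq]] : exists q, [/\ q = p / (p - 1), 1 < q, q < 3 / 2 & p^-1 + q^-1 = 1].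
  exists (p / (p - 1)); split=> //.
  - by rewrite ltr_pdivlMr//; lra.
  - by rewrite ltr_pdivrMr//; lra.
  - by rewrite invf_div; field; rewrite gt_eqF.
have q0 : 0 < q by lra.
have q132 : 1 < q < 3 / 2 by rewrite q1.
have [g01 gq] := hgamma.1 q q132; have /andP[g0 g1] := g01.
rewrite -qE /alpha_; move: (gamma q) g01 gq g0 g1 => g g01 gq g0 g1.
have [Psi [Psi1 [Psi2 [A [C hP]]]]] := profile_exists g01.
have [d /andP[d0 d2] [k k0 hk]] := dual_xx_lt0_box hP.
pose B : set (R * R) := `]2^-1, 2^-1 + d] `*` `](- d), d].
have mB : @measurable _ T B by exact: measurableX.
have BQ : B `<=` @Qdom R.
  by move=> [t x] [/= + _]; rewrite in_itv /= => /andP[h1 h2]; split => /=; lra.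
have Bvol : leb2 R B = (d * (2 * d))%:E.
  by rewrite leb2_box; [congr EFin; ring|lra|lra].
have Bfin : (leb2 R B < +oo)%E by rewrite Bvol ltry.
have mQ := @measurable_Qdom R.
pose a (z : R * R) := A (similarity z.1 z.2).
have ma : @measurable_fun _ _ T R setT a.
  have := measurable_selfsim 0 (profile_measurable hP).
  by apply: eq_measurable_fun => z _; rewrite /selfsim powRr0 mul1r.
(* The solvable right-hand sides are orthogonal to V_xx, and the indicator of B is
   not. *)
exists a, (\1_B); split.
- by split; [exact: measurable_funTS|move=> z _; exact: (profile_range hP)].
- exact: Lp_indic.
move=> [v [[u [[_ [ux [uxx [ut [[_ Luxx Lut] [_ wuxx wut]]]]]] u0 vu]]]].
move=> [vt [vxx [wvt wvxx eqn]]].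
have [K K0 HD] := dual_bounds hP g0.
have hH := dual_half_plane hP.
have p1' : 1 <= p by lra.
have [mut iut] := Lp_setT p1' Lut; have [muxx iuxx] := Lp_setT p1' Luxx.
have cancel xi eta a' b c e : box_test setT xi eta a' b c e ->
    \int[leb2 R]_z (ut z * tensor xi (eta^`()^`())%classic z) +
    \int[leb2 R]_z (uxx z * tensor xi^`()%classic eta z) = 0.
  apply: (@tensor_cancellation R u).
  - by move=> phi hphi; have [_ _ h] := wut; rewrite h// expr1 mulN1r.
  - by move=> phi hphi; have [_ _ h] := wuxx; rewrite h// sqrrN expr1n mul1r.
have [j1 j2 J] := dual_identity hH K0 (dominator_ge0 g) HD p0 q0 pq
  (integrable_dominator_powR q1 g0 gq) mut muxx iut iuxx
  (weak_derivative_past_eq0 wut u0) (weak_derivative_past_eq0 wuxx u0)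
  (weak_derivative_box_integrable wut) (weak_derivative_box_integrable wuxx) cancel.
have et := weak_derivative_Qdom_eq wut wvt vu.
have exx := weak_derivative_Qdom_eq wuxx wvxx vu.
have [_ mHt _ mHxx] := hp_measurable hH.
have mf : @measurable_fun _ _ T R setT (\1_B : R * R -> R) by exact: measurable_indic.
have Bvol0 : (0 < leb2 R B < +oo)%E by rewrite Bfin Bvol lte_fin !mulr_gt0.
have := integral_indic_mul_lt0 mB BQ Bvol0 mHxx k0 hk; rewrite -J -RintegralD//.
rewrite (_ : \int[leb2 R]_(z in @Qdom R) (\1_B z * _) =
  \int[leb2 R]_(z in @Qdom R) (ut z * dual_xx g Psi2 z + uxx z * dual_t g Psi Psi1 z)).
  by rewrite ltxx.
(* u_t V_xx + u_xx V_t = (a u_xx + f) V_xx - a u_xx V_xx = f V_xx *)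
apply: ae_eq_Rintegral => //.
- by apply: measurable_funTS; exact: measurable_funM.
- by apply: measurable_funTS; apply: measurable_funD; exact: measurable_funM.
have h := @filterI _ _ (ae_leb2_filter R) _ _ eqn
  (@filterI _ _ (ae_leb2_filter R) _ _ et exx).
apply: (@filterS _ _ (ae_leb2_filter R)) h => z [e1 [e2 e3]] Qz.
by rewrite -(e2 Qz) -(e3 Qz) (e1 Qz) (dual_heat hP) -/(a z); ring.
Qed.
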